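(* Let $d\ge1$ be an integer, $D=d(d+1)/2$, and let $r_d$ be as defined in the context. Let $s$ be an integer, let $q$ be squarefree with at most $s$ prime factors, and let $\chi$ be a primitive Dirichlet character modulo $q$. Let $M,N,r$ be integers with $N\le q^{1/2+1/(4(r-D))}$ and $r\ge r_d+s+1$. Then for any polynomial $F(x)$ of degree $d$ with real coefficients, $$\left|\sum_{M<n\le M+N}\chi(n)e^{2\pi i F(n)}\right|\le N^{1-1/r}\,q^{\frac{r+1-D}{4r(r-D)}+o(1)}.$$
   Context: For integers $r,d,V\ge 1$, $J_{r,d}(V)$ denotes the number of integer solutions $(v_1,\dots,v_{2r})$ of the system $v_1^{i}+\dots+v_r^{i}=v_{r+1}^{i}+\dots+v_{2r}^{i}$ for $1\le i\le d$, with $1\le v_j\le V$. $r_d$ denotes the smallest integer such that for every integer $r\ge r_d$ one has $J_{r,d}(V)\le V^{2r-d(d+1)/2+o(1)}$ as $V\to\infty$. The factor $q^{o(1)}$ denotes a quantity bounded by $C(\varepsilon)q^{\varepsilon}$ for every $\varepsilon>0$, where $C(\varepsilon)$ depends only on $\varepsilon$ and the fixed parameters ($d,r,s$). *)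

(* Defs.v *)
From Stdlib Require Import Reals ZArith Znumtheory List Lia.
From Coquelicot Require Import Coquelicot.
Import ListNotations.
Open Scope R_scope.

Fixpoint tuples (V : nat) (k : nat) : list (list Z) :=
  match k with
  | O => [ [] ]
  | S k' => flat_map (fun x => map (cons x) (tuples V k'))
                     (map Z.of_nat (seq 1 V))
  end.

Definition power_sum (l : list Z) (i : nat) : Z :=
  fold_right Z.add 0%Z (map (fun v => (v ^ Z.of_nat i)%Z) l).

Definition vmvt_solution (r d : nat) (l : list Z) : bool :=
  forallb (fun i => Z.eqb (power_sum (firstn r l) i) (power_sum (skipn r l) i))
          (seq 1 d).

Definition J (r d V : nat) : nat :=
  length (filter (vmvt_solution r d) (tuples V (2 * r))).

Definition Dd (d : nat) : R := INR d * (INR d + 1) / 2.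

Definition vmvt_holds_from (d r0 : nat) : Prop :=
  forall r : nat, (1 <= r)%nat -> (r0 <= r)%nat ->
  forall eps : R, 0 < eps ->
  exists C : R, forall V : nat, (1 <= V)%nat ->
    INR (J r d V) <= C * Rpower (INR V) (2 * INR r - Dd d + eps).

Definition is_r_d (d rd : nat) : Prop :=
  (1 <= rd)%nat /\ vmvt_holds_from d rd /\
  forall r0 : nat, (1 <= r0)%nat -> vmvt_holds_from d r0 -> (rd <= r0)%nat.

Definition squarefree (q : Z) : Prop :=
  forall p : Z, prime p -> ~ Z.divide (p * p) q.

Definition omega (q : Z) : nat :=
  length (filter (fun p => if prime_dec p then Z.eqb (Z.modulo q p) 0 else false)
                 (map Z.of_nat (seq 0 (S (Z.to_nat q))))).

Definition dirichlet_character (q : Z) (chi : Z -> C) : Prop :=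
  (forall m n : Z, chi (m * n)%Z = Cmult (chi m) (chi n)) /\
  (forall n : Z, chi (n + q)%Z = chi n) /\
  (forall n : Z, chi n = RtoC 0 <-> Z.gcd n q <> 1%Z).

(* primitive: no induced modulus d | q with d < q, i.e. there is no proper
   divisor d of q with chi(n) = 1 for all n = 1 (mod d) coprime to q *)
Definition primitive_character (q : Z) (chi : Z -> C) : Prop :=
  dirichlet_character q chi /\
  ~ (exists d : Z, (1 <= d)%Z /\ (d < q)%Z /\ Z.divide d q /\
       forall n : Z, Z.gcd n q = 1%Z -> Z.modulo n d = Z.modulo 1 d ->
         chi n = RtoC 1).

Definition e (x : R) : C := (cos (2 * PI * x), sin (2 * PI * x)).

Definition poly_eval (a : nat -> R) (d : nat) (x : R) : R :=
  sum_f_R0 (fun i => a i * x ^ i) d.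

Fixpoint csum (f : nat -> C) (N : nat) : C :=
  match N with
  | O => RtoC 0
  | S N' => Cplus (csum f N') (f N)
  end.

Definition char_exp_sum (chi : Z -> C) (a : nat -> R) (d : nat) (M : Z) (N : nat) : C :=
  csum (fun k => Cmult (chi (M + Z.of_nat k)%Z)
                       (e (poly_eval a d (IZR (M + Z.of_nat k)%Z)))) N.

(* Main.v *)
Require Import Defs.
From Stdlib Require Import Reals ZArith Znumtheory List.
From Coquelicot Require Import Coquelicot.
From mathcomp Require all_boot all_order all_algebra all_field.
From Stdlib Require Import Lra Lia.
From mathcomp Require zify ring.
From mathcomp Require complex Rstruct.
Open Scope R_scope.

(* Write D = d(d+1)/2 and K = r - D. Burgess' method: shifting n by ab with a <= A, b <= B,
   AB <= N/16, changes the sum by two shorter sums of the same kind, which are bounded by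
   induction on N. Since chi(n + ab) = chi(a) chi(n/a + b), Hoelder's inequality reduces the
   averaged sum to two estimates: the number of coincidences n/a = n'/a' mod q is
   << A^2 + NA (log A)^2, and the 2r-th moment over x mod q of the sums
   \sum_{b <= B} chi(x + b) e(G(b)), uniformly in the polynomial G of degree d.
   Cauchy-Schwarz over the vectors of the first d power sums replaces the 2r-th power by
   B^D times a sum over the solutions (v_1, ..., v_2r) of Vinogradov's system. Solutions in
   which every value is repeated are few; in the others some v_k is isolated, so the complete sum over
   x is << sqrt q times the product of the primes p | q dividing prod_{j <> k} (v_j - v_k), by the Chinese
   remainder theorem and Weil's bound. At most s primes are involved, so averaging this
   product fixes at most s + 1 variables, and the other 2(r - s - 1) or more variables
   are counted by J_{r-s-1,d}. The choice B ~ q^(1/2K), A ~ N/16B gives the theorem.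

   Weil's bound for \sum_c chi(\prod_i (a_i - c)^(e_i)) is proved by Stepanov's method: the
   L-function is a polynomial by a translation argument, Stepanov's auxiliary polynomial
   bounds its even power sums over F_{p^(2 mu)}, and large mu forces every reciprocal root to
   have modulus at most sqrt p. *)

(** After the substitution the phase polynomial depends on the whole pair (a, n), not only on the
    residue n/a. The moment bound must therefore hold for every choice of phases before x is
    averaged, and the statements quantify over arbitrary unimodular coefficients, a class closed
    under affine substitutions and so stable under the induction on N. The length B ~ q^(1/2K)
    balances the two parts of the moment: q B^r, from the solutions with all values repeated, equals
    q^(1/2) B^(2r-D) when B^K = q^(1/2). The hypothesis on N is what gives A N <= q, so that a
    congruence between the products a n' and a' n leaves a bounded number of cases over the
    integers. For N <= q^(1/4+1/4K) the claim is weaker than the trivial bound. Requiring r >= r_d +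
    s + 1 leaves at least r_d pairs of variables once s + 1 pairs are given up to the primes of
    q. *)

Module Burgess.
Import all_boot all_order all_algebra all_field zify ring complex Rstruct.
Set Implicit Arguments. Unset Strict Implicit. Unset Printing Implicit Defensive.
Import Order.TTheory GRing.Theory Num.Theory.
Local Open Scope ring_scope.

(** * Stepanov's method *)

Lemma exists_linear_relation (K : fieldType) (I : finType) (n : nat)
    (P : I -> {poly K}) :
  (forall i, size (P i) <= n)%N -> (n < #|I|)%N ->
  exists u : I -> K, (exists i, u i != 0) /\ \sum_i u i *: P i = 0.
Proof.
move=> szP ltn.
pose M := \matrix_(i < #|I|, j < n) (P (enum_val i))`_j.
have : kermx M != 0.
  rewrite -mxrank_eq0 mxrank_ker -lt0n subn_gt0.
  exact: leq_ltn_trans (rank_leq_col M) ltn.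
case/rowV0Pn => v /sub_kermxP vM v0.
exists (fun i => v 0 (enum_rank i)); split.
  by case/rV0Pn: v0 => i vi; exists (enum_val i); rewrite enum_valK.
apply/polyP => j; rewrite coef_sum coef0.
have [ltj | lej] := ltnP j n; last first.
  rewrite big1 // => i _; rewrite coefZ.
  by rewrite [_`_j]nth_default ?mulr0 // (leq_trans (szP i)).
move/matrixP: vM => /(_ 0 (Ordinal ltj)); rewrite !mxE.
rewrite (reindex enum_rank) /=; last exact: onW_bij (enum_rank_bij _).
by move=> vM; rewrite -[RHS]vM; apply: eq_bigr => i _; rewrite coefZ mxE enum_rankK.
Qed.

(** The parameter count of Stepanov's method, with D the degree of f: the right side counts the
    unknown coefficients, the left side bounds the size of the polynomial to be annihilated.
    Substituting A k = Q - 1, the term A Q cancels, 2 Q D beats Q D, and 4 <= Q and A < Q absorb the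
    rest. *)
Lemma stepanov_dimension (Q A k D : nat) : (3 < Q)%N -> (A * k = Q.-1)%N ->
  ((A.-1 * Q + (A + 2 * D + 4).-1 + k.-1 * A * D).+1 < k * (A + 2 * D + 4) * A)%N.
Proof.
move=> Q3 Ak.
have A0 : (0 < A)%N by case: A Ak => //; lia.
have k0 : (0 < k)%N by case: k Ak => //; lia.
have leAQ : (A <= Q.-1)%N by rewrite -Ak leq_pmulr.
have E1 : (A.-1 * Q + Q = A * Q)%N by rewrite -{2}[A]prednK // mulSn addnC.
have E2 : (k.-1 * A * D + A * D = Q.-1 * D)%N.
  by rewrite -mulnDl -Ak [(A * k)%N]mulnC -[in RHS](prednK k0) mulSn addnC.
have E3 : (Q.-1 * D + D = Q * D)%N.
  by rewrite -{2}[Q]prednK ?mulSn 1?addnC //; lia.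
have E4 : (4 * D <= Q * D)%N by rewrite leq_mul2r Q3 orbT.
have E5 : (k * (A + 2 * D + 4) * A = Q.-1 * (A + 2 * D + 4))%N.
  by rewrite -Ak mulnAC [(k * A)%N]mulnC.
have E6 : (Q.-1 * (A + 2 * D + 4) + (A + 2 * D + 4) = Q * A + 2 * (Q * D) + 4 * Q)%N.
  rewrite addnC -mulSn prednK; last by lia.
  lia.
rewrite E5; move: E1 E2 E3 E4 E6; rewrite [(Q * A)%N]mulnC; lia.
Qed.

Section Stepanov.

Variables (L : finFieldType) (Q A k : nat) (f f1 : {poly L}) (c : L).
Hypotheses (QF : {morph (fun x : L => x ^+ Q) : x y / x + y})
  (cardL : #|L| = (Q ^ 2)%N) (Q3 : (3 < Q)%N) (Ak : (A * k = Q.-1)%N)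
  (fE : f = 'X * f1) (f10 : f1.[0] != 0) (c0 : c != 0).

Let deg := (size f).-1.
Let J := (A + 2 * deg + 4)%N.
Let T := ('I_k * 'I_J * 'I_A)%type.
(** What the term X^(a + jQ) f^(iA), for t = (i, j, a), becomes under the Q-th power: with y = f(x)
    and y^(A(Q+1)) = c one has y^(iAQ) = c^i y^(-iA), and a factor y^((k-1)A) clears the negative
    exponent. *)
Let P (t : T) : {poly L} :=
  c ^+ t.1.1 *: ('X^(t.2 * Q + t.1.2) * f ^+ ((k.-1 - t.1.1) * A)).
Let wt (t : T) : nat := (t.1.1 * A + t.2 + t.1.2 * Q)%N.

Let f_neq0 : f != 0.
Proof.
rewrite fE mulf_neq0 ?polyX_eq0 //.
by apply: contra_neq f10 => ->; rewrite horner0.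
Qed.

Let size_P t : (size (P t) <= (A.-1 * Q + J.-1 + k.-1 * A * deg).+1)%N.
Proof.
rewrite (leq_trans (size_scale_leq _ _)) //.
rewrite size_monicM ?monicXn ?expf_neq0 // size_polyXn addSn /=.
apply: (@leq_trans (t.2 * Q + t.1.2 + (k.-1 - t.1.1) * A * deg).+1).
  rewrite -addnS leq_add2l.
  apply: leq_trans (size_poly_exp_leq _ _) _.
  by rewrite mulnC.
rewrite ltnS !leq_add ?leq_mul //.
- by case: t => [[i j] a] /=; move: (ltn_ord a); lia.
- by case: t => [[i j] a] /=; move: (ltn_ord j); lia.
- by rewrite leq_subr.
Qed.

Let card_T : ((A.-1 * Q + J.-1 + k.-1 * A * deg).+1 < #|{: T}|)%N.
Proof. by rewrite !card_prod !card_ord; apply: stepanov_dimension. Qed.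

(** Mixed-radix digits: i A + a < k A < Q isolates j, and a < A then separates i from a. *)
Let wt_inj : injective wt.
Proof.
case=> [[i j] a] [[i' j'] a']; rewrite /wt /=.
have ia (i0 : 'I_k) (a0 : 'I_A) : (i0 * A + a0 < Q)%N.
  have : (i0.+1 * A <= k * A)%N by rewrite leq_mul2r ltn_ord orbT.
  by rewrite mulSn [(k * A)%N]mulnC Ak; have := ltn_ord a0; lia.
move=> E.
have Q0 : (0 < Q)%N by lia.
have E1 : j = j' :> nat.
  by have := congr1 (divn^~ Q) E; rewrite /= ![(_ + _ * Q)%N]addnC !divnMDl // !divn_small ?ia // !addn0.
have E2 : (i * A + a = i' * A + a')%N by move: E; rewrite E1; lia.
have A0 : (0 < A)%N by apply: leq_ltn_trans (ltn_ord a).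
have E3 : i = i' :> nat.
  by have := congr1 (divn^~ A) E2; rewrite /= !divnMDl // !divn_small ?ltn_ord // !addn0.
have E4 : a = a' :> nat by move: E2; rewrite E3; lia.
by congr (_, _, _); apply: val_inj.
Qed.

(* As Q-th powers are additive and x^(Q^2) = x on L, the value G(x)^Q of the auxiliary
   polynomial G becomes, on the solutions x, that of \sum_t u_t P_t up to a power of f(x); so the choice of u
   makes G vanish there. The terms of G have the distinct X-adic valuations wt t,
   whence G <> 0. *)
Lemma stepanov_count :
  (#|[set x | f.[x] ^+ (A * Q.+1) == c]| <= (A + 3 * deg + 4) * Q)%N.
Proof.
have [u [[t0 ut0] uP]] := exists_linear_relation size_P card_T.
have Q0 : (0 < Q)%N by lia.
have A0 : (0 < A)%N by case: (A) Ak => //; lia.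
have k0 : (0 < k)%N by case: (k) Ak => [|//]; rewrite muln0; lia.
pose H (t : T) : {poly L} := 'X^(t.2 + t.1.2 * Q) * f ^+ (t.1.1 * A).
pose G := \sum_t u t ^+ Q *: H t.
have HE t : H t = 'X^(wt t) * f1 ^+ (t.1.1 * A).
  rewrite /H fE exprMn mulrA -exprD /wt; congr ('X^_ * _); lia.
have G0 : G != 0.
  have [t1 ut1 mint1] := @arg_minnP _ t0 (fun t => u t != 0) wt ut0.
  suff : G`_(wt t1) != 0.
    by apply: contra_neq => ->; rewrite coef0.
  rewrite coef_sum (bigD1 t1) //= big1 ?addr0 => [|t nt].
    rewrite coefZ HE coefXnM ltnn subnn mulf_neq0 ?expf_neq0 //.
    by rewrite -horner_coef0 horner_exp expf_neq0.
  have [->|ut] := eqVneq (u t) 0.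
    by rewrite expr0n gtn_eqF // scale0r coef0.
  rewrite coefZ HE coefXnM ltn_neqAle mint1 // andbT.
  by rewrite (inj_eq wt_inj) eq_sym nt mulr0.
have rootG x : f.[x] ^+ (A * Q.+1) == c -> root G x.
  move=> /eqP fx; set y := f.[x] in fx.
  have y0 : y != 0.
    apply: contra_neq c0 => y0; rewrite -fx y0 expr0n; case: eqP => //; lia.
  have QS (I : finType) (F : I -> L) : (\sum_i F i) ^+ Q = \sum_i F i ^+ Q.
    by apply: (big_morph _ QF); rewrite expr0n gtn_eqF.
  have xQ (z : L) : z ^+ (Q * Q) = z by rewrite -{2}[z]expf_card cardL mulnn.
  have xQM (z : L) j : z ^+ (j * (Q * Q)) = z ^+ j by rewrite exprM xQ.
  have : G.[x] ^+ Q * y ^+ (k.-1 * A) = 0.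
    transitivity ((\sum_t u t *: P t).[x]); last by rewrite uP horner0.
    rewrite !horner_sum QS mulr_suml; apply: eq_bigr => t _.
    rewrite !hornerZ !hornerM !hornerXn !horner_exp -/y.
    rewrite !exprMn -!exprM xQ -!mulrA; congr (_ * _).
    rewrite -[RHS]mulrCA; congr (_ * _).
      by rewrite mulnDl -mulnA !exprD xQM.
    rewrite -fx -exprM -!exprD; congr (_ ^+ _).
    have le : (t.1.1 * A <= k.-1 * A)%N by rewrite leq_mul2r -ltnS prednK ?ltn_ord ?orbT.
    have -> : (A * Q.+1 * t.1.1 = t.1.1 * A * Q + t.1.1 * A)%N by lia.
    by rewrite mulnBl -addnA subnKC.
  move/eqP; rewrite mulf_eq0 !expf_eq0 (negPf y0) andbF orbF => /andP[_ ?].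
  exact/rootP/eqP.
rewrite cardE -ltnS.
apply: (@leq_trans (size G).+1).
  rewrite ltnS ltnW // max_poly_roots ?enum_uniq //.
  by apply/allP => x; rewrite mem_enum inE => /rootG.
rewrite ltnS; apply: (leq_trans (size_sum _ _ _)).
apply/bigmax_leqP => t _; rewrite (leq_trans (size_scale_leq _ _)) //.
rewrite size_monicM ?monicXn ?expf_neq0 // size_polyXn addSn /=.
have le1 : (size (f ^+ (t.1.1 * A)) <= (k.-1 * A * deg).+1)%N.
  apply: leq_trans (size_poly_exp_leq _ _) _; rewrite ltnS mulnC !leq_mul2r.
  by rewrite -ltnS prednK ?ltn_ord ?orbT.
have le2 : (k.-1 * A * deg <= Q * deg)%N.
  by rewrite leq_mul2r mulnC (leq_trans _ (leq_pred Q)) ?orbT // -Ak leq_mul2l leq_pred orbT.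
have le3 : (t.1.2 * Q <= (A + 2 * deg + 3) * Q)%N.
  rewrite leq_mul2r; apply/orP; right; rewrite -ltnS (leq_trans (ltn_ord _)) //.
  by rewrite /J !addnS.
have le4 : (t.2 < Q)%N.
  by apply: leq_trans (ltn_ord _) _; rewrite (leq_trans _ (leq_pred Q)) // -Ak leq_pmulr.
move: le1 le2 le3 le4; rewrite [(Q * deg)%N]mulnC !mulnDl.
move: (size _) (t.1.2 * Q)%N (k.-1 * A * deg)%N (deg * Q)%N (A * Q)%N (nat_of_ord t.2).
clear; lia.
Qed.

End Stepanov.

(** * L-functions of multiplicative functions on monic polynomials *)

Section MonicPolynomials.
Variable F : finFieldType.

Definition monics n : seq {poly F} := [seq 'X^n + rVpoly v | v : 'rV[F]_n].

Lemma mem_monics n g : (g \in monics n) = (g \is monic) && (size g == n.+1).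
Proof.
apply/mapP/andP => [[v _ ->] | [gm /eqP gs]].
  have lt : (size (rVpoly v) < size ('X^n : {poly F}))%N.
    by rewrite size_polyXn ltnS size_poly.
  by rewrite monicE lead_coefDl // lead_coefXn size_polyDl // size_polyXn !eqxx.
exists (poly_rV (g - 'X^n)); first by rewrite mem_enum.
rewrite poly_rV_K; first by rewrite addrC subrK.
apply/leq_sizeP => j; rewrite leq_eqVlt coefB coefXn => /predU1P[<- | ltj].
  by rewrite eqxx; move/monicP: gm; rewrite lead_coefE gs => ->; rewrite subrr.
by rewrite gtn_eqF // subr0 nth_default // gs.
Qed.

Lemma monics_uniq n : uniq (monics n).
Proof.
rewrite map_inj_uniq ?enum_uniq // => u v /addrI.
exact: can_inj (@rVpolyK _ _) _ _.
Qed.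

Lemma monics0 : monics 0 = [:: 1].
Proof.
apply: perm_small_eq => //; apply: uniq_perm; rewrite ?monics_uniq // => g.
rewrite mem_monics inE; apply/andP/eqP => [[gm /size_poly1P[c c0 gE]]|->].
  by move: gm; rewrite gE monicE lead_coefC => /eqP->.
by rewrite monic1 size_poly1.
Qed.

Lemma monics_mul n k P : P \in monics k ->
  perm_eq [seq g <- monics (n + k) | P %| g] [seq g * P | g <- monics n].
Proof.
rewrite mem_monics => /andP[Pm /eqP Ps].
have P0 := monic_neq0 Pm.
apply: uniq_perm.
- exact/filter_uniq/monics_uniq.
- by rewrite map_inj_uniq ?monics_uniq //; apply: mulIf.
move=> g; rewrite mem_filter mem_monics; apply/andP/mapP.
  move=> [/dvdpP[h ->]]; rewrite monicMr // => /andP[hm /eqP sz].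
  exists h => //; rewrite mem_monics hm /=.
  by apply/eqP; move: sz; rewrite size_Mmonic ?monic_neq0 // Ps; move: (size h) => z; lia.
move=> [h]; rewrite mem_monics => /andP[hm /eqP hs] ->; split; first exact: dvdp_mulIr.
by rewrite monicMr // hm size_Mmonic ?monic_neq0 // hs Ps addSn /= addnS.
Qed.

Definition irrs n : seq {poly F} := [seq P <- monics n | irreducibleb P].

Lemma mem_irrs n P : (P \in irrs n) = irreducibleb P && (P \in monics n).
Proof. by rewrite mem_filter. Qed.

(** A monic divisor of least positive degree cannot split further. *)
Lemma monic_irreducible_factor n g : g \in monics n.+1 ->
  exists d P, [/\ (0 < d <= n.+1)%N, P \in irrs d & P %| g].
Proof.
move=> gm.
have ex : exists d, (0 < d)%N && has (fun P => (P %| g)%R) (monics d).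
  by exists n.+1 => /=; apply/hasP; exists g.
case: (ex_minnP ex) => d /andP[d0 /hasP[P Pm Pg]] mind.
have := gm; have := Pm; rewrite !mem_monics => /andP[Pmon /eqP Ps] /andP[gmon /eqP gs].
exists d, P; split=> //.
  by rewrite d0 /= -ltnS -Ps -gs dvdp_leq ?monic_neq0.
rewrite mem_irrs Pm andbT; apply/irreducibleP; split=> [|q q1 qP]; first by rewrite Ps.
have q0 : q != 0 by apply: contraTneq qP => ->; rewrite dvd0p monic_neq0.
have lq0 : (lead_coef q)^-1 != 0 by rewrite invr_eq0 lead_coef_eq0.
have szq : (size q).-1.+1 = size q by rewrite prednK // size_poly_gt0.
have le : (d <= (size q).-1)%N.
  apply: mind; apply/andP; split.
    by move: q1; rewrite -szq; case: (_.-1).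
  apply/hasP; exists ((lead_coef q)^-1 *: q); last first.
    by rewrite dvdpZl // (dvdp_trans qP).
  by rewrite mem_monics monicE lead_coefZ mulVf ?lead_coef_eq0 // size_scale // szq !eqxx.
by rewrite -dvdp_size_eqp // eqn_leq dvdp_leq ?monic_neq0 //= Ps -szq.
Qed.

Lemma irrs_gt0 d P : P \in irrs d -> (0 < d)%N.
Proof.
by rewrite mem_irrs mem_monics => /andP[/irreducibleP[sP _] /andP[_ /eqP Ps]]; rewrite Ps in sP.
Qed.

Lemma irrs_uniq d : uniq (irrs d).
Proof. exact/filter_uniq/monics_uniq. Qed.

Lemma monics_exp d P j : P \in monics d -> P ^+ j \in monics (j * d).
Proof.
rewrite !mem_monics => /andP[Pm /eqP Ps]; rewrite monic_exp //=.
by rewrite -[size _]prednK ?size_poly_gt0 ?expf_neq0 ?monic_neq0 // size_exp Ps mulnC.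
Qed.

(* The identity [deg g = \sum_{P^j | g} deg P] behind the von Mangoldt function. *)
Lemma degree_sum n N g : g \in monics n -> (n <= N)%N ->
  n = (\sum_(1 <= d < N.+1) \sum_(P <- irrs d)
        d * \sum_(1 <= j < N.+1) (P ^+ j %| g)%R)%N.
Proof.
elim/ltn_ind: n g => -[|n] IH g gm leN.
  apply/esym/big1_seq => d _; apply/big1_seq => P /andP[_ Pd].
  rewrite big1_seq ?muln0 // => j; rewrite mem_index_iota => /andP[_ /andP[j0 _]].
  move: gm; rewrite monics0 inE => /eqP->; apply/eqP; rewrite eqb0 dvdp1.
  have d0 := irrs_gt0 Pd; move: Pd; rewrite mem_irrs => /andP[_ Pm].
  have := monics_exp j Pm; rewrite mem_monics => /andP[_ /eqP->].
  by rewrite eqSS muln_eq0 negb_or -!lt0n j0 d0.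
have [d0 [P0 [/andP[d00 led0] P0d P0g]]] := monic_irreducible_factor gm.
have P0m : P0 \in monics d0 by move: P0d; rewrite mem_irrs => /andP[].
have [h hm gE] : exists2 h, h \in monics (n.+1 - d0) & g = h * P0.
  have : g \in [seq g <- monics (n.+1 - d0 + d0) | P0 %| g].
    by rewrite mem_filter P0g subnK.
  by rewrite (perm_mem (monics_mul _ P0m)) => /mapP.
have IHh := IH (n.+1 - d0)%N (ltac:(lia)) h hm (ltac:(lia)).
have P00 : P0 != 0.
  by move: P0m; rewrite mem_monics => /andP[/monic_neq0].
rewrite -[LHS](subnK led0) {1}IHh.
(* Dividing by P0 lowers the exponent of P0 alone, by one. So d0 is written as a double sum
   supported at P0, and the two sides are compared term by term. *)
have <- : (\sum_(1 <= d < N.+1) \sum_(P <- irrs d) d * (P == P0) = d0)%N.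
  rewrite (bigD1_seq d0) ?iota_uniq //=; last first.
    by rewrite mem_index_iota d00 ltnS (leq_trans led0).
  rewrite [X in (_ + X)%N]big1 ?addn0 => [|d /negPf dd0].
    rewrite (bigD1_seq P0) ?irrs_uniq //= eqxx muln1 big1 ?addn0 // => P /negPf->.
    by rewrite muln0.
  apply: big1_seq => P /andP[_ Pd]; case: eqP => [PP0|_]; last by rewrite muln0.
  move: Pd P0m; rewrite PP0 mem_irrs !mem_monics => /andP[_ /andP[_ /eqP->]].
  by rewrite eqSS dd0 andbF.
rewrite -big_split; apply: eq_big_nat => d _; rewrite -big_split big_seq [RHS]big_seq /=.
apply: eq_bigr => P Pd; rewrite -mulnDr; congr (_ * _)%N.
have Pm : P \in monics d by move: Pd; rewrite mem_irrs => /andP[].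
have Pirr : irreducible_poly P by apply/irreducibleP; move: Pd; rewrite mem_irrs => /andP[].
have P0irr : irreducible_poly P0 by apply/irreducibleP; move: P0d; rewrite mem_irrs => /andP[].
have [->{P Pd Pm Pirr} | neP] := eqVneq P P0; last first.
  rewrite addn0; apply: eq_bigr => j _; rewrite gE Gauss_dvdpl //.
  rewrite coprimep_expl // irreducible_poly_coprime //.
  apply: contra neP => PP0; rewrite -eqp_monic.
  - by rewrite P0irr //; case: Pirr => ? _; rewrite neq_ltn orbC; apply/orP; left.
  - by move: Pm; rewrite mem_monics => /andP[].
  - by move: P0m; rewrite mem_monics => /andP[].
have N0 : (0 < N)%N by apply: leq_ltn_trans leN.
(* The exponent j + 1 in g matches j in h; the term for P0^N in h, which has no partner, vanishes
   for degree reasons. *)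
rewrite [RHS]big_ltn // expr1 P0g addnC; congr (_ + _)%N.
rewrite [RHS]big_add1 [LHS]big_nat_recr //= [X in (_ + X)%N](_ : _ = 0%N).
  rewrite addn0; apply: eq_bigr => j _; rewrite gE exprSr dvdp_mul2r //.
apply/eqP; rewrite eqb0; apply/negP => /dvdp_leq.
have := monics_exp N P0m; have := hm; rewrite !mem_monics.
move=> /andP[/monic_neq0-> /eqP->] /andP[_ /eqP->] /(_ isT).
by rewrite ltnS; have : (N <= N * d0)%N by [rewrite leq_pmulr]; lia.
Qed.

End MonicPolynomials.

Section EulerProduct.
Variables (F : finFieldType) (C : fieldType) (lam : {poly F} -> C).
Hypotheses (lam1 : lam 1 = 1) (lamM : forall g h, lam (g * h) = lam g * lam h).

(* The coefficients of L(T) = \sum_g lam(g) T^(deg g) and of T L'(T) / L(T), the latter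
   written as the sum over prime powers. *)
Definition lcoef n : C := \sum_(g <- monics F n) lam g.
Definition lpower k : C :=
  \sum_(1 <= d < k.+1) \sum_(1 <= j < k.+1 | (j * d == k)%N)
    \sum_(P <- irrs F d) d%:R * lam P ^+ j.

Lemma lcoef0 : lcoef 0 = 1.
Proof. by rewrite /lcoef monics0 big_seq1. Qed.

Lemma lamX g j : lam (g ^+ j) = lam g ^+ j.
Proof. by elim: j => [|j IH]; rewrite ?expr0 // !exprS lamM IH. Qed.

Lemma lcoef_dvd n d P j : P \in irrs F d ->
  \sum_(g <- monics F n) (P ^+ j %| g)%R%:R * lam g =
  (j * d <= n)%N%:R * (lam P ^+ j * lcoef (n - j * d)).
Proof.
rewrite mem_irrs => /andP[_ /(monics_exp j) Pm].
have [le|lt] := leqP (j * d) n; last first.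
  rewrite mul0r big1_seq // => g /andP[_ gm]; case: (boolP (_ %| _)%R) => [/dvdp_leq|]; rewrite ?mul0r //.
  have := Pm; have := gm; rewrite !mem_monics => /andP[/monic_neq0-> /eqP->] /andP[_ /eqP->].
  by move=> /(_ isT); rewrite ltnS leqNgt lt.
rewrite mul1r -lamX /lcoef mulr_sumr.
rewrite (eq_bigr (fun g => if P ^+ j %| g then lam g else 0)); last first.
  by move=> g _; case: (_ %| _)%R; rewrite ?mul1r ?mul0r.
rewrite -big_mkcond -big_filter -{1}(subnK le).
rewrite (perm_big _ (monics_mul _ Pm)) big_map; apply: eq_bigr => g _.
by rewrite lamM mulrC.
Qed.

(** Coefficientwise form of T L' = (T L'/L) L. The factor n is replaced by the degree identity for
    each g, and the sum over g is carried out for fixed P and j. *)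
Lemma lcoef_rec n : n%:R * lcoef n = \sum_(1 <= k < n.+1) lpower k * lcoef (n - k).
Proof.
transitivity (\sum_(1 <= d < n.+1) \sum_(1 <= j < n.+1)
    (j * d <= n)%N%:R * (\sum_(P <- irrs F d) d%:R * lam P ^+ j) * lcoef (n - j * d)).
  rewrite mulr_sumr big_seq.
  under eq_bigr => g gm.
    rewrite {1}(degree_sum gm (leqnn n)) natr_sum mulr_suml.
    under eq_bigr => d _.
      rewrite natr_sum mulr_suml.
      under eq_bigr => P _.
        rewrite natrM natr_sum -mulrA mulr_suml; over.
      over.
    over.
  rewrite -big_seq exchange_big /=; apply: eq_bigr => d _.
  rewrite exchange_big /= [RHS](eq_bigr (fun j => \sum_(P <- irrs F d)
     d%:R * ((j * d <= n)%N%:R * (lam P ^+ j * lcoef (n - j * d))))); last first.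
    move=> j _; rewrite [X in X * _ = _]mulr_sumr mulr_suml; apply: eq_bigr => P _.
    by rewrite -!mulrA mulrCA.
  rewrite [RHS]exchange_big /= big_seq [RHS]big_seq; apply: eq_bigr => P Pd.
  rewrite -mulr_sumr exchange_big /= mulr_sumr; apply: eq_bigr => j _.
  by rewrite (lcoef_dvd _ _ Pd).
rewrite [RHS](eq_big_nat _ _ (F2 := fun k => \sum_(1 <= d < n.+1) \sum_(1 <= j < n.+1)
    (j * d == k)%N%:R * (\sum_(P <- irrs F d) d%:R * lam P ^+ j) * lcoef (n - k))).
  rewrite [RHS]exchange_big /=; apply: eq_big_nat => d /andP[d0 _].
  rewrite [RHS]exchange_big /=; apply: eq_big_nat => j /andP[j0 _].
  have [le|lt] := leqP (j * d) n; last first.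
    rewrite !mul0r big1_seq // => k; rewrite mem_index_iota => /andP[_ /andP[_ kn]].
    by rewrite gtn_eqF ?mul0r // (leq_trans _ lt).
  rewrite (bigD1_seq (j * d)%N) ?iota_uniq ?mem_index_iota ?muln_gt0 ?j0 ?d0 //=.
  rewrite eqxx [X in _ = _ + X]big1 ?addr0 // => k /negPf ne; by rewrite eq_sym ne !mul0r.
move=> k /andP[k0 kn]; rewrite /lpower mulr_suml.
rewrite [RHS](big_cat_nat (n := k.+1)) //= [X in _ = _ + X]big1_seq ?addr0; last first.
  move=> d; rewrite mem_index_iota => /andP[_ /andP[kd _]].
  apply: big1_seq => j; rewrite mem_index_iota => /andP[_ /andP[j0 _]].
  by rewrite gtn_eqF ?mul0r // (leq_trans kd) // leq_pmull.
apply: eq_big_nat => d /andP[d0 _].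
rewrite [RHS](big_cat_nat (n := k.+1)) //= [X in _ = _ + X]big1_seq ?addr0; last first.
  move=> j; rewrite mem_index_iota => /andP[_ /andP[kj _]].
  by rewrite gtn_eqF ?mul0r // (leq_trans kj) // leq_pmulr.
rewrite mulr_suml big_mkcond; apply: eq_bigr => j _.
by case: eqP => _; rewrite ?mul1r ?mul0r.
Qed.

End EulerProduct.

(** * Newton's identities and reciprocal roots *)

Lemma one_sub_prod_coef0 (K : fieldType) (ws : seq K) :
  (\prod_(w <- ws) (1 - w *: 'X))`_0 = 1.
Proof.
rewrite -horner_coef0 horner_prod big1 // => w _.
by rewrite !hornerE ?mulr0 ?subr0.
Qed.

Lemma newton_identity (K : fieldType) (ws : seq K) (n : nat)
    (a := \prod_(w <- ws) (1 - w *: 'X)) :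
  n%:R * a`_n = - \sum_(1 <= k < n.+1) (\sum_(w <- ws) w ^+ k) * a`_(n - k).
Proof.
rewrite {}/a; elim: ws n => [|w ws IH] n.
  rewrite big_nil coef1 big1_seq ?oppr0; last by move=> k _; rewrite big_nil mul0r.
  by case: n => [|n] /=; rewrite ?mul0r ?mulr0.
rewrite big_cons; set b := \prod_(_ <- ws) _ in IH *.
have bE i : ((1 - w *: 'X) * b)`_i = b`_i - (if i is j.+1 then w * b`_j else 0).
  rewrite mulrBl mul1r coefB -scalerAl coefZ coefXM.
  by case: i => [|i] //=; rewrite mulr0.
transitivity (- \sum_(1 <= k < n.+1) (\sum_(w0 <- ws) w0 ^+ k) * ((1 - w *: 'X) * b)`_(n - k)
   - \sum_(1 <= k < n.+1) w ^+ k * ((1 - w *: 'X) * b)`_(n - k)); last first.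
  rewrite -opprD -big_split; congr (- _); apply: eq_bigr => k _.
  by rewrite big_cons [(w ^+ k + _) * _]mulrDl [RHS]addrC.
(* Coefficientwise form of (1 - wX) b times the series of w^k X^k over k >= 1, which is wX b. *)
have tele : \sum_(1 <= k < n.+1) w ^+ k * ((1 - w *: 'X) * b)`_(n - k) =
            if n is j.+1 then w * b`_j else 0.
  case: n => [|n]; first by rewrite big_geq.
  rewrite big_add1 /=.
  pose F k := if (k <= n)%N then w ^+ k.+1 * b`_(n - k) else 0.
  rewrite (eq_big_nat _ _ (F2 := fun k => F k - F k.+1)); last first.
    move=> k /andP[_ kn]; rewrite /F bE subSS; rewrite ltnS in kn; rewrite kn.
    have [-> | ltk] := eqVneq k n; first by rewrite subnn ltnn !subr0.
    rewrite ltn_neqAle ltk kn /=.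
    have -> : (n - k = (n - k.+1).+1)%N by rewrite subnSK // ltn_neqAle ltk.
    by rewrite mulrBr mulrA -exprSr.
  rewrite (@telescope_sumr_eq _ _ _ (fun k => - F k)) // => [|k _].
    by rewrite /F ltnn subn0 leq0n oppr0 sub0r opprK expr1.
  by rewrite opprK addrC.
rewrite {}tele.
have split : \sum_(1 <= k < n.+1) (\sum_(w0 <- ws) w0 ^+ k) * ((1 - w *: 'X) * b)`_(n - k)
   = - (n%:R * b`_n) + (if n is j.+1 then w * (j%:R * b`_j) else 0).
  under eq_bigr do rewrite bE mulrBr.
  rewrite sumrB IH opprK; congr (_ + _).
  case: n => [|n]; first by rewrite big_geq ?oppr0.
  rewrite IH mulrN; congr (- _).
  rewrite big_nat_recr //= subnn mulr0 addr0 mulr_sumr.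
  apply: eq_big_nat => k /andP[_ kn]; rewrite subSn //; exact: mulrCA.
rewrite split bE opprD opprK.
by case: n {IH bE split} => [|n]; rewrite ?subr0 ?mulr0 ?addr0 // mulrBr -addrA -opprD -mulrDr -{3}[b`_n]mul1r -mulrDl natr1 [w * (_ * _)]mulrCA.
Qed.

(** The recurrence is solved for S n, whose coefficient a_0 is 1: no division by n occurs. *)
Lemma newton_unique (K : fieldType) (ws : seq K) (S : nat -> K)
    (a := \prod_(w <- ws) (1 - w *: 'X)) :
  (forall n, n%:R * a`_n = \sum_(1 <= k < n.+1) S k * a`_(n - k)) ->
  forall n, (0 < n)%N -> S n = - \sum_(w <- ws) w ^+ n.
Proof.
move=> H n; elim/ltn_ind: n => n IH n0.
have := H n; rewrite newton_identity -sumrN.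
case: n n0 IH => // n _ IH.
rewrite !(big_nat_recr n.+1) //= subnn /a one_sub_prod_coef0 !mulr1 => E.
apply: (addrI (\sum_(1 <= i < n.+1) S i * a`_(n.+1 - i))); rewrite -E; congr (_ + _).
apply: eq_big_nat => k /andP[k0 kn]; by rewrite IH // mulNr.
Qed.

(** The w are the reciprocals of the roots, which are nonzero because the constant term is 1; the
    same condition removes the leading factor. *)
Lemma closed_one_sub_prod (C : closedFieldType) (a : {poly C}) :
  a`_0 = 1 -> exists2 ws : seq C, (size ws = (size a).-1)%N &
    a = \prod_(w <- ws) (1 - w *: 'X).
Proof.
move=> a0; have [rs aE] := closed_field_poly_normal a.
have an0 : a != 0 by apply: contra_eq_neq a0 => ->; rewrite coef0 eq_sym oner_eq0.
have r0 r : r \in rs -> r != 0.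
  move=> rrs; apply: contra_eq_neq a0 => r0; rewrite -horner_coef0 aE hornerZ.
  rewrite -r0 (_ : _.[r] = 0) ?mulr0 1?eq_sym ?oner_eq0 //.
  by apply/rootP; rewrite root_prod_XsubC.
have E : a = (lead_coef a * \prod_(r <- rs) - r)%:P *
             \prod_(w <- [seq r^-1 | r <- rs]) (1 - w *: 'X).
  rewrite [LHS]aE polyCM -mulrA -mul_polyC; congr (_ * _).
  rewrite big_map rmorph_prod -big_split /= !big_seq.
  apply: eq_bigr => r /r0 rn0.
  by rewrite mulrBr mulr1 mul_polyC scalerA mulNr divff // scaleN1r opprK polyCN addrC.
exists [seq r^-1 | r <- rs].
  by rewrite size_map aE size_scale ?lead_coef_eq0 // size_prod_XsubC.
have := congr1 (fun p : {poly C} => p`_0) E.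
rewrite /= a0 coefCM one_sub_prod_coef0 mulr1 => E1.
by rewrite {1}E -E1 mul1r.
Qed.

(** * Growth of power sums *)

Section Growth.
Variable C : numClosedFieldType.
Hypothesis arch : forall x : C, 0 <= x -> exists n : nat, x < n%:R.

Lemma bernoulli (t : C) n : 0 <= t -> 1 + n%:R * t <= (1 + t) ^+ n.
Proof.
move=> t0; elim: n => [|n IH]; first by rewrite mul0r addr0.
rewrite exprS; apply: le_trans (ler_wpM2l _ IH); last by rewrite addr_ge0.
rewrite mulrDl mul1r mulrDr mulr1 -natr1 mulrDl mul1r !addrA.
rewrite -[leLHS]addr0 [1 + _ + t]addrAC lerD2l.
by rewrite !mulr_ge0.
Qed.

(* A combination of the power sums isolates the multiplicity of a single z1 times P(z1) z1^n, where P
   vanishes at the other zs. *)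
Lemma power_sum_growth (zs : seq C) (rho B : C) : 0 < rho ->
  (forall n, (1 < n)%N -> `|\sum_(z <- zs) z ^+ n| <= B * rho ^+ n) ->
  forall z, z \in zs -> `|z| <= rho.
Proof.
move=> rho0 H z1 z1zs.
rewrite real_leNgt ?normr_real ?gtr0_real //; apply/negP => lt1.
pose P := \prod_(w <- rem z1 (undup zs)) ('X - w%:P).
have Pz1 : P.[z1] != 0.
  rewrite -[_ == 0]/(root P z1) root_prod_XsubC mem_rem_uniq ?undup_uniq //.
  by rewrite inE eqxx.
have Pz z : z \in zs -> z != z1 -> P.[z] = 0.
  move=> zzs zz1; apply/rootP; rewrite root_prod_XsubC mem_rem_uniq ?undup_uniq //.
  by rewrite inE zz1 mem_undup.
have E n : \sum_(z <- zs) P.[z] * z ^+ n = (count_mem z1 zs)%:R * (P.[z1] * z1 ^+ n).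
  rewrite big_seq (bigID (pred1 z1)) /= [X in _ + X]big1 => [|z /andP[zz zn]]; last first.
    by rewrite Pz ?mul0r.
  rewrite addr0 (eq_bigr (fun=> P.[z1] * z1 ^+ n)); last by move=> z /andP[_ /eqP->].
  rewrite (eq_bigl (pred1 z1)); last by move=> z /=; case: eqP => [->|]; rewrite ?andbT ?andbF.
  by rewrite big_const_seq iter_addr_0 mulr_natl.
pose K := \sum_(j < size P) `|P`_j| * B * rho ^+ j.
have bnd n : (1 < n)%N -> `|P.[z1]| * `|z1| ^+ n <= K * rho ^+ n.
  move=> n1; rewrite -normrX -normrM.
  apply: le_trans (_ : `|(count_mem z1 zs)%:R * (P.[z1] * z1 ^+ n)| <= _).
    rewrite [leRHS]normrM normr_nat ler_peMl ?normr_ge0 // ler1n.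
    by rewrite -has_count has_pred1.
  rewrite -E.
  have -> : \sum_(z <- zs) P.[z] * z ^+ n = \sum_(j < size P) P`_j * \sum_(z <- zs) z ^+ (n + j).
    under [RHS]eq_bigr do rewrite mulr_sumr.
    rewrite exchange_big /=; apply: eq_bigr => z _.
    rewrite horner_coef mulr_suml; apply: eq_bigr => j _.
    by rewrite -mulrA -exprD addnC.
  apply: le_trans (ler_norm_sum _ _ _) _; rewrite /K mulr_suml.
  apply: ler_sum => j _; rewrite normrM -!mulrA ler_wpM2l //.
  by rewrite -exprD [(j + n)%N]addnC H // ltn_addr.
(* If |z1| > rho, the powers (1 + t)^n would stay below K / |P(z1)|, against Bernoulli's inequality
   and [arch]. *)
pose t := `|z1| / rho - 1.
have t0 : 0 < t by rewrite subr_gt0 ltr_pdivlMr ?mul1r.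
have K0 : 0 <= K.
  have := bnd 2 isT => /(le_trans (mulr_ge0 (normr_ge0 _) (exprn_ge0 _ (normr_ge0 _)))).
  by rewrite pmulr_lge0 ?exprn_gt0.
have Pz0 : 0 < `|P.[z1]| by rewrite normr_gt0.
have [n nP] := arch (divr_ge0 (divr_ge0 K0 (ltW Pz0)) (ltW t0)).
have := bnd n.+2 isT.
have -> : `|z1| = (1 + t) * rho by rewrite addrC subrK divfK ?gt_eqF.
rewrite exprMn mulrA ler_pM2r ?exprn_gt0 // mulrC -ler_pdivlMr //.
move=> /(le_trans (bernoulli _ (ltW t0))) le1.
move: nP; rewrite ltr_pdivrMr // => /(le_lt_trans le1).
move=> ltn; suff : n%:R * t <= 1 + n.+2%:R * t by rewrite (lt_geF ltn).
by rewrite -[leLHS]add0r lerD ?ler01 ?ler_wpM2r ?(ltW t0) ?ler_nat //; lia.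
Qed.

End Growth.

(** * Characteristic polynomials over the prime field *)

Section FrobeniusOrbits.
Variables (p : nat) (L : finFieldType) (iota : {rmorphism 'F_p -> L}) (k : nat).
Hypotheses (charL : p \in [pchar L]) (cardL : #|L| = (p ^ k)%N) (k0 : (0 < k)%N).

Let p_pr : prime p := pcharf_prime charL.
Let frob := pFrobenius_aut charL.

Lemma frob_iter j x : iter j frob x = x ^+ (p ^ j).
Proof.
by elim: j => [|j IH]; rewrite ?expr1 //= IH /frob pFrobenius_autE -exprM expnSr.
Qed.

Lemma iota_fixed c : iota c ^+ p = iota c.
Proof.
rewrite -rmorphXn; congr (iota _).
by have := expf_card c; rewrite card_Fp.
Qed.

Lemma frob_fixed y : y ^+ p = y -> exists c, iota c = y.
Proof.
move=> yp; have : root (map_poly iota ('X^#|'F_p| - 'X)) y.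
  rewrite rmorphB /= map_polyXn map_polyX /root !hornerE card_Fp // yp subrr //.
rewrite finField_genPoly rmorph_prod /= => /rootP; rewrite horner_prod => /eqP.
rewrite prodf_seq_eq0 => /hasP[c _]; rewrite rmorphB /= map_polyX map_polyC !hornerE subr_eq0.
by move=> /eqP ->; exists c.
Qed.

(** The characteristic polynomial of x over the prime field, a power of its minimal polynomial. *)
Definition orbit_poly (x : L) : {poly L} := \prod_(j < k) ('X - (x ^+ (p ^ j))%:P).

Lemma frob_orbit_poly x : map_poly frob (orbit_poly x) = orbit_poly x.
Proof.
rewrite /orbit_poly rmorph_prod /=.
transitivity (\prod_(1 <= j < k.+1) ('X - (x ^+ (p ^ j))%:P)).
  rewrite big_add1 big_mkord /=; apply: eq_bigr => j _.
  by rewrite rmorphB /= map_polyX map_polyC /= pFrobenius_autE -exprM expnSr.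
rewrite -[RHS](big_mkord xpredT (fun j => 'X - (x ^+ (p ^ j))%:P)).
rewrite big_nat_recr //= [RHS]big_ltn // mulrC.
by rewrite -cardL expf_card expn0 expr1.
Qed.

(** Frobenius permutes the conjugates cyclically, so it fixes the coefficients, and its fixed points
    are the image of F_p. *)
Lemma orbit_poly_descends x : exists R : {poly 'F_p}, map_poly iota R == orbit_poly x.
Proof.
pose inv y := odflt 0 [pick c | iota c == y].
have invK y : y ^+ p = y -> iota (inv y) = y.
  move=> /frob_fixed[c cy]; rewrite /inv; case: pickP => [c' /eqP // | /(_ c)].
  by rewrite cy eqxx.
have inv0 : inv 0 = 0.
  by apply: (fmorph_inj iota); rewrite invK ?rmorph0 // expr0n gtn_eqF ?prime_gt0.
exists (map_poly inv (orbit_poly x)); apply/eqP/polyP => i.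
have fixed : (orbit_poly x)`_i ^+ p = (orbit_poly x)`_i.
  by rewrite -[in RHS]frob_orbit_poly coef_map /= pFrobenius_autE.
rewrite coef_map /= (_ : (map_poly inv _)`_i = inv (orbit_poly x)`_i) ?invK //.
exact: coef_map_id0.
Qed.

Definition norm_poly x : {poly 'F_p} := xchoose (orbit_poly_descends x).

Lemma norm_polyP x : map_poly iota (norm_poly x) = orbit_poly x.
Proof. exact/eqP/(xchooseP (orbit_poly_descends x)). Qed.

Lemma norm_poly_monic x : norm_poly x \in monics 'F_p k.
Proof.
rewrite mem_monics -(map_monic iota) -(size_map_poly iota) norm_polyP.
by rewrite monic_prod_XsubC size_prod_XsubC /index_enum unlock -enumT size_enum_ord eqxx.
Qed.

(** The exponent is (p^k - 1)/(p - 1), that of the norm from L to F_p. *)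
Lemma norm_poly_eval x a :
  iota (norm_poly x).[a] = (iota a - x) ^+ (\sum_(j < k) p ^ j).
Proof.
rewrite -horner_map norm_polyP horner_prod expr_sum; apply: eq_bigr => j _.
rewrite !hornerE -!frob_iter; elim: (nat_of_ord j) => [|i] //=.
move=> <-.
by rewrite /frob rmorphB /= !pFrobenius_autE iota_fixed.
Qed.

Lemma root_frob (P : {poly 'F_p}) x : root (map_poly iota P) (x ^+ p) = root (map_poly iota P) x.
Proof.
have E : map_poly frob (map_poly iota P) = map_poly iota P.
  rewrite -map_poly_comp; apply: eq_map_poly => c /=.
  by rewrite /frob pFrobenius_autE iota_fixed.
by rewrite -{1}E -[x ^+ p](pFrobenius_autE charL) fmorph_root.
Qed.

Lemma root_frobX (P : {poly 'F_p}) x j :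
  root (map_poly iota P) (x ^+ (p ^ j)) = root (map_poly iota P) x.
Proof. by elim: j => [|j IH]; rewrite ?expr1 // expnSr exprM root_frob. Qed.

Lemma common_root_dvdp (P g : {poly 'F_p}) x : irreducible_poly P ->
  root (map_poly iota P) x -> root (map_poly iota g) x -> P %| g.
Proof.
move=> Pirr Px gx; apply: contraLR gx; rewrite -irreducible_poly_coprime //.
by rewrite -(coprimep_map iota) => /coprimep_root/(_ Px).
Qed.

Lemma orbit_dvdp_split x g : g %| norm_poly x -> g \is monic -> (1 < size g)%N ->
  root (map_poly iota g) x.
Proof.
rewrite -(dvdp_map iota) norm_polyP => /dvdp_prod_XsubC[m].
move=> + gm; rewrite eqp_monic ?map_monic ?monic_prod_XsubC // => /eqP E sg.
have : (1 < size (map_poly iota g))%N by rewrite size_map_poly.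
rewrite {1}E size_prod_XsubC ltnS.
case: (mask _ _) E => [|j s] // E _.
by rewrite -(root_frobX _ _ j) E big_cons rootM root_XsubC eqxx.
Qed.

(** Every monic divisor of positive degree has a conjugate of x, hence x itself, as a root, so it is
    divisible by P. Peeling off P by induction leaves a power of P. *)
Lemma norm_poly_power x P d : P \in irrs 'F_p d -> root (map_poly iota P) x ->
  exists j, (j * d = k)%N /\ norm_poly x = P ^+ j.
Proof.
move=> Pd Px; have [/irreducibleP Pirr Pm] : irreducibleb P /\ P \in monics _ d.
  by apply/andP; rewrite -mem_irrs.
suff H n g : g \in monics _ n -> g %| norm_poly x -> exists j, (j * d = n)%N /\ g = P ^+ j.
  exact: H (norm_poly_monic x) (dvdpp _).
elim/ltn_ind: n g => -[|n] IH g gm gx.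
  by exists 0%N; split => //; move: gm; rewrite monics0 inE => /eqP.
have /andP[gmon /eqP gs] : (g \is monic) && (size g == n.+2) by rewrite -mem_monics.
have d0 := irrs_gt0 Pd.
have Pg : P %| g.
  by apply: common_root_dvdp Pirr Px _; apply: orbit_dvdp_split; rewrite ?gs.
have led : (d <= n.+1)%N.
  move: Pm; rewrite mem_monics => /andP[_ /eqP Ps].
  by rewrite -ltnS -Ps -gs dvdp_leq ?monic_neq0.
have [h hm gE] : exists2 h, h \in monics 'F_p (n.+1 - d) & g = h * P.
  have : g \in [seq g <- monics 'F_p (n.+1 - d + d) | (P %| g)%R].
    by rewrite mem_filter Pg subnK.
  by rewrite (perm_mem (monics_mul _ Pm)) => /mapP.
have hx : h %| norm_poly x by apply: dvdp_trans gx; rewrite gE dvdp_mulIl.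
have [j [jd hE]] := IH (n.+1 - d)%N (ltac:(lia)) h hm hx.
by exists j.+1; rewrite exprSr gE hE mulSn jd subnKC.
Qed.

Lemma norm_poly_irr x : exists d P,
  [/\ (0 < d <= k)%N, P \in irrs 'F_p d & root (map_poly iota P) x].
Proof.
case: k k0 (norm_poly_monic x) => // n _ /monic_irreducible_factor[d [P [led Pd Px]]].
exists d, P; split => //; move: Pd; rewrite mem_irrs mem_monics => /andP[/irreducibleP[sP _] /andP[Pm _]].
exact: orbit_dvdp_split.
Qed.

Lemma irr_uniq_root x d d' P P' : P \in irrs 'F_p d -> P' \in irrs 'F_p d' ->
  root (map_poly iota P) x -> root (map_poly iota P') x -> P = P'.
Proof.
rewrite !mem_irrs !mem_monics => /andP[/irreducibleP Pi /andP[Pm _]] /andP[/irreducibleP Pi' /andP[Pm' _]] Px Px'.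
by apply/eqP; rewrite -eqp_monic // /eqp !(@common_root_dvdp _ _ x).
Qed.

(** A root z of P generates a field with p^d elements, so z^(p^d) = z, and j iterations give z^(p^k)
    = z. *)
Lemma irr_dvd_genPoly d j P : P \in irrs 'F_p d -> (j * d = k)%N -> P %| 'X^(p ^ k) - 'X.
Proof.
rewrite mem_irrs mem_monics => /andP[/irreducibleP Pi /andP[Pm /eqP Ps]] jd.
have [E dimE [z Pz _]] := irredp_FAdjoin Pi.
have zE : z ^+ (p ^ d) = z.
  have := Fermat's_little_theorem {:E}%AS z.
  by rewrite memvf dimE Ps /= card_Fp // => /esym/eqP.
rewrite -[_ %| _]negbK -irreducible_poly_coprime // -(coprimep_map (in_alg E)).
apply/negP => /coprimep_root/(_ Pz).
rewrite rmorphB /= map_polyXn map_polyX !hornerE -jd mulnC expnM.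
suff -> : z ^+ ((p ^ d) ^ j) = z by rewrite subrr eqxx.
by elim: j {jd} => [|j IH]; rewrite ?expr1 // expnSr exprM IH.
Qed.

Lemma card_irr_roots d j P : P \in irrs 'F_p d -> (j * d = k)%N ->
  #|[set x | root (map_poly iota P) x]| = d.
Proof.
move=> Pd jd; have := irr_dvd_genPoly Pd jd; rewrite -(dvdp_map iota) rmorphB /= map_polyXn map_polyX.
rewrite -cardL finField_genPoly => /dvdp_prod_XsubC[m].
move: Pd; rewrite mem_irrs mem_monics => /andP[_ /andP[Pm /eqP Ps]].
rewrite eqp_monic ?map_monic ?monic_prod_XsubC // => /eqP E.
have sz : size (mask m (index_enum L)) = d.
  by apply/eqP; rewrite -eqSS -(size_prod_XsubC _ id) -E size_map_poly Ps.
rewrite -[RHS]sz -(card_uniqP _); last by rewrite mask_uniq // index_enum_uniq.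
by apply: eq_card => x; rewrite inE E root_prod_XsubC.
Qed.

(** An irreducible P of degree d dividing k has exactly d roots in L, and [norm_poly] sends each of
    them to P^(k/d); so the prime powers of degree k, weighted by d, are parametrised by the
    elements of L. *)
Lemma lpower_norm_sum (C : fieldType) (lam : {poly 'F_p} -> C) :
  lam 1 = 1 -> (forall g h, lam (g * h) = lam g * lam h) ->
  lpower lam k = \sum_x lam (norm_poly x).
Proof.
move=> lam1 lamM; rewrite /lpower.
transitivity (\sum_x \sum_(1 <= d < k.+1) \sum_(1 <= j < k.+1 | (j * d == k)%N)
   \sum_(P <- irrs 'F_p d) (root (map_poly iota P) x)%:R * lam P ^+ j).
  rewrite [RHS]exchange_big /=; apply: eq_bigr => d _.
  rewrite [RHS]exchange_big /=; apply: eq_bigr => j /eqP jd.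
  rewrite [RHS]exchange_big /= big_seq [RHS]big_seq; apply: eq_bigr => P Pd.
  rewrite -mulr_suml -natr_sum; congr (_%:R * _).
  by rewrite -[LHS](card_irr_roots Pd jd) -sum1_card big_mkcond; apply: eq_bigr => x _; rewrite inE; case: root.
apply: eq_bigr => x _.
have [d [P [/andP[d0 dk] Pd Px]]] := norm_poly_irr x.
have [j [jd ->]] := norm_poly_power Pd Px.
rewrite (bigD1_seq d) ?mem_index_iota ?d0 ?iota_uniq //= [X in _ + X]big1_seq ?addr0; last first.
  move=> d' /andP[dd' _]; apply: big1 => j' _; apply: big1_seq => P' /andP[_ Pd'].
  case: (boolP (root _ _)) => [Px'|]; last by rewrite mul0r.
  have PP := irr_uniq_root Pd Pd' Px Px'; move: Pd' Pd; rewrite PP !mem_irrs !mem_monics.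
  move=> /andP[_ /andP[_ /eqP->]] /andP[_ /andP[_]]; rewrite eqSS => /eqP dd.
  by rewrite dd eqxx in dd'.
have j0 : (0 < j)%N by case: j jd k0 => // <-.
rewrite -big_filter (_ : [seq _ <- _ | _] = [:: j]); last first.
  apply: perm_small_eq => //; apply: uniq_perm; rewrite ?filter_uniq ?iota_uniq // => i.
  rewrite mem_filter mem_index_iota inE -jd eqn_pmul2r //; apply/andP/eqP => [[/eqP]|->] //.
  by rewrite eqxx j0 ltnS leq_pmulr.
rewrite big_seq1 (bigD1_seq P) ?irrs_uniq //= Px mul1r [X in _ + X]big1_seq ?addr0 ?lamX //.
move=> P' /andP[PP' Pd']; case: (boolP (root _ _)) => [Px'|]; last by rewrite mul0r.
by rewrite (irr_uniq_root Pd Pd' Px Px') eqxx in PP'.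
Qed.

End FrobeniusOrbits.

(** * Weil's bound *)

Section Weil.
Variable C : numClosedFieldType.
Hypothesis arch : forall x : C, 0 <= x -> exists n : nat, x < n%:R.
Variables (p : nat) (chi : 'F_p -> C).
Hypotheses (p_pr : prime p) (chi1 : chi 1 = 1) (chi0 : chi 0 = 0)
  (chiM : {morph chi : x y / x * y}) (chi_nt : exists2 y, y != 0 & chi y != 1).

Lemma char_norm c : c != 0 -> `|chi c| = 1.
Proof.
move=> c0; have cc0 : chi c != 0.
  apply: contraTneq (oner_neq0 C) => chic.
  by rewrite negbK -chi1 -(divff c0) chiM chic mul0r.
have chiX j : chi (c ^+ j) = chi c ^+ j.
  by elim: j => [|j IH]; rewrite ?expr0 // !exprS chiM IH.
have : chi c ^+ p = chi c by rewrite -chiX; have := expf_card c; rewrite card_Fp // => ->.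
rewrite -[p in _ ^+ p]prednK ?prime_gt0 // exprSr => /(canRL (mulfK cc0)).
rewrite divff // => /(congr1 Num.norm); rewrite normrX normr1 => /eqP.
have p1 : (0 < p.-1)%N by rewrite -subn1 subn_gt0 prime_gt1.
by rewrite pexpr_eq1 ?normr_ge0 // => /eqP.
Qed.

Lemma char_sum0 : \sum_c chi c = 0.
Proof.
have [y y0 chiy] := chi_nt.
have : chi y * \sum_c chi c = \sum_c chi c.
  rewrite mulr_sumr [RHS](reindex_inj (mulfI y0)) /=; apply: eq_bigr => c _.
  by rewrite chiM.
move/eqP; rewrite -subr_eq0 -{2}[\sum_c chi c]mul1r -mulrBl mulf_eq0 subr_eq0.
by rewrite (negPf chiy) /= => /eqP.
Qed.

Variables (I : finType) (a : I -> 'F_p) (e : I -> nat) (i0 : I).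
Hypotheses (e0 : e i0 = 1%N) (a0 : forall i, i != i0 -> a i != a i0).

(** Its value at X - c is the general term of the character sum to be bounded, which is therefore
    [lcoef lam 1]. *)
Let lam (g : {poly 'F_p}) : C := chi (\prod_i g.[a i] ^+ e i).
Let E := (\sum_i e i)%N.

Let lam1 : lam 1 = 1.
Proof. by rewrite /lam big1 // => i _; rewrite hornerC expr1n. Qed.

Let lamM g h : lam (g * h) = lam g * lam h.
Proof.
rewrite /lam -chiM -big_split; congr chi; apply: eq_bigr => i _.
by rewrite hornerM exprMn.
Qed.

(* Adding c Pi to g changes only its value at a i0, so that averaging over c gives a
   complete character sum. *)
Lemma lcoef_vanish n : (#|I| <= n)%N -> lcoef lam n = 0.
Proof.
move=> leIn; pose Pi := \prod_(i | i != i0) ('X - (a i)%:P).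
have szPi : (size Pi <= n)%N.
  rewrite /Pi -big_filter size_prod_XsubC.
  have -> : size [seq i <- index_enum I | i != i0] = #|I|.-1.
    rewrite -(cardC1 i0) cardE /enum_mem; apply: congr1.
    by rewrite /index_enum !unlock.
  by rewrite prednK //; apply/card_gt0P; exists i0.
have Pi0 : Pi.[a i0] != 0.
  rewrite horner_prod; apply/prodf_neq0 => i ii0.
  by rewrite !hornerE subr_eq0 eq_sym a0.
have Pii i : i != i0 -> Pi.[a i] = 0.
  by move=> ii0; rewrite horner_prod (bigD1 i) //= !hornerE subrr mul0r.
have shift c : lcoef lam n = \sum_(g <- monics 'F_p n) lam (g + c *: Pi).
  rewrite /lcoef -[RHS](big_map (fun g => g + c *: Pi) xpredT lam).
  apply: perm_big; apply: uniq_perm; rewrite ?monics_uniq //.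
    by rewrite map_inj_uniq ?monics_uniq //; apply: addIr.
  move=> g; have mon c' h : (h \in monics 'F_p n) -> h + c' *: Pi \in monics 'F_p n.
    rewrite !mem_monics => /andP[hm /eqP hs].
    have lt : (size (c' *: Pi) < size h)%N.
      by rewrite hs ltnS (leq_trans (size_scale_leq _ _)).
    by rewrite monicE lead_coefDl // -monicE hm size_polyDl // hs eqxx.
  apply/idP/mapP => [gm | [h hm ->]]; last exact: mon.
  by exists (g + - c *: Pi); rewrite ?mon // scaleNr subrK.
have : p%:R * lcoef lam n = 0.
  rewrite mulr_natl -[in X in _ *+ X](card_Fp p_pr) -sumr_const.
  rewrite (eq_bigr _ (fun c _ => shift c)) exchange_big big1 //= => g _.
  rewrite /lam; under eq_bigr => c _.
    rewrite (bigD1 i0) //= e0 expr1 chiM (eq_bigr (fun i => g.[a i] ^+ e i)); last first.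
      by move=> i ii0; rewrite hornerD hornerZ Pii // mulr0 addr0.
    over.
  rewrite -mulr_suml (_ : \sum_i _ = 0) ?mul0r //.
  rewrite -[RHS]char_sum0 [RHS](reindex (fun c => g.[a i0] + c * Pi.[a i0])).
    by apply: eq_bigr => c _; rewrite hornerD hornerZ.
  exists (fun y => (y - g.[a i0]) / Pi.[a i0]) => y _.
    by rewrite addrC addKr mulfK.
  by rewrite divfK // addrC subrK.
by move/eqP; rewrite mulf_eq0 pnatr_eq0 gtn_eqF ?prime_gt0 //= => /eqP.
Qed.

Section Extension.
Variables (L : finFieldType) (iota : {rmorphism 'F_p -> L}) (mu : nat).
Hypotheses (charL : p \in [pchar L]) (cardL : #|L| = (p ^ (2 * mu))%N) (mu1 : (1 < mu)%N).

Let mu2 : (0 < 2 * mu)%N.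
Proof. by rewrite muln_gt0 /= ltnW. Qed.

Let Q := (p ^ mu)%N.
Let A := (\sum_(j < mu) p ^ j)%N.
Let f : {poly L} := \prod_i ((iota (a i) - iota (a i0))%:P - 'X) ^+ e i.
Let f1 : {poly L} := - \prod_(i | i != i0) ((iota (a i) - iota (a i0))%:P - 'X) ^+ e i.
Let npol (x : L) := norm_poly iota charL cardL mu2 x.

Let AE : (A * p.-1 = Q.-1)%N.
Proof. by rewrite mulnC -predn_exp. Qed.

Let M_E : (\sum_(j < 2 * mu) p ^ j = A * Q.+1)%N.
Proof.
apply/eqP; rewrite -(eqn_pmul2l (_ : 0 < p.-1)%N); last by rewrite -subn1 subn_gt0 prime_gt1.
rewrite -predn_exp mulnA [(p.-1 * A)%N]mulnC AE [(2 * mu)%N]mulnC expnM.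
have : (0 < Q)%N by rewrite expn_gt0 prime_gt0.
by rewrite -mulnn /Q; case: (p ^ mu)%N => // q _; apply/eqP => /=; lia.
Qed.

Let fE : f = 'X * f1.
Proof.
rewrite /f (bigD1 i0) //= subrr sub0r e0 expr1 /f1 mulrN mulNr.
by [].
Qed.

Let f10 : f1.[0] != 0.
Proof.
rewrite hornerN oppr_eq0 horner_prod; apply/prodf_neq0 => i ii0.
by rewrite horner_exp !hornerE expf_neq0 // subr0 subr_eq0 (inj_eq (fmorph_inj iota)) a0.
Qed.

Let sizef : ((size f).-1 <= E)%N.
Proof.
suff : (size f <= E.+1)%N by case: (size f).
rewrite /f /E; elim/big_rec2: _ => [|i m g _ IH]; first by rewrite size_poly1.
apply: leq_trans (size_polyMleq _ _) _.
have : (size (((iota (a i) - iota (a i0))%:P - 'X) ^+ e i) <= (e i).+1)%N.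
  apply: leq_trans (size_poly_exp_leq _ _) _.
  by rewrite -opprB size_polyN size_XsubC mul1n.
by move: (size _) (size g) IH => u v; lia.
Qed.

Let npol_eval x : iota (\prod_i (npol x).[a i] ^+ e i) = f.[x - iota (a i0)] ^+ (A * Q.+1).
Proof.
rewrite rmorph_prod horner_prod -prodrXl; apply: eq_bigr => i _.
rewrite rmorphXn /= norm_poly_eval M_E horner_exp !hornerE exprAC; congr (_ ^+ _ ^+ _).
by rewrite opprB addrA subrK.
Qed.

Let cnt (c : 'F_p) := #|[set x | \prod_i (npol x).[a i] ^+ e i == c]|.

Let shift_count (S T : {set L}) : (forall x, x \in S -> x - iota (a i0) \in T) -> (#|S| <= #|T|)%N.
Proof.
move=> ST; rewrite -(card_imset _ (addIr (- iota (a i0)))).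
by apply/subset_leq_card/subsetP => y /imsetP[x /ST ? ->].
Qed.

Let cntB c : c != 0 -> (cnt c <= (A + 3 * E + 4) * Q)%N.
Proof.
move=> c0; have QF : {morph (fun x : L => x ^+ Q) : x y / x + y}.
  move=> x y; rewrite /Q; elim: mu => [|m IH]; first by rewrite !expr1.
  by rewrite !expnSr !exprM IH -!(pFrobenius_autE charL) rmorphD.
have Q3 : (3 < Q)%N.
  apply: leq_trans (_ : 2 ^ 2 <= Q)%N => //; apply: leq_trans (_ : p ^ 2 <= Q)%N.
    by rewrite leq_exp2r // prime_gt1.
  by rewrite leq_exp2l // prime_gt1.
have cardQ : #|L| = (Q ^ 2)%N by rewrite cardL mulnC expnM.
have ic0 : iota c != 0 by rewrite fmorph_eq0.
apply: leq_trans (leq_trans (stepanov_count QF cardQ Q3 AE fE f10 ic0) _).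
  by apply: shift_count => x; rewrite !inE => /eqP <-; rewrite npol_eval.
by rewrite leq_mul ?leq_add ?leq_mul.
Qed.

Let cnt0 : (cnt 0%R <= E)%N.
Proof.
have f0 : f != 0.
  rewrite fE mulf_neq0 ?polyX_eq0 //; apply: contra_neq f10 => ->.
  by rewrite horner0.
apply: leq_trans sizef.
apply: leq_trans (_ : #|[set y | root f y]| <= _)%N.
  apply: shift_count => x; rewrite !inE => /eqP H.
  by have := npol_eval x; rewrite H rmorph0 => /esym/eqP; rewrite expf_eq0 => /andP[].
rewrite -ltnS prednK ?size_poly_gt0 // cardE max_poly_roots ?enum_uniq //.
by apply/allP => y; rewrite mem_enum inE.
Qed.

(** Upper bounds on the counts suffice: as chi sums to 0, the common bound B may be subtracted from
    each count with c <> 0. The differences then have one sign, and their sum follows from the total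
    number Q^2 of elements of L, which cancels against the main part (Q - 1) Q of (p - 1) B. *)
Lemma lpower_bound :
  `|lpower lam (2 * mu)| <= (p.-1 * (3 * E + 4) + E)%N%:R * p%:R ^+ mu.
Proof.
rewrite (lpower_norm_sum iota charL cardL mu2 lam1 lamM).
pose B := ((A + 3 * E + 4) * Q)%N.
have -> : \sum_x lam (npol x) = \sum_(c | c != 0) chi c * ((cnt c)%:R - B%:R).
  rewrite (partition_big (fun x => \prod_i (npol x).[a i] ^+ e i) xpredT) //=.
  transitivity (\sum_c chi c * (cnt c)%:R).
    apply: eq_bigr => c _; rewrite (eq_bigr (fun=> chi c)); last by move=> x /eqP <-.
    rewrite big_const iter_addr_0 mulr_natr; congr (_ *+ _).
    by apply: eq_card => x; rewrite !inE.
  rewrite (bigD1 0) //= chi0 mul0r add0r.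
  under [RHS]eq_bigr do rewrite mulrBr.
  rewrite sumrB -mulr_suml; have := char_sum0; rewrite (bigD1 0) //= chi0 add0r => ->.
  by rewrite mul0r subr0.
apply: le_trans (ler_norm_sum _ _ _) _.
apply: le_trans (_ : (\sum_(c : 'F_p | c != 0%R) (B - cnt c))%N%:R <= _).
  rewrite natr_sum; apply: ler_sum => c c0.
  by rewrite normrM char_norm // mul1r distrC natrB ?ger0_norm ?subr_ge0 ?ler_nat ?cntB.
rewrite -natrX -natrM ler_nat -/Q.
have S1 : (\sum_(c : 'F_p | c != 0%R) (B - cnt c) + \sum_(c : 'F_p | c != 0%R) cnt c = p.-1 * B)%N.
  rewrite -big_split (eq_bigr (fun=> B)) => [|c c0]; last by rewrite /= subnK ?cntB.
  rewrite sum_nat_const; congr (_ * _)%N.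
  by have := cardC1 (0 : 'F_p); rewrite card_Fp //.
have S2 : (cnt 0%R + \sum_(c : 'F_p | c != 0%R) cnt c = Q * Q)%N.
  transitivity (\sum_(c : 'F_p) cnt c)%N; first by rewrite [RHS](bigD1 0%R).
  rewrite mulnn -expnM [(mu * 2)%N]mulnC -cardL -[RHS]sum1_card.
  rewrite [RHS](partition_big (fun x => \prod_i (npol x).[a i] ^+ e i) xpredT) //=.
  by apply: eq_bigr => c _; rewrite sum1_card; apply: eq_card => x; rewrite !inE.
have S3 : (p.-1 * B = (Q - 1) * Q + p.-1 * (3 * E + 4) * Q)%N.
  by rewrite /B mulnA -!addnA [(p.-1 * (A + _))%N]mulnDr [(p.-1 * A)%N]mulnC AE subn1 mulnDl.
have Q0 : (0 < Q)%N by rewrite expn_gt0 prime_gt0.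
have E1 : (E <= E * Q)%N by rewrite leq_pmulr.
have E2 : ((Q - 1) * Q + Q = Q * Q)%N by rewrite mulnBl mul1n subnK // leq_pmull.
rewrite mulnDl; move: S1 S2 S3 cnt0 E1 E2.
move: (\sum_(c | _) (B - _))%N (\sum_(c | _) cnt c)%N (p.-1 * B)%N (cnt 0%R) (Q * Q)%N (E * Q)%N.
by move: ((Q - 1) * Q)%N (p.-1 * _ * Q)%N; clear; lia.
Qed.

End Extension.

Theorem weil_bound :
  `|\sum_c chi (\prod_i (a i - c) ^+ e i)| <= #|I|%:R * sqrtC p%:R.
Proof.
have I0 : (0 < #|I|)%N by apply/card_gt0P; exists i0.
(* The whole L-function, since the coefficients vanish from |I| on. *)
pose q := \poly_(n < #|I|) lcoef lam n.
have qE n : q`_n = lcoef lam n.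
  rewrite coef_poly; case: ltnP => // /lcoef_vanish -> //.
have [ws szws qws] : exists2 ws : seq C, size ws = (size q).-1 &
    q = \prod_(w <- ws) (1 - w *: 'X).
  by apply: closed_one_sub_prod; rewrite qE lcoef0.
have pw n : (0 < n)%N -> lpower lam n = - \sum_(w <- ws) w ^+ n.
  apply: newton_unique => k; rewrite -qws qE (lcoef_rec lam1 lamM).
  by apply: eq_bigr => i _; rewrite qE.
have p0 : 0 < p%:R :> C by rewrite ltr0n prime_gt0.
have wle w : w \in ws -> `|w| <= sqrtC p%:R.
  move=> wws; rewrite -(@ler_pXn2r _ 2) ?nnegrE ?sqrtC_ge0 ?(ltW p0) ?normr_ge0 //.
  rewrite sqrtCK -normrX.
  (* Only even power sums are controlled, so the growth argument runs on the squares of the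
     reciprocal roots, with rho = p. *)
  apply: (power_sum_growth arch (zs := [seq w ^+ 2 | w <- ws])
     (B := (p.-1 * (3 * E + 4) + E)%N%:R)) => //; last by apply/mapP; exists w.
  move=> n n1; have n2 : (0 < 2 * n)%N by rewrite muln_gt0 /= ltnW.
  rewrite big_map.
  have -> : \sum_(j <- ws) (j ^+ 2) ^+ n = - lpower lam (2 * n).
    rewrite pw // opprK; apply: eq_bigr => j _.
    by rewrite -exprM.
  rewrite normrN.
  have [Fm charFm cardFm] := pPrimePowerField p_pr n2.
  exact: (@lpower_bound (pPrimeCharType charFm) (in_alg (pPrimeCharType charFm))).
have -> : \sum_c chi (\prod_i (a i - c) ^+ e i) = lpower lam 1.
  have := lcoef_rec lam1 lamM 1; rewrite mul1r big_nat1 lcoef0 // mulr1 => <-.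
  transitivity (\sum_(g <- [seq 'X - c%:P | c : 'F_p]) lam g).
    rewrite big_image /=; apply: eq_bigr => c _; congr chi; apply: eq_bigr => i _.
    by rewrite !hornerE.
  apply: perm_big; apply: uniq_perm; rewrite ?monics_uniq //.
    by rewrite map_inj_uniq ?enum_uniq // => c c' /addrI/oppr_inj/polyC_inj.
  move=> g; rewrite mem_monics; apply/mapP/andP => [[c _ ->]|[gm /eqP gs]].
    by rewrite monicXsubC size_XsubC.
  exists (- g`_0); first by rewrite mem_enum.
  apply/polyP => -[|[|j]]; rewrite coefB coefX coefC /= ?sub0r ?opprK //.
    by move/monicP: gm; rewrite lead_coefE gs /= subr0 => ->.
  by rewrite oppr0 nth_default // gs.
rewrite pw // normrN; apply: le_trans (ler_norm_sum _ _ _) _.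
apply: le_trans (_ : \sum_(w <- ws) sqrtC p%:R <= _).
  by rewrite big_seq [leRHS]big_seq; apply: ler_sum => w /wle; rewrite expr1.
have -> : \sum_(w <- ws) sqrtC p%:R = (size ws)%:R * sqrtC p%:R :> C.
  by rewrite big_const_seq count_predT iter_addr_0 mulr_natl.
rewrite ler_wpM2r ?sqrtC_ge0 ?(ltW p0) //.
by rewrite ler_nat szws (leq_trans (leq_pred _)) // size_poly.
Qed.

End Weil.

(** * Complete sums to squarefree moduli *)

Lemma periodic_mod (T : Type) (f : nat -> T) m :
  (forall x, f (x + m)%N = f x) -> forall x, f (x %% m)%N = f x.
Proof.
move=> fm x; rewrite [in RHS](divn_eq x m) addnC.
by elim: (x %/ m)%N => [|k IH]; rewrite ?addn0 // mulSn [(m + _)%N]addnC addnA fm.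
Qed.

Lemma sum_crt (R : comNzRingType) m n (f g : nat -> R) : coprime m n ->
  (0 < m)%N -> (0 < n)%N ->
  (forall x, f (x + m)%N = f x) -> (forall x, g (x + n)%N = g x) ->
  \sum_(x < m * n) f x * g x = (\sum_(x < m) f x) * (\sum_(x < n) g x).
Proof.
move=> co m0 n0 fm gn; rewrite big_distrlr pair_big /=.
pose h (x : 'I_(m * n)) : 'I_m * 'I_n :=
  (Ordinal (ltn_pmod x m0), Ordinal (ltn_pmod x n0)).
have hinj : injective h.
  move=> x y [] Em En; apply: val_inj => /=.
  rewrite -[nat_of_ord x](modn_small (ltn_ord x)) -[nat_of_ord y](modn_small (ltn_ord y)).
  by apply/eqP; rewrite chinese_remainder // Em En !eqxx.
have hbij : bijective h.
  by apply: inj_card_bij hinj _; rewrite card_prod !card_ord.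
rewrite (reindex h) /=; last exact: onW_bij.
by apply: eq_bigr => x _; rewrite (periodic_mod fm) (periodic_mod gn).
Qed.

Lemma sum_crt_seq (R : comNzRingType) (ps : seq nat) (Phi : nat -> nat -> R) :
  uniq ps -> all prime ps ->
  (forall p, p \in ps -> forall x, Phi p (x + p)%N = Phi p x) ->
  \sum_(x < \prod_(p <- ps) p) \prod_(p <- ps) Phi p x =
  \prod_(p <- ps) \sum_(x < p) Phi p x.
Proof.
elim: ps => [|p ps IH] /=; first by rewrite !big_nil big_ord_recl big_ord0 big_nil addr0.
move=> /andP[pps ups] /andP[p_pr prs] per.
have per' p' : p' \in ps -> forall x, Phi p' (x + p')%N = Phi p' x.
  by move=> p'ps; apply: per; rewrite inE p'ps orbT.
have co : coprime p (\prod_(p <- ps) p).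
  rewrite big_seq; elim/big_ind: _ => [|x y|p' p'ps]; first exact: coprimen1.
    by rewrite coprimeMr => -> ->.
  rewrite prime_coprime // dvdn_prime2 //; first by apply: contraNneq pps => ->.
  exact: (allP prs).
have prod0 : (0 < \prod_(p <- ps) p)%N.
  by rewrite big_seq; apply: prodn_cond_gt0 => i /(allP prs)/prime_gt0.
rewrite [in RHS]big_cons -IH // big_cons.
rewrite -(@sum_crt _ _ _ (Phi p) (fun x => \prod_(p0 <- ps) Phi p0 x)) ?(prime_gt0 p_pr) //.
- by apply: eq_bigr => x _; rewrite big_cons.
- by move=> x; apply: per; rewrite inE eqxx.
move=> x; rewrite big_seq [RHS]big_seq; apply: eq_bigr => p' p'ps.
have /dvdnP[k ->] : (p' %| \prod_(p0 <- ps) p0)%N by rewrite (big_rem _ p'ps) /= dvdn_mulr.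
by elim: k => [|k IHk]; rewrite ?addn0 // mulSn [(p' + _)%N]addnC addnA per'.
Qed.

Section LocalSum.
Variable C : numClosedFieldType.
Hypothesis arch : forall x : C, 0 <= x -> exists n : nat, x < n%:R.

Definition nontrivial_char p (psi : nat -> C) : Prop :=
  [/\ forall x y, psi (x * y)%N = psi x * psi y, forall x, psi (x + p)%N = psi x,
      psi 0%N = 0, psi 1%N = 1 & exists2 x, ~~ (p %| x)%N & psi x != 1].

(** With indices in bool * 'I_r, conditional conjugation writes |S|^(2r) as a single product of 2r
    factors. *)
Definition cj (b : bool) (z : C) : C := if b then z^* else z.

Lemma cjM b : {morph cj b : x y / x * y}.
Proof. by case: b => x y //=; rewrite rmorphM. Qed.

Lemma cj0 b : cj b 0 = 0. Proof. by case: b; rewrite /cj ?conjC0. Qed.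
Lemma cj1 b : cj b 1 = 1. Proof. by case: b; rewrite /cj ?conjC1. Qed.
Lemma norm_cj b z : `|cj b z| = `|z|. Proof. by case: b; rewrite /cj ?norm_conjC. Qed.
Lemma cj_eq1 b z : (cj b z == 1) = (z == 1).
Proof. by case: b => //=; rewrite -{1}(conjC1 C) (inj_eq (can_inj (@conjCK C))). Qed.

Variables (p : nat) (psi : nat -> C).
Hypotheses (p_pr : prime p) (psiP : nontrivial_char p psi).

Let psi_mod x : psi (x %% p)%N = psi x.
Proof. by case: psiP => _ per _ _ _; apply: periodic_mod. Qed.

Let val_Fp n : (n%:R : 'F_p) = (n %% p)%N :> nat.
Proof. exact: val_Fp_nat. Qed.

Let chi b (c : 'F_p) := cj b (psi c).

Let chi1 b : chi b 1 = 1.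
Proof.
case: psiP => _ _ _ p1 _; rewrite /chi -[1]/(1%:R) val_Fp psi_mod p1; exact: cj1.
Qed.

Let chi0 b : chi b 0 = 0.
Proof. by case: psiP => _ _ p0 _ _; rewrite /chi p0 cj0. Qed.

Let chiM b : {morph chi b : x y / x * y}.
Proof.
move=> x y; case: psiP => pM _ _ _ _; rewrite /chi -cjM -pM.
by rewrite -{1}[x]natr_Zp -{1}[y]natr_Zp -natrM val_Fp psi_mod.
Qed.

Let chi_nt b : exists2 y, y != 0 & chi b y != 1.
Proof.
case: psiP => _ _ _ _ [x xp x1]; exists x%:R; last by rewrite /chi val_Fp psi_mod cj_eq1.
by apply: contra xp => /eqP/(congr1 (@nat_of_ord _)); rewrite val_Fp => /eqP.
Qed.

Lemma psi_norm_le1 x : `|psi x| <= 1.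
Proof.
rewrite -psi_mod -val_Fp -[psi _]/(chi false x%:R).
have [->|nz] := eqVneq (x%:R : 'F_p) 0; first by rewrite chi0 normr0 ler01.
by rewrite (char_norm p_pr (chi1 _) (chiM _) nz).
Qed.

(** Modulo 2 every unit is 1. The bound makes p - 2 positive, so that c^(p-2), which stands for 1/c,
    vanishes at c = 0. *)
Lemma nontrivial_char_gt2 : (2 < p)%N.
Proof.
rewrite ltn_neqAle prime_gt1 // andbT; apply/eqP => p2.
case: psiP => _ _ _ p1 [x xp]; rewrite -psi_mod -p2 modn2.
by move: xp; rewrite -p2 dvdn2 negbK => ->; rewrite p1 eqxx.
Qed.

Let chi_conj b c : chi (~~ b) c = chi b (c ^+ (p - 2)).
Proof.
have p2 := nontrivial_char_gt2.
have [->|c0] := eqVneq c 0.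
  by rewrite expr0n subn_eq0 leqNgt p2 !chi0.
have nc : `|chi b c| = 1 by apply: (char_norm p_pr (chi1 _) (chiM _) c0).
have cc0 : chi b c != 0 by rewrite -normr_eq0 nc oner_eq0.
apply: (mulIf cc0); rewrite -chiM -exprSr.
have -> : c ^+ (p - 2).+1 = 1.
  apply: (mulIf c0); rewrite mul1r -exprSr.
  have -> : (p - 2).+2 = p by lia.
  by have := expf_card c; rewrite card_Fp.
rewrite chi1; have -> : chi (~~ b) c = (chi b c)^*.
  by rewrite /chi; case: b {nc cc0} => //=; rewrite conjCK.
by rewrite mulrC -normCK nc expr1n.
Qed.

Variables (I : finType) (sgn : I -> bool) (v : I -> nat).

Lemma local_sum_trivial :
  `|\sum_(x < p) \prod_i cj (sgn i) (psi (x + v i)%N)| <= p%:R.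
Proof.
apply: le_trans (ler_norm_sum _ _ _) _.
apply: le_trans (_ : \sum_(x < p) 1 <= _); last by rewrite sumr_const card_ord.
apply: ler_sum => x _; rewrite normr_prod; apply: prodr_ile1 => i _.
by rewrite normr_ge0 norm_cj psi_norm_le1.
Qed.

(** Conjugates are turned into powers p - 2 of one character, the one carried by i0, so that the
    isolated i0 keeps the exponent 1 required by [weil_bound]. *)
Lemma local_sum_weil (i0 : I) : (forall i, i != i0 -> v i != v i0 %[mod p]) ->
  `|\sum_(x < p) \prod_i cj (sgn i) (psi (x + v i)%N)| <= #|I|%:R * sqrtC p%:R.
Proof.
move=> vi0.
pose e i := if sgn i == sgn i0 then 1%N else (p - 2)%N.
pose a i : 'F_p := (v i)%:R.
have e0 : e i0 = 1%N by rewrite /e eqxx.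
have a0 i : i != i0 -> a i != a i0.
  move=> /vi0; apply: contra => /eqP/(congr1 (@nat_of_ord _)).
  by rewrite /a !val_Fp => ->.
have := weil_bound arch p_pr (chi1 _) (chi0 _) (chiM (sgn i0)) (chi_nt _) e0 a0.
rewrite (reindex_inj oppr_inj) /=; congr (`|_| <= _).
transitivity (\sum_(0 <= x < p) \prod_i cj (sgn i) (psi (x + v i)%N)); last by rewrite big_mkord.
rewrite -[p in RHS](Fp_cast p_pr) big_mkord; apply: eq_bigr => c _.
rewrite (big_morph _ (chiM _) (chi1 _)); apply: eq_bigr => i _.
have -> : a i - - c = (c + v i)%N%:R by rewrite opprK addrC natrD natr_Zp.
rewrite -[psi (c + v i)%N]psi_mod -val_Fp -/(chi (sgn i) _) /e.
have [->|ne] := eqVneq (sgn i) (sgn i0); first by rewrite expr1.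
by rewrite -chi_conj; congr (chi _ _); move: ne; case: (sgn i); case: (sgn i0).
Qed.

End LocalSum.

(** * Congruences between variables and averages of common divisors *)

Definition dist (a b : nat) : nat := (a - b + (b - a))%N.

Lemma dist_eqmod p a b : (a == b %[mod p]) = (p %| dist a b)%N.
Proof.
have [le|/ltnW le] := leqP a b.
  by rewrite /dist (eqP (_ : (a - b)%N == 0%N)) ?add0n ?subn_eq0 // eq_sym eqn_mod_dvd.
by rewrite /dist (eqP (_ : (b - a)%N == 0%N)) ?addn0 ?subn_eq0 // eqn_mod_dvd.
Qed.

(* Weil's bound applies to p as soon as one v i is isolated modulo p. *)
Definition bad (I : finType) (v : I -> nat) (p : nat) : bool :=
  [forall i, exists j, (j != i) && (v j == v i %[mod p])].

(** For distinct primes, the gcd of h with their product. *)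
Definition smooth_part (ps : seq nat) (h : nat) : nat :=
  (\prod_(p <- ps) if (p %| h)%N then p else 1)%N.

(** Badness of p gives some j <> k with v j = v k mod p. J collects one such j for each bad prime,
    whence its size, and each bad p appears inside the factor of its own j. *)
Lemma bad_prod (I : finType) (v : I -> nat) (ps : seq nat) (k : I) :
  all prime ps -> exists J : {set I}, [/\ k \notin J, (#|J| <= size ps)%N &
   (\prod_(p <- ps) (if bad v p then p else 1) <=
     \prod_(j in J) smooth_part ps (dist (v j) (v k)))%N].
Proof.
move=> prs; pose jp p := odflt k [pick j | (j != k) && (v j == v k %[mod p])].
have jpP p : bad v p -> jp p != k /\ v (jp p) == v k %[mod p].
  move=> /forallP/(_ k)/existsP[j jP]; rewrite /jp; case: pickP => [j' /andP[] //|/(_ j)].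
  by rewrite jP.
pose J := [set j in [seq jp p | p <- ps & bad v p]].
exists J; split.
- rewrite inE; apply/mapP => -[p]; rewrite mem_filter => /andP[/jpP[jk _] _] kE.
  by rewrite -kE eqxx in jk.
- rewrite cardsE (leq_trans (card_size _)) // size_map size_filter.
  exact: count_size.
rewrite /smooth_part exchange_big /=.
rewrite big_seq [X in (_ <= X)%N]big_seq; apply: leq_prod => p pps.
have pge1 j : (0 < if (p %| dist (v j) (v k))%N then p else 1)%N.
  by case: ifP => // _; rewrite prime_gt0 // (allP prs).
case: ifP => [bp|_]; last by apply: prodn_cond_gt0 => j _.
have [_ jm] := jpP p bp.
rewrite (bigD1 (jp p)) /=; last by rewrite inE; apply/mapP; exists p; rewrite // mem_filter bp.
by rewrite -dist_eqmod jm leq_pmulr // prodn_cond_gt0.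
Qed.

Lemma big_multiples (R : Type) (idx : R) (op : Monoid.law idx) (p B : nat) (f : nat -> R) :
  (0 < p)%N ->
  \big[op/idx]_(1 <= h < B.+1 | (p %| h)%N) f h =
  \big[op/idx]_(1 <= h < (B %/ p).+1) f (p * h)%N.
Proof.
move=> p0; elim: B => [|B IH]; first by rewrite div0n !big_geq.
rewrite big_mkcond big_nat_recr //= -big_mkcond IH.
have [/dvdnP[k kE]|np] := boolP (p %| B.+1)%N; last first.
  rewrite Monoid.mulm1; congr (\big[op/idx]_(1 <= h < _.+1) _).
  apply/eqP; rewrite eqn_leq leq_div2r //= -ltnS -(ltn_pmul2r p0).
  have := divn_eq B.+1 p; have : (0 < B.+1 %% p)%N by rewrite lt0n.
  rewrite ltn_pmul2r // ltnS leq_divRL // -ltnS; move: (B.+1 %/ p * p)%N (B.+1 %% p)%N; lia.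
rewrite kE mulnK //; case: k kE => [|k kE]; first by [].
rewrite [RHS]big_nat_recr //= [(k.+1 * p)%N]mulnC; congr (op (\big[op/idx]_(1 <= h < _.+1) _) _).
by apply/eqP; rewrite eqn_leq -ltnS ltn_divLR // leq_divRL //; lia.
Qed.

(** A new prime p adds weight p on at most B/p multiples, so it at most doubles the sum. *)
Lemma sum_smooth_part ps B : uniq ps -> all prime ps ->
  (\sum_(1 <= h < B.+1) smooth_part ps h <= 2 ^ size ps * B)%N.
Proof.
elim: ps B => [|p ps IH] B /=.
  by rewrite (eq_bigr (fun=> 1%N)) ?sum_nat_const_nat ?subn1 ?muln1 ?mul1n // => h _; rewrite /smooth_part big_nil.
move=> /andP[pps ups] /andP[p_pr prs]; have p0 := prime_gt0 p_pr.
have step h : (smooth_part (p :: ps) h <= smooth_part ps h +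
     (if p %| h then p * smooth_part ps h else 0))%N.
  rewrite /smooth_part big_cons; case: ifP => _; last by rewrite mul1n addn0.
  by rewrite leq_addl.
apply: leq_trans (leq_sum _ (fun h _ => step h)) _.
rewrite big_split /= -big_mkcond big_multiples // expnS mul2n -addnn mulnDl leq_add ?IH //.
have ph h : smooth_part ps (p * h) = smooth_part ps h.
  rewrite /smooth_part big_seq [RHS]big_seq; apply: eq_bigr => p' p'ps.
  have p'_pr : prime p' by apply: (allP prs).
  rewrite Gauss_dvdr // prime_coprime // dvdn_prime2 //.
  by apply: contraNneq pps => <-.
rewrite (eq_bigr _ (fun h _ => congr1 (muln p) (ph h))) -big_distrr /=.
apply: leq_trans (leq_mul (leqnn p) (IH _ ups prs)) _.
by rewrite mulnCA leq_mul2l mulnC leq_divM orbT.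
Qed.

(** Each distance occurs at most once on either side of c, hence one more factor 2. *)
Lemma sum_smooth_dist ps B (c : 'I_B) : uniq ps -> all prime ps ->
  (\sum_(x < B | x != c) smooth_part ps (dist x.+1 c.+1) <= 2 ^ (size ps).+1 * B)%N.
Proof.
move=> ups prs.
pose G h := smooth_part ps h.
have half n : (n <= B)%N -> (\sum_(1 <= h < n.+1) G h <= 2 ^ size ps * B)%N.
  move=> nB; apply: leq_trans (sum_smooth_part B ups prs).
  by rewrite [leqRHS](@big_cat_nat _ _ _ n.+1) //= leq_addr.
rewrite (bigID (fun x : 'I_B => x < c)%N) /= expnS mul2n -addnn mulnDl leq_add //.
  apply: leq_trans (half c (ltnW (ltn_ord c))).
  rewrite big_add1 /= big_nat_rev /= add0n.
  rewrite (big_nat_widen _ _ B) ?(ltnW (ltn_ord c)) // big_mkord.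
  rewrite (eq_bigl (fun x : 'I_B => x < c)%N).
    rewrite [leqRHS](eq_bigr (fun x : 'I_B => G (dist x.+1 c.+1))) // => x xc.
    by congr G; rewrite /dist; lia.
  by move=> x /=; rewrite -val_eqE /=; lia.
apply: leq_trans (half (B - c.+1)%N (leq_subr _ _)).
rewrite big_add1 /=.
have -> : (\sum_(0 <= i < B - c.+1) G i.+1 = \sum_(c.+1 <= i < B) G (i - c))%N.
  rewrite -{2}[c.+1]add0n big_addn; apply: eq_bigr => i _; congr G; lia.
rewrite (big_nat_widenl _ 0) // big_mkord.
rewrite (eq_bigl (fun x : 'I_B => c < x)%N).
  rewrite [leqRHS](eq_bigr (fun x : 'I_B => G (dist x.+1 c.+1))) // => x xc.
  by congr G; rewrite /dist; lia.
by move=> x /=; rewrite -val_eqE /=; lia.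
Qed.

Section CompleteSum.
Variable C : numClosedFieldType.
Hypothesis arch : forall x : C, 0 <= x -> exists n : nat, x < n%:R.
Variables (ps : seq nat) (chip : nat -> nat -> C).
Hypotheses (ups : uniq ps) (prs : all prime ps)
  (chipP : forall p, p \in ps -> nontrivial_char p (chip p)).

Let q := (\prod_(p <- ps) p)%N.
Definition prod_char x : C := \prod_(p <- ps) chip p x.
Local Notation chi := prod_char.

Lemma prod_char_norm_le1 x : `|chi x| <= 1.
Proof.
rewrite normr_prod big_seq prodr_ile1 // => p pps.
by rewrite normr_ge0 (psi_norm_le1 (allP prs _ pps) (chipP pps)).
Qed.

Lemma complete_sum (I : finType) (sgn : I -> bool) (v : I -> nat) :
  `|\sum_(x < q) \prod_i cj (sgn i) (chi (x + v i)%N)| <=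
  \prod_(p <- ps) (if bad v p then p%:R else #|I|%:R * sqrtC p%:R).
Proof.
rewrite (eq_bigr (fun x : 'I_q => \prod_(p <- ps) \prod_i cj (sgn i) (chip p (x + v i)%N))); last first.
  move=> x _; rewrite exchange_big; apply: eq_bigr => i _.
  exact: (big_morph _ (cjM _) (cj1 _ _)).
rewrite (@sum_crt_seq C ps (fun p x => \prod_i cj (sgn i) (chip p (x + v i)%N))) //; last first.
  move=> p pps x; apply: eq_bigr => i _; congr (cj _ _).
  by case: (chipP pps) => _ per _ _ _; rewrite addnAC per.
rewrite normr_prod big_seq [leRHS]big_seq; apply: ler_prod => p pps; rewrite normr_ge0 /=.
have p_pr : prime p by apply: (allP prs).
case: ifPn => [_|/forallPn[i0 /existsPn good]].
  exact: (local_sum_trivial p_pr (chipP pps)).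
have H i : i != i0 -> v i != v i0 %[mod p] by move=> ii0; have := good i; rewrite ii0.
exact: (local_sum_weil arch p_pr (chipP pps) _ H).
Qed.

(** Crude at a bad prime, which pays p on top of its share of sqrt q; this lets sqrt q be factored
    out uniformly in v. *)
Lemma prod_weight (I : finType) (v : I -> nat) (k : I) :
  \prod_(p <- ps) (if bad v p then p%:R else #|I|%:R * sqrtC p%:R) <=
  #|I|%:R ^+ size ps * sqrtC q%:R * (\prod_(p <- ps) if bad v p then p else 1)%N%:R :> C.
Proof.
have I1 : 1 <= #|I|%:R :> C by rewrite ler1n; apply/card_gt0P; exists k.
have -> : #|I|%:R ^+ size ps * sqrtC q%:R * (\prod_(p <- ps) if bad v p then p else 1)%N%:R
  = \prod_(p <- ps) (#|I|%:R * sqrtC p%:R * (if bad v p then p else 1)%N%:R) :> C.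
  rewrite /q !natr_prod; elim: (ps) => [|p l IH]; first by rewrite !big_nil expr0 sqrtC1 !mulr1.
  rewrite !big_cons -IH /= exprS sqrtCM ?nnegrE ?prodr_ge0 //.
  by rewrite -!mulrA; congr (_ * _); rewrite !mulrA; congr (_ * _); rewrite mulrC !mulrA; congr (_ * _); rewrite mulrC -!mulrA.
rewrite big_seq [leRHS]big_seq; apply: ler_prod => p pps.
have p1 : 1 <= p%:R :> C by rewrite ler1n prime_gt0 // (allP prs).
have s0 : 1 <= sqrtC p%:R :> C by rewrite -[leLHS]sqrtC1 ler_sqrtC ?nnegrE ?ler01 ?ler0n.
case: ifP => _; last by rewrite mulr1 lexx mulr_ge0 ?ler0n // (le_trans ler01).
by rewrite ler0n ler_peMl ?ler0n // mulr_ege1.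
Qed.

End CompleteSum.

(** * Vinogradov's system *)

Section Solutions.
Variables (d B : nat).

(** Elements of 'I_B stand for 1, ..., B and j for the exponent j + 1; the boolean selects the side
    of the system. *)
Definition vsol r (V : {ffun bool * 'I_r -> 'I_B}) : bool :=
  [forall j : 'I_d, (\sum_(i < r) (V (false, i)).+1 ^ j.+1 ==
                     \sum_(i < r) (V (true, i)).+1 ^ j.+1)%N].

Definition vcount r : nat := #|[set V : {ffun bool * 'I_r -> 'I_B} | vsol V]|.

Variable C : numClosedFieldType.

Lemma prim_root_ex m : (0 < m)%N -> exists z : C, m.-primitive_root z.
Proof.
move=> m0; pose p : {poly C} := 'X^m - 1.
have [r pE] := closed_field_poly_normal p.
have p0 : p \is monic by rewrite monicXnsubC.
rewrite (monicP p0) scale1r in pE.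
have rr : all m.-unity_root r by apply/allP => z; rewrite -root_prod_XsubC -pE.
have sz : size r = m.
  by apply/eqP; rewrite -eqSS -(size_prod_XsubC _ id) -pE size_XnsubC.
have ur : uniq r.
  by rewrite -separable_prod_XsubC -pE separable_Xn_sub_1 // pnatr_eq0 -lt0n.
by have /hasP[z _ zm] := cyclic.has_prim_root m0 rr ur (eq_leq (esym sz)); exists z.
Qed.

Section Orthogonality.
Variables (m : nat) (z : C).
Hypothesis zm : m.-primitive_root z.

Let z1 : `|z| = 1.
Proof.
have m0 := prim_order_gt0 zm.
have /eqP : `|z| ^+ m = 1 by rewrite -normrX (prim_expr_order zm) normr1.
by rewrite pexpr_eq1 ?normr_ge0 // => /eqP.
Qed.

(** Plays the role of e(alpha_1 x + ... + alpha_d x^d) with alpha_j = t_j / m: the integral over the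
    torus becomes a finite average over m-th roots of unity. *)
Definition addchar (t : {ffun 'I_d -> 'I_m}) (x : nat) : C :=
  \prod_(j < d) z ^+ (t j * x ^ j.+1).

Lemma norm_addchar t x : `|addchar t x| = 1.
Proof.
by rewrite normr_prod big1 // => j _; rewrite normrX z1 expr1n.
Qed.

(** All power sums are at most r B^d < m, so congruence modulo m is equality. *)
Lemma addchar_orth r (V : {ffun bool * 'I_r -> 'I_B}) : (r * B ^ d < m)%N ->
  \sum_t \prod_i cj i.1 (addchar t (V i).+1) = (m ^ d)%:R * (vsol V)%:R.
Proof.
move=> mbig; have m0 := prim_order_gt0 zm.
pose S b (j : 'I_d) := (\sum_(i < r) (V (b, i)).+1 ^ j.+1)%N.
pose w j := z ^+ S false j * (z ^+ S true j)^*.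
have E t : \prod_i cj i.1 (addchar t (V i).+1) = \prod_(j < d) w j ^+ t j.
  transitivity (\prod_b \prod_i cj b (addchar t (V (b, i)).+1)).
    by rewrite pair_big; apply: eq_bigr => -[b i] _.
  have Eb b : \prod_i cj b (addchar t (V (b, i)).+1) = cj b (\prod_(j < d) z ^+ (t j * S b j)).
    rewrite -(big_morph _ (cjM b) (cj1 _ b)) exchange_big /=; congr (cj b _).
    by apply: eq_bigr => j _; rewrite -expr_sum -big_distrr.
  rewrite (eq_bigr _ (fun b _ => Eb b)) big_bool /= rmorph_prod [LHS]mulrC -big_split /=; apply: eq_bigr => j _.
  by rewrite /w exprMn -!exprM -rmorphXn -exprM ![(_ * t j)%N]mulnC.
rewrite (eq_bigr _ (fun t _ => E t)) -(bigA_distr_bigA (fun j (x : 'I_m) => w j ^+ x)).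
have wm j : w j ^+ m = 1.
  have zS k : (z ^+ k) ^+ m = 1 by rewrite exprAC (prim_expr_order zm) expr1n.
  by rewrite /w exprMn -rmorphXn !zS rmorph1 mulr1.
have Sm b j : (S b j < m)%N.
  apply: leq_ltn_trans mbig; rewrite -[X in (_ <= X * _)%N]card_ord -sum_nat_const.
  apply: leq_sum => i _; apply: leq_trans (_ : B ^ j.+1 <= _)%N.
    by rewrite leq_exp2r.
  rewrite leq_pexp2l //; exact: leq_ltn_trans (ltn_ord (V (b, i))).
have w1 j : (w j == 1) = (S false j == S true j).
  have nz : (z ^+ S true j)^* != 0 by rewrite -normr_eq0 norm_conjC normrX z1 expr1n oner_eq0.
  have nn : z ^+ S true j * (z ^+ S true j)^* = 1 by rewrite -normCK normrX z1 !expr1n.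
  rewrite /w -{1}nn (inj_eq (mulIf nz)) (eq_prim_root_expr zm).
  by rewrite !modn_small.
have geo j : \sum_(x < m) w j ^+ x = m%:R * (S false j == S true j)%:R.
  have [/eqP wj1|wj1] := boolP (w j == 1).
    rewrite -w1 wj1 eqxx mulr1 (eq_bigr (fun=> 1)) => [|x _]; last by rewrite expr1n.
    by rewrite sumr_const card_ord.
  rewrite -w1 (negPf wj1) mulr0; apply/eqP.
  have /eqP := subrX1 (w j) m; rewrite wm subrr eq_sym mulf_eq0 subr_eq0 (negPf wj1) /=.
  by [].
rewrite (eq_bigr _ (fun j _ => geo j)) big_split /= prodr_const card_ord natrX; congr (_ * _).
rewrite /vsol; case: forallP => [H|H].
  by rewrite big1 // => j _; rewrite (H j).
have [j Hj] : exists j, ~~ (S false j == S true j).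
  by apply/existsP; rewrite -negb_forall; apply/forallP.
by rewrite (bigD1 j) //= (negPf Hj) mul0r.
Qed.

End Orthogonality.

(* Detecting the solutions by additive characters, one may bound the factors of the
   weighted variables trivially: the remaining ones form a power of a single exponential sum. *)
Lemma weighted_count r r' (K : {set bool * 'I_r}) (F : bool * 'I_r -> 'I_B -> nat) :
  (r' <= r)%N -> (#|K| <= 2 * (r - r'))%N -> (forall i, i \notin K -> forall x, F i x = 1%N) ->
  (\sum_(V : {ffun bool * 'I_r -> 'I_B} | vsol V) \prod_i F i (V i) <=
   (\prod_(i in K) \sum_x F i x) * B ^ (2 * (r - r') - #|K|) * vcount r')%N.
Proof.
move=> r'r leK F1.
pose m := (r * B ^ d).+1.
have [z zm] := prim_root_ex (isT : (0 < m)%N).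
have md0 : (0 < (m ^ d)%:R :> C) by rewrite ltr0n expn_gt0.
rewrite -(ler_nat C) -(ler_pM2l md0).
pose f (t : {ffun 'I_d -> 'I_m}) := \sum_(x < B) addchar z t x.+1.
have I1 : (m ^ d)%:R * (\sum_(V : {ffun bool * 'I_r -> 'I_B} | vsol V) \prod_i F i (V i))%N%:R =
   \sum_(t : {ffun 'I_d -> 'I_m}) \prod_i \sum_(x < B) (F i x)%:R * cj i.1 (addchar z t x.+1).
  under [RHS]eq_bigr do rewrite bigA_distr_bigA.
  rewrite exchange_big big_mkcond natr_sum mulr_sumr; apply: eq_bigr => V _.
  under [RHS]eq_bigr do rewrite big_split.
  rewrite -mulr_sumr (addchar_orth zm) // mulrCA; congr (_ * _).
  by case: (vsol V); rewrite ?mulr1 ?mulr0 // natr_prod.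
have I2 : (m ^ d)%:R * (vcount r')%:R = \sum_t `|f t| ^+ (2 * r').
  have mr' : (r' * B ^ d < m)%N by rewrite ltnS leq_mul2r r'r orbT.
  rewrite /vcount -sum1_card natr_sum mulr_sumr big_mkcond /=.
  rewrite (eq_bigr (fun V : {ffun bool * 'I_r' -> 'I_B} => \sum_(t : {ffun 'I_d -> 'I_m}) \prod_i cj i.1 (addchar z t (V i).+1))); last first.
    by move=> V _; rewrite (addchar_orth zm) // inE; case: ifP; rewrite ?mulr1 ?mulr0.
  rewrite exchange_big; apply: eq_bigr => t _.
  rewrite -(bigA_distr_bigA (fun (i : bool * 'I_r') (x : 'I_B) => cj i.1 (addchar z t x.+1))).
  rewrite (eq_bigr (fun i => cj i.1 (f t))); last first.
    move=> [[] i] _ //=; by rewrite /f rmorph_sum.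
  transitivity (\prod_b \prod_(i < r') cj b (f t)).
    by rewrite pair_big; apply: eq_bigr => -[b i] _.
  by rewrite big_bool /= !prodr_const card_ord /= -exprMn mulrC -normCK exprM.
rewrite I1 natrM mulrCA I2 mulr_sumr.
rewrite -[leLHS]ger0_norm; last by rewrite -I1 mulr_ge0 ?ler0n.
apply: le_trans (ler_norm_sum _ _ _) _; apply: ler_sum => t _.
rewrite normr_prod (bigID (mem K)) /= natrM -mulrA.
apply: ler_pM; rewrite ?prodr_ge0 //.
  rewrite natr_prod; apply: ler_prod => i _; rewrite normr_ge0 /=.
  apply: le_trans (ler_norm_sum _ _ _) _; rewrite natr_sum; apply: ler_sum => x _.
  by rewrite normrM norm_cj (norm_addchar zm) mulr1 normr_nat.
rewrite (eq_bigr (fun=> `|f t|)); last first.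
  move=> i iK; rewrite -(norm_cj i.1 (f t)) /f; congr `|_|.
  rewrite (eq_bigr (fun x : 'I_B => cj i.1 (addchar z t x.+1))); last by move=> x _; rewrite F1 ?mul1r.
  by case: (i.1); rewrite //= rmorph_sum.
rewrite prodr_const.
have -> : #|[predC K]| = (2 * (r - r') - #|K| + 2 * r')%N.
  have KE : (#|K| + #|[predC K]| = 2 * r)%N by rewrite cardC card_prod card_bool card_ord.
  by move: leK KE r'r; clear; lia.
rewrite exprD ler_wpM2r ?exprn_ge0 // natrX lerXn2r ?nnegrE ?ler0n //.
apply: le_trans (ler_norm_sum _ _ _) _.
under eq_bigr do rewrite (norm_addchar zm).
by rewrite sumr_const card_ord.
Qed.

End Solutions.

(** * Cauchy-Schwarz and power means *)

Section Inequalities.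
Variables (C : numClosedFieldType) (I : finType) (A : pred I).

Lemma ler_2mul (x y : C) : 0 <= x -> 0 <= y -> x * y *+ 2 <= x ^+ 2 + y ^+ 2.
Proof.
move=> x0 y0; rewrite -subr_ge0.
have -> : x ^+ 2 + y ^+ 2 - x * y *+ 2 = (x - y) ^+ 2 by rewrite sqrrB addrAC.
by rewrite real_exprn_even_ge0 // rpredB // ger0_real.
Qed.

Lemma cauchy_schwarz (a b : I -> C) : (forall i, 0 <= a i) -> (forall i, 0 <= b i) ->
  (\sum_(i | A i) a i * b i) ^+ 2 <= (\sum_(i | A i) a i ^+ 2) * (\sum_(i | A i) b i ^+ 2).
Proof.
move=> a0 b0; rewrite -(ler_pMn2r (isT : (0 < 2)%N)) expr2 !big_distrlr /=.
rewrite [leRHS]mulr2n [X in _ <= _ + X]exchange_big /= -big_split -sumrMnl /=.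
apply: ler_sum => i _; rewrite -sumrMnl -big_split; apply: ler_sum => j _ /=.
have := ler_2mul (mulr_ge0 (a0 i) (b0 j)) (mulr_ge0 (a0 j) (b0 i)).
by rewrite !exprMn [a i * b i * _]mulrACA [a i * b j * _]mulrACA [b j * b i]mulrC [_ ^+ 2 * b i ^+ 2]mulrC.
Qed.

Lemma power_mean (y : I -> C) k : (forall i, 0 <= y i) ->
  (\sum_(i | A i) y i) ^+ k.+1 <= #|A|%:R ^+ k * \sum_(i | A i) y i ^+ k.+1.
Proof.
move=> y0; elim: k => [|k IH].
  by rewrite expr1 mul1r; under [leRHS]eq_bigr do rewrite expr1.
have S0 : 0 <= \sum_(i | A i) y i by apply: sumr_ge0.
rewrite exprS; apply: le_trans (ler_wpM2l S0 IH) _.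
rewrite mulrCA exprSr -!mulrA ler_wpM2l ?exprn_ge0 ?ler0n //.
rewrite -(ler_pMn2r (isT : (0 < 2)%N)).
have -> : #|A|%:R * (\sum_(i | A i) y i ^+ k.+2) *+ 2 =
    \sum_(i | A i) \sum_(j | A j) (y i ^+ k.+2 + y j ^+ k.+2).
  under [RHS]eq_bigr do rewrite big_split /= sumr_const.
  by rewrite big_split /= sumr_const sumrMnl mulr_natl [LHS]mulr2n.
rewrite big_distrlr /= mulr2n [X in _ + X <= _]exchange_big /= -big_split.
apply: ler_sum => i _; rewrite -big_split; apply: ler_sum => j _ /=.
rewrite -subr_ge0.
(* Chebyshev's trick: y_i - y_j and y_i^(k+1) - y_j^(k+1) have the same sign. *)
have -> : y i ^+ k.+2 + y j ^+ k.+2 - (y i * y j ^+ k.+1 + y j * y i ^+ k.+1) =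
   (y i - y j) * (y i ^+ k.+1 - y j ^+ k.+1).
  rewrite mulrBl !mulrBr -!exprS; ring.
rewrite subrXX mulrA -expr2 mulr_ge0 //.
  by rewrite real_exprn_even_ge0 // rpredB // ger0_real.
by apply: sumr_ge0 => l _; rewrite mulr_ge0 ?exprn_ge0.
Qed.

End Inequalities.

(** * Moments of incomplete sums, uniformly in the phases *)

Section MeanValue.
Variable C : numClosedFieldType.

(** The value e(G(b)) for G of degree at most d, where u_j is e of the j-th coefficient. *)
Definition poly_phase (d : nat) (u : nat -> C) (b : nat) : C :=
  \prod_(j < d.+1) u j ^+ (b ^ j).

Definition vsum (d B r : nat) (c : 'I_B -> C) : C :=
  \sum_(V : {ffun bool * 'I_r -> 'I_B} | vsol d V) \prod_i cj i.1 (c (V i)).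

(* Expanding the [r]-th power, the sum becomes a trigonometric polynomial in the phases
   whose frequencies are the vectors of power sums; Cauchy-Schwarz over these
   vectors gives a bound uniform in the phases. *)
Lemma phase_sum_bound d B r (c : 'I_B -> C) (u : nat -> C) : (0 < B)%N ->
  (forall j, `|u j| = 1) ->
  `|\sum_(b < B) c b * poly_phase d u b.+1| ^+ (2 * r) <=
   (\prod_(j < d) (r * B ^ j.+1).+1)%N%:R * vsum d r c.
Proof.
move=> B0 u1; pose M := (r * B ^ d)%N.
pose P (v : {ffun 'I_r -> 'I_B}) j := (\sum_(i < r) (v i).+1 ^ j)%N.
pose key (v : {ffun 'I_r -> 'I_B}) : {ffun 'I_d -> 'I_M.+1} := [ffun j => inord (P v (nat_of_ord j).+1)].
have Ple v j : (P v j <= r * B ^ j)%N.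
  rewrite -[X in (_ <= X * _)%N]card_ord -sum_nat_const; apply: leq_sum => i _.
  by case: j => [|j]; rewrite ?expn0 // leq_exp2r.
have keyE v (j : 'I_d) : key v j = P v j.+1 :> nat.
  rewrite ffunE inordK // ltnS (leq_trans (Ple _ _)) // leq_mul2l leq_pexp2l ?orbT //.
pose cc (v : {ffun 'I_r -> 'I_B}) := \prod_i c (v i).
pose psi (n : {ffun 'I_d -> 'I_M.+1}) := u 0%N ^+ r * \prod_(j < d) u j.+1 ^+ n j.
have psi1 n : `|psi n| = 1.
  rewrite normrM normrX u1 expr1n mul1r normr_prod big1 // => j _.
  by rewrite normrX u1 expr1n.
have E : (\sum_(b < B) c b * poly_phase d u b.+1) ^+ r = \sum_v cc v * psi (key v).
  rewrite -[r in LHS]card_ord -prodr_const bigA_distr_bigA; apply: eq_bigr => v _.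
  rewrite big_split; congr (_ * _); rewrite /psi /poly_phase exchange_big big_ord_recl /=.
  congr (_ * _).
    by under eq_bigr do rewrite expn0 expr1; rewrite prodr_const card_ord.
  by apply: eq_bigr => j _; rewrite keyE -expr_sum.
pose A : pred {ffun 'I_d -> 'I_M.+1} := fun n => n \in [set key v | v in [set: {ffun 'I_r -> 'I_B}]].
pose g n := \sum_(v | key v == n) cc v.
have E2 : \sum_v cc v * psi (key v) = \sum_(n | A n) g n * psi n.
  rewrite (partition_big key A) /=; last by move=> v _; apply/imsetP; exists v.
  by apply: eq_bigr => n _; rewrite mulr_suml; apply: eq_bigr => v /eqP ->.
(* The power sum of exponent j + 1 is at most r B^(j+1), so only about B^(1 + ... + d) = B^D
   frequencies occur. *)
have cardA : (#|A| <= \prod_(j < d) (r * B ^ j.+1).+1)%N.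
  pose Fm (j : 'I_d) : pred 'I_M.+1 := fun x => (x < (r * B ^ j.+1).+1)%N.
  apply: leq_trans (_ : #|family Fm| <= _)%N.
    apply/subset_leq_card/subsetP => n /imsetP[v _ ->]; apply/familyP => j.
    by rewrite -topredE /= /Fm keyE ltnS Ple.
  rewrite card_family foldrE big_map big_enum /=; apply: leq_prod => j _.
  have le : ((r * B ^ j.+1).+1 <= M.+1)%N by rewrite ltnS leq_mul2l leq_pexp2l ?orbT.
  by rewrite -sum1_card (big_ord_narrow le) sum1_card card_ord.
rewrite mulnC exprM -normrX E E2.
apply: le_trans (_ : (\sum_(n | A n) `|g n|) ^+ 2 <= _).
  rewrite lerXn2r ?nnegrE ?normr_ge0 ?sumr_ge0 //.
  apply: le_trans (ler_norm_sum _ _ _) _; apply: ler_sum => n _.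
  by rewrite normrM psi1 mulr1.
apply: le_trans (power_mean A 1 (fun n => normr_ge0 (g n))) _.
rewrite expr1; apply: ler_pM; rewrite ?ler0n ?ler_nat //.
  by apply: sumr_ge0 => n _; apply: exprn_ge0.
(* Opening the squares pairs v with the w having the same power sums, that is, it runs over the
   solutions (v, w) of the system. *)
have -> : vsum d r c = \sum_n `|g n| ^+ 2.
  under eq_bigr do rewrite normCK /g rmorph_sum big_distrlr /=.
  rewrite (eq_bigr (fun n => \sum_v \sum_w (if (key v == n) && (key w == n) then cc v * (cc w)^* else 0))); last first.
    move=> n _; rewrite big_mkcond; apply: eq_bigr => v _.
    by case: ifP => _; [rewrite big_mkcond | rewrite big1].
  rewrite exchange_big /=; under eq_bigr do rewrite exchange_big /=.
  transitivity (\sum_v \sum_w (if key v == key w then cc v * (cc w)^* else 0)); last first.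
    apply: eq_bigr => v _; apply: eq_bigr => w _.
    rewrite (bigD1 (key v)) //= eqxx [X in _ + X]big1 ?addr0; last first.
      by move=> n; rewrite eq_sym => /negPf->.
    by rewrite [key w == _]eq_sym.
  rewrite /vsum big_mkcond pair_big.
  pose mk (vw : {ffun 'I_r -> 'I_B} * {ffun 'I_r -> 'I_B}) : {ffun bool * 'I_r -> 'I_B} :=
    [ffun i => if i.1 then vw.2 i.2 else vw.1 i.2].
  rewrite (reindex mk) /=; last first.
    exists (fun V => ([ffun i => V (false, i)], [ffun i => V (true, i)])) => [[v w] _|V _].
      by congr (_, _); apply/ffunP => i; rewrite !ffunE.
    by apply/ffunP => -[[] i]; rewrite !ffunE.
  apply: eq_bigr => -[v w] _ /=.
  have -> : vsol d (mk (v, w)) = (key v == key w).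
    apply/forallP/eqP => [H|kvw j].
      apply/ffunP => j; apply: val_inj; rewrite /= !keyE; have /eqP := H j.
      by rewrite /P; under eq_bigr do rewrite ffunE /=; under [in RHS]eq_bigr do rewrite ffunE /=.
    rewrite (eq_bigr (fun i => (v i).+1 ^ j.+1)%N) => [|i _]; last by rewrite ffunE.
    rewrite [X in _ == X](eq_bigr (fun i => (w i).+1 ^ j.+1)%N) => [|i _]; last by rewrite ffunE.
    by rewrite -/(P v j.+1) -/(P w j.+1) -!keyE kvw.
  case: ifP => // _.
  transitivity (\prod_b \prod_(i < r) cj b (c (mk (v, w) (b, i)))).
    by rewrite pair_big; apply: eq_bigr => -[b i].
  rewrite big_bool /= mulrC /cc rmorph_prod; congr (_ * _).
    by apply: eq_bigr => i _; rewrite ffunE.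
  by apply: eq_bigr => i _; rewrite ffunE.
rewrite [leRHS](bigID A) /= lerDl sumr_ge0 // => n _.
exact: exprn_ge0.
Qed.

End MeanValue.

Definition has_single (I : finType) (B : nat) (V : {ffun I -> 'I_B}) : bool :=
  [exists k, forall j, (j != k) ==> (V j != V k)].

(** If every value is repeated, the 2r variables take at most r values, so V factors through 'I_r:
    there are r^(2r) maps into 'I_r and B^r choices of values. *)
Lemma card_no_single r B :
  (#|[set V : {ffun bool * 'I_r -> 'I_B} | ~~ has_single V]| <= r ^ (2 * r) * B ^ r)%N.
Proof.
pose Phi (ug : {ffun 'I_r -> 'I_B} * {ffun bool * 'I_r -> 'I_r}) : {ffun bool * 'I_r -> 'I_B} :=
  [ffun i => ug.1 (ug.2 i)].
apply: leq_trans (_ : #|Phi @: setT| <= _)%N; last first.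
  apply: leq_trans (leq_imset_card _ _) _.
  by rewrite cardsT card_prod !card_ffun card_prod card_bool !card_ord mulnC.
apply/subset_leq_card/subsetP => V; rewrite inE => noV.
pose S := enum [set V x | x : bool * 'I_r].
have mate k : exists j, (j != k) && (V j == V k).
  move: noV => /existsPn/(_ k)/forallPn[j]; rewrite negb_imply negbK => jP.
  by exists j.
have sS : (size S <= r)%N.
  rewrite -cardE -(leq_pmul2l (isT : 0 < 2)%N).
  have -> : (2 * r)%N = #|{: bool * 'I_r}| by rewrite card_prod card_bool card_ord.
  rewrite -[X in (_ <= X)%N]sum1_card (partition_big_imset V) /=.
  rewrite mulnC -sum_nat_const big_mkcond [X in (_ <= X)%N]big_mkcond /=.
  apply: leq_sum => y _; case: ifP => // /imsetP[k _ ->].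
  have [j /andP[jk jV]] := mate k.
  rewrite sum1_card; apply/card_gt1P; exists j, k.
  by split; [exact: jV | exact: (eqxx (V k)) | exact: jk].
have Vi i : (index (V i) S < r)%N.
  by apply: leq_trans sS; rewrite index_mem mem_enum imset_f.
apply/imsetP; exists ([ffun j : 'I_r => nth (V (false, j)) S j], [ffun i => Ordinal (Vi i)]) => //.
apply/ffunP => i; rewrite !ffunE /= nth_index // mem_enum; exact: imset_f.
Qed.

(** A [vsum] is a sum of squared moduli; the sign is read off from [phase_sum_bound] at trivial
    phases. *)
Lemma vsum_ge0 (C : numClosedFieldType) d B r (c : 'I_B -> C) : (0 < B)%N -> 0 <= vsum d r c.
Proof.
move=> B0; have := phase_sum_bound d r c (u := fun=> 1) B0 (fun=> normr1 C).
move/(le_trans (exprn_ge0 _ (normr_ge0 _))); rewrite pmulr_rge0 //.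
by rewrite ltr0n; apply: prodn_gt0.
Qed.

Section MeanValue.
Variable C : numClosedFieldType.
Hypothesis arch : forall x : C, 0 <= x -> exists n : nat, x < n%:R.
Variables (ps : seq nat) (chip : nat -> nat -> C) (d B r r' s : nat).
Hypotheses (ups : uniq ps) (prs : all prime ps)
  (chipP : forall p, p \in ps -> nontrivial_char p (chip p))
  (sizeps : (size ps <= s)%N) (rE : (r = s.+1 + r')%N).

Let q := (\prod_(p <- ps) p)%N.
Local Notation chi := (prod_char ps chip).

(** The factors are (2r)^s from Weil's bound at up to s primes, 2r choices of the isolated variable,
    2^(2r) sets J, and 2^((s+1)s) from averaging the common divisors over J. *)
Definition mean_const : nat := ((2 * r) ^ s * ((2 * r) * 2 ^ (2 * r) * 2 ^ (s.+1 * s)))%N.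

Let shifted (x : nat) (b : 'I_B) : C := chi (x + b.+1)%N.

Let sumF (k : bool * 'I_r) (J : {set bool * 'I_r}) :
  k \notin J -> (#|J| <= size ps)%N ->
  (\sum_(V : {ffun bool * 'I_r -> 'I_B} | vsol d V && [forall j, (j != k) ==> (V j != V k)])
     \prod_(j in J) smooth_part ps (dist (V j).+1 (V k).+1) <=
   2 ^ (s.+1 * s) * B ^ (2 * s.+1) * vcount d B r')%N.
Proof.
move=> kJ szJ.
(* The isolated variable is pinned at c, and those in J carry the common divisors with x = c
   excluded, because distance 0 would cost the full modulus. *)
pose F (c : 'I_B) i (x : 'I_B) : nat := if i == k then (x == c : nat) else
  if i \in J then (if x != c then smooth_part ps (dist x.+1 c.+1) else 0%N) else 1%N.
have szK : #|k |: J| = #|J|.+1 by rewrite cardsU1 kJ.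
have leJ : (#|J| <= s)%N by apply: leq_trans sizeps.
have rr' : (r - r' = s.+1)%N by rewrite rE addnK.
have Fc c : (\sum_(V : {ffun bool * 'I_r -> 'I_B} | vsol d V) \prod_i F c i (V i) <=
    (2 ^ s.+1 * B) ^ #|J| * B ^ (2 * s.+1 - #|J|.+1) * vcount d B r')%N.
  apply: leq_trans (@weighted_count d B C r r' (k |: J) (F c) _ _ _) _.
  - by rewrite rE leq_addl.
  - by rewrite szK rr'; lia.
  - by move=> i; rewrite !inE /F => /norP[/negPf-> /negPf->].
  rewrite szK rr' !leq_mul // big_setU1 //= /F eqxx -[X in (_ <= X)%N]mul1n.
  apply: leq_mul.
    by rewrite (bigD1 c) //= eqxx big1 ?addn0 // => x /negPf->.
  rewrite -prod_nat_const; apply: leq_prod => j jJ.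
  have -> : (j == k) = false by apply: contraNF kJ => /eqP <-.
  rewrite jJ -big_mkcond; apply: leq_trans (sum_smooth_dist c ups prs) _.
  by rewrite leq_mul2r leq_pexp2l ?orbT.
apply: leq_trans (_ : \sum_(c < B) \sum_(V : {ffun bool * 'I_r -> 'I_B} | vsol d V) \prod_i F c i (V i) <= _)%N.
  rewrite exchange_big /= big_mkcondr; apply: leq_sum => V _; case: ifP => // /forallP single.
  rewrite (bigD1 (V k)) //=; apply: leq_trans (leq_addr _ _).
  rewrite [leqRHS](bigD1 k) //= /F !eqxx mul1n big_mkcond /=.
  rewrite (bigD1 k) //= (negPf kJ) mul1n.
  apply: leq_prod => j jk; rewrite (negPf jk); case: ifP => // _.
  by have := single j; rewrite jk => /= ->.
apply: leq_trans (leq_sum _ (fun c _ => Fc c)) _.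
rewrite sum_nat_const card_ord mulnA leq_mul2r; apply/orP; right.
rewrite expnMn -!mulnA mulnCA leq_mul //.
  by rewrite -expnM leq_pexp2l // leq_mul2l leJ orbT.
rewrite -expnD -expnS; apply: eq_leq; congr (_ ^ _)%N; lia.
Qed.

Lemma mean_value : (0 < B)%N ->
  \sum_(x < q) vsum d r (shifted x) <=
  (q * (r ^ (2 * r) * B ^ r))%N%:R +
  sqrtC q%:R * (mean_const * (B ^ (2 * s.+1) * vcount d B r'))%N%:R.
Proof.
move=> B0; pose I := (bool * 'I_r)%type.
pose T (V : {ffun I -> 'I_B}) : C := \sum_(x < q) \prod_i cj i.1 (chi (x + (V i).+1)%N).
rewrite -[leLHS]ger0_norm; last by apply: sumr_ge0 => x _; apply: vsum_ge0.
have -> : \sum_(x < q) vsum d r (shifted x) = \sum_(V | vsol d V) T V.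
  by rewrite exchange_big.
apply: le_trans (ler_norm_sum _ _ _) _.
rewrite (bigID (fun V => has_single V)) /= addrC; apply: lerD.
  apply: le_trans (_ : \sum_(V : {ffun I -> 'I_B} | ~~ has_single V) q%:R <= _).
    rewrite big_mkcond [leRHS]big_mkcond; apply: ler_sum => V _.
    case: (has_single V); rewrite ?andbF // andbT; case: (vsol d V); rewrite ?ler0n //=.
    apply: le_trans (ler_norm_sum _ _ _) _.
    rewrite -[X in _ <= X%:R]card_ord -sumr_const; apply: ler_sum => x _.
    rewrite normr_prod; apply: prodr_ile1 => i _; rewrite normr_ge0 norm_cj.
    exact: prod_char_norm_le1.
  rewrite sumr_const -mulrnA ler_nat leq_mul2l.
  apply/orP; right; apply: leq_trans (card_no_single r B).
  by apply/subset_leq_card/subsetP => V; rewrite inE.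
have cI : #|{: I}| = (2 * r)%N by rewrite card_prod card_bool card_ord.
pose W k (V : {ffun I -> 'I_B}) (J : {set I}) := (\prod_(j in J) smooth_part ps (dist (V j).+1 (V k).+1))%N.
pose single k (V : {ffun I -> 'I_B}) := [forall j, (j != k) ==> (V j != V k)].
pose okJ k (J : {set I}) := (k \notin J) && (#|J| <= size ps)%N.
(* The set J depends on V, so the bound sums over all admissible J; the isolated index k is summed
   below for the same reason. *)
have TV V k : `|T V| <= (2 * r)%:R ^+ s * sqrtC q%:R * (\sum_(J : {set I} | okJ k J) W k V J)%N%:R.
  apply: le_trans (complete_sum arch ups prs chipP _ _) _.
  apply: le_trans (prod_weight C prs (fun i => (V i).+1) k) _; rewrite cI.
  have [J [kJ szJ leJ]] := bad_prod (fun i => (V i).+1) k prs.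
  have s0 : 0 <= sqrtC q%:R :> C by rewrite sqrtC_ge0 ler0n.
  have r0 : 1 <= (2 * r)%:R :> C by rewrite ler1n muln_gt0 rE.
  apply: ler_pM; rewrite ?mulr_ge0 ?exprn_ge0 ?ler0n //.
    by rewrite ler_wpM2r // ler_weXn2l.
  rewrite ler_nat; apply: leq_trans leJ _.
  by rewrite (bigD1 J) /= ?leq_addr // /okJ kJ szJ.
apply: le_trans (_ : \sum_(k : I) \sum_(V | vsol d V && single k V)
   (2 * r)%:R ^+ s * sqrtC q%:R * (\sum_(J : {set I} | okJ k J) W k V J)%N%:R <= _).
  rewrite (exchange_big_dep (fun V => vsol d V)) /=; last by move=> k V _ /andP[].
  rewrite big_mkcondr /=; apply: ler_sum => V vV.
  have ge0 k : 0 <= (2 * r)%:R ^+ s * sqrtC q%:R * (\sum_(J : {set I} | okJ k J) W k V J)%N%:R :> C.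
    by rewrite !mulr_ge0 ?exprn_ge0 ?ler0n ?sqrtC_ge0 ?ler0n.
  case: ifP => [/existsP[k sk]|_]; last by apply: sumr_ge0.
  rewrite [leRHS](bigD1 k) /=; last by rewrite vV.
  apply: le_trans (TV V k) _.
  by rewrite lerDl sumr_ge0.
under eq_bigr do rewrite -mulr_sumr -natr_sum.
rewrite -mulr_sumr -natr_sum -natrX mulrAC mulrC ler_wpM2l ?sqrtC_ge0 ?ler0n //.
rewrite -natrM ler_nat /mean_const -!mulnA leq_mul2l; apply/orP; right.
apply: leq_trans (_ : \sum_(k : I) \sum_(J : {set I}) 2 ^ (s.+1 * s) * B ^ (2 * s.+1) * vcount d B r' <= _)%N.
  apply: leq_sum => k _; rewrite exchange_big /= big_mkcond.
  apply: leq_sum => J _; case: ifP => // /andP[kJ szJ].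
  exact: sumF.
have cS : #|{: {set I}}| = (2 ^ (2 * r))%N.
  by rewrite -cardsT -powersetT card_powerset cardsT cI.
by rewrite !sum_nat_const cS cI !mulnA.
Qed.

End MeanValue.

(** * Burgess' amplification *)

Definition coprime_count (ps : seq nat) (A : nat) : nat :=
  (\sum_(1 <= a < A.+1) all (fun p => ~~ (p %| a)) ps)%N.

(** Legendre's sieve: sieving by one more prime subtracts the same count up to A/p, which doubles
    the error and adds at most 1 for the rounding. *)
Lemma coprime_count_approx ps A : uniq ps -> all prime ps ->
  `|(coprime_count ps A)%:R - A%:R * \prod_(p <- ps) (1 - p%:R^-1)| <= 2 ^+ size ps - 1 :> rat.
Proof.
elim: ps A => [|p ps IH] A.
  move=> _ _; rewrite /coprime_count big_nil mulr1 /= sum_nat_const_nat muln1 subn1 /= subrr normr0.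
  by rewrite expr0 subrr.
move=> /= /andP[pps ups] /andP[p_pr prs]; have p0 := prime_gt0 p_pr.
have E : coprime_count ps A = (coprime_count (p :: ps) A + coprime_count ps (A %/ p))%N.
  rewrite /coprime_count.
  have ph h : all (fun p0 => ~~ (p0 %| h)%N) ps = all (fun p0 => ~~ (p0 %| p * h)%N) ps.
    apply: eq_in_all => p' p'ps; have p'_pr : prime p' by apply: (allP prs).
    rewrite Gauss_dvdr // prime_coprime // dvdn_prime2 //.
    by apply: contraNneq pps => <-.
  rewrite [X in (_ = _ + X)%N](eq_bigr (fun h => nat_of_bool (all (fun p0 => ~~ (p0 %| p * h)%N) ps))); last first.
    by move=> h _; rewrite -ph.
  rewrite -(big_multiples _ A (fun h => nat_of_bool (all (fun p0 => ~~ (p0 %| h)%N) ps))) //.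
  rewrite [X in (_ = _ + X)%N]big_mkcond -big_split; apply: eq_bigr => a _ /=.
  by case: (p %| a)%N => //=; rewrite ?addn0.
have -> : (coprime_count (p :: ps) A)%:R = (coprime_count ps A)%:R - (coprime_count ps (A %/ p))%:R :> rat.
  by rewrite E natrD addrK.
rewrite big_cons; set f := \prod_(_ <- ps) _ in IH *.
have f01 : 0 <= f <= 1.
  rewrite /f big_seq; apply/andP; split; [apply: prodr_ge0 | apply: prodr_ile1] => p' /(allP prs)/prime_gt0 p'0.
    by rewrite subr_ge0 invf_le1 ?ltr0n // ler1n.
  by rewrite subr_ge0 invf_le1 ?ltr0n // ler1n p'0 lerBlDr lerDl invr_ge0 ler0n.
have pn0 : p%:R != 0 :> rat by rewrite pnatr_eq0 -lt0n.
have split : A%:R = (A %/ p)%:R * p%:R + (A %% p)%:R :> rat by rewrite -natrM -natrD -divn_eq.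
set c1 := (coprime_count ps A)%:R; set c2 := (coprime_count ps (A %/ p))%:R.
have -> : c1 - c2 - A%:R * ((1 - p%:R^-1) * f) =
  (c1 - A%:R * f) - (c2 - (A %/ p)%:R * f) + (A %% p)%:R / p%:R * f.
  by rewrite split; field.
have IH1 := IH A ups prs; have IH2 := IH (A %/ p)%N ups prs.
apply: le_trans (ler_normD _ _) _.
have -> : 2 ^+ (size ps).+1 - 1 = (2 ^+ size ps - 1) + (2 ^+ size ps - 1) + 1 :> rat.
  by rewrite exprS; ring.
apply: lerD; first by apply: le_trans (ler_normB _ _) (lerD IH1 IH2).
case/andP: f01 => f0 f1.
rewrite ger0_norm; last by rewrite !mulr_ge0 ?invr_ge0 ?ler0n.
rewrite mulr_ile1 ?mulr_ge0 ?invr_ge0 ?ler0n // ler_pdivrMr ?ltr0n // mul1r ler_nat.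
exact/ltnW/ltn_pmod.
Qed.

(** Each factor 1 - 1/p is at least 1/2. For A >= 2 * 4^s at least A / 2^(s+1) of the multipliers a
    survive when at most s primes are sieved. *)
Lemma coprime_count_lb ps A : uniq ps -> all prime ps ->
  (A <= 2 ^ size ps * (coprime_count ps A + 2 ^ size ps))%N.
Proof.
move=> ups prs; have := coprime_count_approx A ups prs; rewrite ler_distl => /andP[lb _].
have f2 : 2^-1 ^+ size ps <= \prod_(p <- ps) (1 - p%:R^-1) :> rat.
  elim: (ps) prs => [|p l IH] /=; first by rewrite big_nil.
  move=> /andP[p_pr lprs]; rewrite big_cons exprS; apply: ler_pM; rewrite ?exprn_ge0 ?invr_ge0 ?ler0n ?IH //.
  rewrite lerBrDr -lerBrDl (_ : 1 - 2^-1 = 2^-1 :> rat) //.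
  by rewrite lef_pV2 ?posrE ?ltr0n ?prime_gt0 // ler_nat prime_gt1.
rewrite -(ler_nat rat) natrM natrD natrX -ler_pdivrMl ?exprn_gt0 //.
move: lb; rewrite lerBlDr => lb; apply: le_trans (le_trans lb _); last first.
  by rewrite lerD2l lerBlDr lerDl.
by rewrite mulrC ler_wpM2l ?ler0n // -exprVn.
Qed.

(** * Coincidences among quotients modulo q *)

Section CongruencePairs.
Variables (q A N M : nat).
Hypotheses (q0 : (0 < q)%N) (ANq : (A * N <= q)%N).

(** The form a1 k2 - a2 k1 is determined modulo q and ranges over fewer than 2q integers, so it
    takes at most two values. For a fixed value, k1 is determined modulo b1 = a1 / gcd(a1, a2), and
    k1 determines k2. *)
Lemma congruence_fibre (a1 a2 : nat) : (0 < a1 <= A)%N -> (0 < a2 <= A)%N ->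
  (#|[set k : 'I_N * 'I_N | a1 * (M + k.2) == a2 * (M + k.1) %[mod q]]|
   <= 2 * (N %/ (a1 %/ gcdn a1 a2)).+1)%N.
Proof.
move=> /andP[a10 a1A] /andP[a20 a2A]; set g := gcdn a1 a2.
have g0 : (0 < g)%N by rewrite gcdn_gt0 a10.
pose b1 := (a1 %/ g)%N; pose b2 := (a2 %/ g)%N.
have a1E : a1 = (b1 * g)%N by rewrite divnK // dvdn_gcdl.
have a2E : a2 = (b2 * g)%N by rewrite divnK // dvdn_gcdr.
have b10 : (0 < b1)%N by move: a10; rewrite a1E muln_gt0 => /andP[].
have co : coprime b1 b2.
  by rewrite /coprime -(eqn_pmul2r g0) mul1n muln_gcdl -a1E -a2E.
(* The form a1 k2 - a2 k1, translated by a2 N to stay in the naturals. *)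
pose u (k : 'I_N * 'I_N) := (a1 * k.2 + a2 * (N - k.1))%N.
have ult k : (u k < 2 * q)%N.
  apply: leq_trans (_ : 2 * (A * N) <= _)%N; last by rewrite leq_mul2l.
  rewrite mul2n -addnn /u -addSn leq_add //.
    by rewrite -ltnS ltnS; apply: leq_trans (_ : a1 * N <= _)%N; rewrite ?ltn_pmul2l ?leq_mul2r ?a1A ?orbT.
  by rewrite leq_mul ?leq_subr.
pose h (k : 'I_N * 'I_N) : 'I_2 * 'I_(N %/ b1).+1 := (inord (u k %/ q), inord (k.1 %/ b1)).
have -> : (2 * (N %/ b1).+1)%N = #|{: 'I_2 * 'I_(N %/ b1).+1}|.
  by rewrite card_prod !card_ord.
rewrite -(card_in_imset (f := h)); first exact: max_card.
move=> [k1 k2] [l1 l2]; rewrite !inE /= => /eqP Ek /eqP El [] /(congr1 (@nat_of_ord _)) + /(congr1 (@nat_of_ord _)).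
have lt2 k : (u k %/ q < 2)%N by rewrite ltn_divLR // ult.
have ltb (k : 'I_N) : (k %/ b1 < (N %/ b1).+1)%N by rewrite ltnS leq_div2r // ltnW.
rewrite !inordK // => Eu Eb.
have um (k1' k2' : 'I_N) : a1 * (M + k2') = a2 * (M + k1') %[mod q] ->
   (u (k1', k2') + a1 * M = a2 * (M + N) %[mod q])%N.
  move=> E; rewrite /u /=.
  have -> : (a1 * k2' + a2 * (N - k1') + a1 * M = a1 * (M + k2') + a2 * (N - k1'))%N.
    by rewrite mulnDr; lia.
  by rewrite -modnDml E modnDml -mulnDr -addnA subnKC // ltnW.
have uE : u (k1, k2) = u (l1, l2).
  rewrite (divn_eq (u (k1, k2)) q) (divn_eq (u (l1, l2)) q) Eu; congr (_ + _)%N.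
  by apply/eqP; rewrite -(eqn_modDr (a1 * M)); apply/eqP; rewrite !um.
have key : (b1 * k2 + b2 * l1 = b1 * l2 + b2 * k1)%N.
  apply/eqP; rewrite -(eqn_pmul2r g0) !mulnDl ![(b1 * _ * g)%N]mulnAC ![(b2 * _ * g)%N]mulnAC -a1E -a2E.
  have := ltn_ord k1; have := ltn_ord l1; move: uE; rewrite /u /= !mulnBr.
  have : (a2 * k1 <= a2 * N)%N by rewrite leq_mul2l ltnW ?orbT.
  have : (a2 * l1 <= a2 * N)%N by rewrite leq_mul2l ltnW ?orbT.
  by move: (a1 * k2)%N (a1 * l2)%N (a2 * N)%N (a2 * k1)%N (a2 * l1)%N; clear; lia.
have E1 : k1 = l1 :> nat.
  have kl : k1 == l1 %[mod b1].
    rewrite dist_eqmod -(Gauss_dvdr _ co) (_ : b2 * dist k1 l1 = dist (b2 * k1) (b2 * l1))%N; last first.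
      by rewrite /dist mulnDr !mulnBr.
    rewrite -dist_eqmod; have := congr1 (modn^~ b1) key.
    by rewrite /= ![(b1 * _)%N]mulnC !modnMDl => ->.
  by rewrite (divn_eq k1 b1) (divn_eq l1 b1) Eb (eqP kl).
have E2 : k2 = l2 :> nat.
  by apply/eqP; move: key; rewrite E1 => /addIn/eqP; rewrite eqn_pmul2l.
by congr (_, _); apply: val_inj.
Qed.

End CongruencePairs.

Section Harmonic.
Variable K : numFieldType.

Definition harmonic A : K := \sum_(1 <= h < A.+1) h%:R^-1.

Lemma harmonic_mono A A' : (A <= A')%N -> harmonic A <= harmonic A'.
Proof.
move=> le; rewrite /harmonic [leRHS](@big_cat_nat _ _ _ A.+1) //= lerDl.
by apply: sumr_ge0 => h _; rewrite invr_ge0 ler0n.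
Qed.

(** The term at gcd(a, b) is dominated by the sum over all common divisors g. For given g there are
    at most A/g values of b, and the inverses of a/g sum to at most [harmonic A]. *)
Lemma sum_gcd_le A :
  \sum_(1 <= a < A.+1) \sum_(1 <= b < A.+1) (a %/ gcdn a b)%N%:R^-1 <=
    A%:R * harmonic A ^+ 2.
Proof.
apply: le_trans (_ : \sum_(1 <= a < A.+1) \sum_(1 <= b < A.+1) \sum_(1 <= g < A.+1 | (g %| a)%N && (g %| b)%N)
    (a %/ g)%N%:R^-1 <= _).
  rewrite big_nat [leRHS]big_nat; apply: ler_sum => a /andP[a0 aA].
  rewrite big_nat [leRHS]big_nat; apply: ler_sum => b /andP[b0 bA].
  rewrite big_mkcond (bigD1_seq (gcdn a b)) ?iota_uniq //=; last first.
    rewrite mem_index_iota gcdn_gt0 a0 /=; apply: leq_ltn_trans aA.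
    by rewrite dvdn_leq // dvdn_gcdl.
  rewrite dvdn_gcdl dvdn_gcdr /= lerDl; apply: sumr_ge0 => g _.
  by case: ifP => // _; rewrite invr_ge0 ler0n.
under eq_bigr do under eq_bigr do rewrite big_mkcond /=.
under eq_bigr do rewrite exchange_big /=.
rewrite exchange_big /=.
have -> : A%:R * harmonic A ^+ 2 = \sum_(1 <= g < A.+1) harmonic A * (A%:R * g%:R^-1).
  by rewrite -!mulr_sumr -/(harmonic A) expr2 mulrCA.
rewrite big_nat [leRHS]big_nat; apply: ler_sum => g /andP[g0 gA].
have -> : \sum_(1 <= a < A.+1) \sum_(1 <= b < A.+1)
    (if (g %| a)%N && (g %| b)%N then (a %/ g)%N%:R^-1 else 0) =
   (\sum_(1 <= a < A.+1 | (g %| a)%N) (a %/ g)%N%:R^-1) * (A %/ g)%N%:R :> K.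
  rewrite mulr_suml [RHS]big_mkcond; apply: eq_bigr => a _.
  case: (g %| a)%N => /=; last by rewrite big1.
  rewrite -big_mkcond big_multiples // big_const_nat subn1 iter_addr_0 /=.
  by rewrite mulr_natr.
rewrite big_multiples //; apply: ler_pM; rewrite ?ler0n //.
- by apply: sumr_ge0 => h _; rewrite invr_ge0 ler0n.
2: by rewrite ler_pdivlMr ?ltr0n // -natrM ler_nat leq_divM.
apply: le_trans (_ : harmonic (A %/ g) <= _); last by apply: harmonic_mono; rewrite leq_div.
by rewrite /harmonic; under eq_bigr do rewrite mulKn //.
Qed.
End Harmonic.

(** Binomial expansion: the substitution b -> t + a b keeps the degree, and of the phases only
    unimodularity is retained. *)
Lemma poly_phase_affine (C : numClosedFieldType) d (u : nat -> C) (t a : nat) :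
  (forall j, `|u j| = 1) -> exists u', (forall j, `|u' j| = 1) /\
    forall b, poly_phase d u (t + a * b)%N = poly_phase d u' b.
Proof.
move=> u1; exists (fun i => \prod_(j < d.+1) u j ^+ ('C(j, i) * (t ^ (j - i) * a ^ i))%N); split.
  by move=> i; rewrite normr_prod big1 // => j _; rewrite normrX u1 expr1n.
move=> b; rewrite /poly_phase.
under [RHS]eq_bigr do rewrite -prodrXl.
rewrite [RHS]exchange_big /=; apply: eq_bigr => j _.
rewrite expnDn expr_sum (big_ord_widen d.+1 (fun i => u j ^+ ('C(j, i) * (t ^ (j - i) * (a * b) ^ i)))) //.
rewrite big_mkcond; apply: eq_bigr => i _.
case: ltnP => [_ | lt]; last by rewrite bin_small // mul0n expr0 expr1n.
by rewrite -exprM expnMn !mulnA.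
Qed.

Section BurgessStep.
Variable C : numClosedFieldType.
Hypothesis arch : forall x : C, 0 <= x -> exists n : nat, x < n%:R.
Variables (ps : seq nat) (chip : nat -> nat -> C) (d r r' s : nat).
Hypotheses (ups : uniq ps) (prs : all prime ps)
  (chipP : forall p, p \in ps -> nontrivial_char p (chip p))
  (sizeps : (size ps <= s)%N) (rE : (r = s.+1 + r')%N).

Let q := (\prod_(p <- ps) p)%N.
Local Notation chi := (prod_char ps chip).

Lemma prod_charM x y : chi (x * y)%N = chi x * chi y.
Proof.
rewrite /prod_char -big_split big_seq [RHS]big_seq; apply: eq_bigr => p pps.
by case: (chipP pps) => ->.
Qed.

Lemma prod_char_mod x y : x = y %[mod q] -> chi x = chi y.
Proof.
move=> xy; rewrite /prod_char big_seq [RHS]big_seq; apply: eq_bigr => p pps.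
have pq : (p %| q)%N by rewrite /q (big_rem _ pps) /= dvdn_mulr.
case: (chipP pps) => _ per _ _ _.
by rewrite -(periodic_mod per) -(modn_dvdm _ pq) xy (modn_dvdm _ pq) (periodic_mod per).
Qed.

Definition mixed_sum M N (u : nat -> C) : C :=
  \sum_(k < N) chi (M + k)%N * poly_phase d u k.

Let q0 : (0 < q)%N.
Proof. by rewrite /q big_seq; apply: prodn_cond_gt0 => i /(allP prs)/prime_gt0. Qed.

Lemma mod_inverse a y : all (fun p => ~~ (p %| a)%N) ps ->
  exists x : 'I_q, a * x == y %[mod q].
Proof.
move=> co; have : coprime a q.
  rewrite /q big_seq; elim/big_ind: _ => [|x z|p pps]; first exact: coprimen1.
    by rewrite coprimeMr => -> ->.
  by rewrite coprime_sym prime_coprime ?(allP prs) // (allP co).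
(* [coprimeP] wants a > 0; a = 0 is coprime to q only when q = 1. *)
have [->|a0] := posnP a.
  rewrite /coprime gcd0n => /eqP q1; exists (Ordinal q0).
  have m1 z : (z %% q = 0)%N by rewrite q1 modn1.
  by rewrite !m1.
move=> /(coprimeP _ a0)[[u1 u2] /= E].
exists (Ordinal (ltn_pmod (u1 * y) q0)); rewrite /= modnMmr mulnA [(a * u1)%N]mulnC.
have -> : (u1 * a = u2 * q + 1)%N by lia.
by rewrite mulnDl mul1n mulnAC modnMDl.
Qed.

Variables (A N B M : nat) (u : nat -> C).
Hypotheses (B0 : (0 < B)%N) (ANq : (A * N <= q)%N) (u1 : forall j, `|u j| = 1).

Let T := ('I_A * 'I_N)%type.
Let co (t : T) := all (fun p => ~~ (p %| t.1.+1)%N) ps.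
(** The residue n/a with a = t.1 + 1 and n = M + t.2; the default 0 is taken where the congruence
    has no solution. *)
Let xx (t : T) : 'I_q := odflt (Ordinal q0) [pick x : 'I_q | t.1.+1 * x == M + t.2 %[mod q]].
Let U (t : T) : C := \sum_(b < B) chi (M + t.2 + t.1.+1 * b.+1)%N * poly_phase d u (t.2 + t.1.+1 * b.+1)%N.
Let P := (\prod_(j < d) (r * B ^ j.+1).+1)%N.
Let W (x : nat) : C := vsum d r (fun b : 'I_B => chi (x + b.+1)%N).

Let xxP t : co t -> t.1.+1 * xx t == M + t.2 %[mod q].
Proof.
move=> /(mod_inverse (M + t.2))[x xP]; rewrite /xx; case: pickP => [? //|/(_ x)].
by rewrite xP.
Qed.

Let U_bound t : co t -> `|U t| ^+ (2 * r) <= P%:R * W (xx t).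
Proof.
move=> cot; have [u' [u'1 u'E]] := poly_phase_affine d t.2 t.1.+1 u1.
have -> : U t = chi t.1.+1 * \sum_(b < B) chi (xx t + b.+1)%N * poly_phase d u' b.+1.
  rewrite mulr_sumr; apply: eq_bigr => b _; rewrite mulrA -prod_charM u'E; congr (_ * _).
  by apply: prod_char_mod; rewrite mulnDr -modnDml -(eqP (xxP cot)) modnDml.
apply: le_trans (phase_sum_bound _ _ _ B0 u'1).
rewrite lerXn2r ?nnegrE ?normr_ge0 // normrM ler_piMl ?normr_ge0 //.
exact: prod_char_norm_le1.
Qed.

Let nu (x : 'I_q) : nat := #|[pred t | co t && (xx t == x)]|.

(** Opening the square counts pairs with equal quotients, and cross-multiplication removes the
    inverses. *)
Let nu2 : (\sum_x nu x ^ 2 <= \sum_(a1 < A) \sum_(a2 < A)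
   #|[set k : 'I_N * 'I_N | a1.+1 * (M + k.2) == a2.+1 * (M + k.1) %[mod q]]|)%N.
Proof.
pose R (t1 t2 : T) := t1.1.+1 * (M + t2.2) == t2.1.+1 * (M + t1.2) %[mod q].
apply: leq_trans (_ : \sum_(t1 : T) \sum_(t2 : T) R t1 t2 <= _)%N.
  apply: leq_trans (_ : \sum_(t1 : T) \sum_(t2 : T) (co t1 && co t2 && (xx t1 == xx t2)) <= _)%N.
    apply: eq_leq; under eq_bigr => x _.
      rewrite -mulnn /nu -sum1_card big_distrlr /= big_mkcond /=.
      under eq_bigr => t1 _ do rewrite big_mkcond /=.
      over.
    rewrite exchange_big; apply: eq_bigr => t1 _ /=.
    have [c1|c1] := boolP (co t1); last first.
      by rewrite [RHS]big1 // big1 // => x _; rewrite inE (negPf c1).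
    under eq_bigr do rewrite inE c1 /=.
    rewrite (bigD1 (xx t1)) //= eqxx [X in (_ + X)%N]big1 ?addn0; last first.
      by move=> x; rewrite eq_sym => /negPf->.
    by apply: eq_bigr => t2 _; rewrite inE [xx t2 == _]eq_sym; case: (_ && _).
  apply: leq_sum => t1 _; apply: leq_sum => t2 _.
  case: (boolP (_ && _ && _)) => // /andP[/andP[c1 c2] /eqP xE].
  rewrite /R -modnMmr -(eqP (xxP c2)) modnMmr mulnCA -xE.
  by rewrite -modnMmr (eqP (xxP c1)) modnMmr eqxx.
apply: eq_leq; rewrite -(pair_big xpredT xpredT (fun a1 k1 => \sum_(t2 : T) R (a1, k1) t2)%N) /=.
apply: eq_bigr => a1 _.
under eq_bigr => k1 _.
  rewrite -(pair_big xpredT xpredT (fun a2 k2 => nat_of_bool (R (a1, k1) (a2, k2)))) /=.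
  over.
rewrite exchange_big /=; apply: eq_bigr => a2 _.
rewrite pair_big /= -sum1_card [RHS]big_mkcond; apply: eq_bigr => -[k1 k2] _ /=.
by rewrite inE /R /=; case: (_ == _).
Qed.

Let nu2_bound : (\sum_x nu x ^ 2)%N%:R <=
  (2 * A ^ 2)%N%:R + (2 * (N * A))%N%:R * harmonic C A ^+ 2.
Proof.
apply: le_trans (_ : (\sum_(a1 < A) \sum_(a2 < A) 2 * (N %/ (a1.+1 %/ gcdn a1.+1 a2.+1)).+1)%N%:R <= _).
  rewrite ler_nat; apply: leq_trans nu2 _; apply: leq_sum => a1 _; apply: leq_sum => a2 _.
  by apply: (congruence_fibre M q0 ANq); rewrite /= ltn_ord.
apply: le_trans (_ : \sum_(a1 < A) \sum_(a2 < A) (2%:R + (2 * N)%N%:R * (a1.+1 %/ gcdn a1.+1 a2.+1)%N%:R^-1) <= _).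
  rewrite natr_sum; apply: ler_sum => a1 _; rewrite natr_sum; apply: ler_sum => a2 _.
  rewrite mulnS natrD lerD2l natrM natrM -mulrA ler_wpM2l ?ler0n //.
  rewrite ler_pdivlMr; last first.
    by rewrite ltr0n divn_gt0 ?gcdn_gt0 // dvdn_leq // dvdn_gcdl.
  by rewrite -natrM ler_nat leq_divM.
under eq_bigr do rewrite big_split /=.
rewrite big_split /= lerD //.
  by rewrite !sumr_const card_ord -!mulrnA mulnn mulnC natrM mulr_natr -mulrnA mulnC.
under eq_bigr do rewrite -mulr_sumr.
rewrite -mulr_sumr mulnA [(2 * N * A)%N%:R]natrM -mulrA ler_wpM2l ?ler0n //.
apply: le_trans (sum_gcd_le C A); rewrite big_add1 big_mkord; apply: ler_sum => a1 _.
by rewrite big_add1 big_mkord.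
Qed.

Let MV : C := (q * (r ^ (2 * r) * B ^ r))%N%:R +
  sqrtC q%:R * (mean_const r s * (B ^ (2 * s.+1) * vcount d B r'))%N%:R.

Let r0 : (0 < r)%N. Proof. by rewrite rE. Qed.

(** Grouping the pairs by x = n/a, Cauchy-Schwarz separates the second moment of the multiplicities
    from the complete moment over x. *)
Let Z_bound : (\sum_(t | co t) `|U t| ^+ r) ^+ 2 <=
  ((2 * A ^ 2)%N%:R + (2 * (N * A))%N%:R * harmonic C A ^+ 2) * (P%:R * MV).
Proof.
have W0 x : 0 <= W x by apply: vsum_ge0.
have PW0 x : 0 <= P%:R * W x by rewrite mulr_ge0 ?ler0n.
apply: le_trans (_ : (\sum_(x : 'I_q) (nu x)%:R * sqrtC (P%:R * W x)) ^+ 2 <= _).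
  rewrite lerXn2r ?nnegrE ?sumr_ge0 //.
  - by move=> t _; rewrite exprn_ge0.
  - by move=> x _; rewrite mulr_ge0 ?ler0n ?sqrtC_ge0.
  rewrite (partition_big xx xpredT) //=; apply: ler_sum => x _.
  apply: le_trans (_ : \sum_(t | co t && (xx t == x)) sqrtC (P%:R * W x) <= _).
    apply: ler_sum => t /andP[cot /eqP <-].
    rewrite -(@ler_pXn2r _ 2) ?nnegrE ?sqrtC_ge0 ?exprn_ge0 //.
    by rewrite sqrtCK -exprM mulnC U_bound.
  rewrite sumr_const [leRHS]mulr_natl; exact: lexx.
apply: le_trans (cauchy_schwarz xpredT _ _) _ => [x|x|].
- exact: ler0n.
- by rewrite sqrtC_ge0.
apply: ler_pM.
- by apply: sumr_ge0 => x _; rewrite exprn_ge0 ?ler0n.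
- by apply: sumr_ge0 => x _; rewrite exprn_ge0 ?sqrtC_ge0.
- by rewrite (eq_bigr (fun x => (nu x ^ 2)%N%:R)) -?natr_sum // => x _; rewrite natrX.
under eq_bigr do rewrite sqrtCK.
rewrite -mulr_sumr ler_wpM2l ?ler0n //.
exact: (mean_value arch d ups prs chipP sizeps rE B0).
Qed.

Let card_co : #|co| = (coprime_count ps A * N)%N.
Proof.
rewrite -sum1_card big_mkcond (eq_bigr (fun t => nat_of_bool (co t))); last first.
  by move=> t _; rewrite -[t \in co]/(co t); case: (co t).
rewrite -(pair_big xpredT xpredT (fun a k => nat_of_bool (co (a, k)))) /=.
rewrite /coprime_count big_add1 big_mkord big_distrl; apply: eq_bigr => a _ /=.
by rewrite /co /= sum_nat_const card_ord mulnC.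
Qed.

(** Y bounds the average over the shifts and 2E the two end segments. The numerical hypothesis says
    that the moment estimate, after the power mean with exponent r and a squaring, stays below the
    2r-th power of Y times the number of shifts; it is settled by the choice of lengths. *)
Lemma burgess_step (Y E : C) : 0 <= Y -> (0 < coprime_count ps A)%N ->
  (forall h M' u', (h <= A * B)%N -> (forall j, `|u' j| = 1) -> `|mixed_sum M' h u'| <= E) ->
  (A * N)%:R ^+ (2 * r.-1) *
   (((2 * A ^ 2)%N%:R + (2 * (N * A))%N%:R * harmonic C A ^+ 2) * (P%:R * MV)) <=
  (Y * (coprime_count ps A * B)%N%:R) ^+ (2 * r) ->
  `|mixed_sum M N u| <= Y + E *+ 2.
Proof.
move=> Y0 c0 EP hyp; set c := coprime_count ps A in c0 hyp *.
have cA : (c <= A)%N.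
  rewrite /c /coprime_count big_add1 big_mkord -[X in (_ <= X)%N]card_ord -sum1_card.
  by apply: leq_sum => a _; case: all.
pose X := \sum_(t | co t) `|U t|.
have X0 : 0 <= X by apply: sumr_ge0.
have Xle : X <= Y * (c * B)%N%:R.
  rewrite -(@ler_pXn2r _ (2 * r)) ?muln_gt0 ?r0 ?nnegrE ?mulr_ge0 ?ler0n //.
  apply: le_trans hyp; rewrite mulnC exprM.
  apply: le_trans (_ : (#|co|%:R ^+ r.-1 * \sum_(t | co t) `|U t| ^+ r) ^+ 2 <= _).
    rewrite lerXn2r ?nnegrE ?mulr_ge0 ?exprn_ge0 ?ler0n ?sumr_ge0 // => [t _|].
      exact: exprn_ge0.
    rewrite -{1 3}(prednK r0); exact: (power_mean co r.-1 (fun t => normr_ge0 (U t))).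
  rewrite exprMn -exprM [(r.-1 * 2)%N]mulnC; apply: ler_pM; rewrite ?exprn_ge0 ?sumr_ge0 //.
  - by move=> t _; rewrite exprn_ge0.
  - by rewrite lerXn2r ?nnegrE ?ler0n // card_co ler_nat leq_mul2r cA orbT.
(* Shifting by h trades the first h terms for the h terms after the end; the latter are recentred at
   N to form a [mixed_sum] again. *)
have shift h : (h <= A * B)%N ->
  `|mixed_sum M N u - \sum_(k < N) chi (M + k + h)%N * poly_phase d u (k + h)%N| <= E *+ 2.
  move=> hAB; have [v [v1 vE]] := poly_phase_affine d N 1 u1.
  have -> : mixed_sum M N u - \sum_(k < N) chi (M + k + h)%N * poly_phase d u (k + h)%N =
    mixed_sum M h u - mixed_sum (M + N) h v.
    pose F k := chi (M + k)%N * poly_phase d u k.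
    have -> : mixed_sum (M + N) h v = \sum_(N <= k < N + h) F k.
      rewrite -{2}[N]add0n big_addn addKn big_mkord; apply: eq_bigr => k _.
      by rewrite /F -vE mul1n addnA addnAC [(k + N)%N]addnC.
    have -> : \sum_(k < N) chi (M + k + h)%N * poly_phase d u (k + h)%N = \sum_(h <= k < N + h) F k.
      rewrite -{3}[h]add0n big_addn addnK big_mkord; apply: eq_bigr => k _.
      by rewrite /F addnA.
    have E1 : \sum_(0 <= k < N + h) F k = mixed_sum M N u + \sum_(N <= k < N + h) F k.
      by rewrite (@big_cat_nat _ _ _ N) ?leq_addr //= big_mkord.
    have E2 : \sum_(0 <= k < N + h) F k = mixed_sum M h u + \sum_(h <= k < N + h) F k.
      by rewrite (@big_cat_nat _ _ _ h) ?leq_addl //= big_mkord.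
    by apply/eqP; rewrite subr_eq addrAC -E2 E1 addrK.
  by apply: le_trans (ler_normB _ _) _; rewrite mulr2n lerD ?EP.
have cB0 : 0 < (c * B)%N%:R :> C by rewrite ltr0n muln_gt0 c0.
rewrite -(ler_pM2r cB0).
pose D (a b : nat) := \sum_(k < N) chi (M + k + a * b)%N * poly_phase d u (k + a * b)%N.
pose coA (a : 'I_A) := all (fun p => ~~ (p %| a.+1)%N) ps.
have cE : \sum_(a < A | coA a) \sum_(b < B) 1 = (c * B)%N%:R :> C.
  under eq_bigr do rewrite sumr_const card_ord.
  rewrite sumr_const -mulrnA mulnC; congr (_ * _)%N%:R.
  rewrite /c /coprime_count big_add1 big_mkord -sum1_card big_mkcond; apply: eq_bigr => a _.
  by rewrite unfold_in /coA; case: all.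
have XE : `|\sum_(a < A | coA a) \sum_(b < B) D a.+1 b.+1| <= X.
  have -> : \sum_(a < A | coA a) \sum_(b < B) D a.+1 b.+1 = \sum_(t | co t) U t.
    rewrite (eq_bigl (fun t : T => coA t.1 && true)); last by move=> t; rewrite andbT.
    rewrite -(pair_big coA xpredT (fun a k => U (a, k))) /=; apply: eq_bigr => a _.
    by rewrite exchange_big.
  exact: ler_norm_sum.
have -> : `|mixed_sum M N u| * (c * B)%N%:R =
   `|\sum_(a < A | coA a) \sum_(b < B) D a.+1 b.+1 +
     \sum_(a < A | coA a) \sum_(b < B) (mixed_sum M N u - D a.+1 b.+1)|.
  rewrite -big_split /=; under [in RHS]eq_bigr do rewrite -big_split /=.
  under [in RHS]eq_bigr do under eq_bigr do rewrite addrC subrK.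
  by rewrite -[LHS](ger0_norm (mulr_ge0 (normr_ge0 _) (ltW cB0))) normrM normr_id normr_nat -normr_nat -normrM -cE mulr_sumr; under [in RHS]eq_bigr do rewrite -[mixed_sum M N u]mulr1 -mulr_sumr.
apply: le_trans (ler_normD _ _) _; rewrite mulrDl lerD ?(le_trans XE) //.
apply: le_trans (ler_norm_sum _ _ _) _; rewrite -cE mulr_sumr; apply: ler_sum => a _.
apply: le_trans (ler_norm_sum _ _ _) _; rewrite mulr_sumr; apply: ler_sum => b _.
by rewrite mulr1; apply: shift; rewrite leq_mul.
Qed.

End BurgessStep.

Local Notation R := Rdefinitions.R.
Local Notation Cx := (complex R).

(** * Complex characters as functions on residues *)

Definition toC (z : Coquelicot.Complex.C) : Cx := Complex z.1 z.2.

Lemma toC_mult x y : toC (Cmult x y) = toC x * toC y.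
Proof. by []. Qed.

Lemma toC_plus x y : toC (Cplus x y) = toC x + toC y.
Proof. by []. Qed.

Lemma toC_norm z : `|toC z| = (Cmod z)%:C%C.
Proof. by rewrite normc_def /Cmod RsqrtE !RpowE. Qed.

Lemma toC_inj : injective toC.
Proof. by case=> a b [c d] [-> ->]. Qed.

Lemma complex_arch (x : Cx) : 0 <= x -> exists n : nat, x < n%:R.
Proof.
move=> /ger0_real/RRe_real <-.
have [n] := INR_unbounded (complex.Re x).
move=> /RltP lt; exists n; rewrite -(rmorph_nat (real_complex R)) ltcR.
by rewrite -INRE.
Qed.

Lemma e_plus x y : toC (Defs.e (x + y)%R) = toC (Defs.e x) * toC (Defs.e y).
Proof.
rewrite /toC /Defs.e /= Rmult_plus_distr_l cos_plus sin_plus.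
by apply/eqP; rewrite eq_complex /=; apply/andP; split => //; rewrite [X in _ == X]addrC.
Qed.

Lemma e0 : toC (Defs.e 0%R) = 1.
Proof.
by rewrite /toC /Defs.e Rmult_0_r cos_0 sin_0.
Qed.

Lemma e_natmul x n : toC (Defs.e (x * n%:R)%R) = toC (Defs.e x) ^+ n.
Proof.
elim: n => [|n IH]; first by rewrite mulr0n mulr0 e0 expr0.
by rewrite -addn1 natrD mulrDr mulr1 e_plus IH exprD expr1.
Qed.

Lemma e_sum n (f : nat -> R) : toC (Defs.e (\sum_(i < n) f i)%R) = \prod_(i < n) toC (Defs.e (f i)).
Proof.
elim: n => [|n IH]; first by rewrite !big_ord0 e0.
by rewrite !big_ord_recr /= e_plus IH.
Qed.

Lemma e_norm x : `|toC (Defs.e x)| = 1.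
Proof.
rewrite toC_norm /Cmod /Defs.e /= !Rmult_1_r.
rewrite Rplus_comm (_ : Rplus _ _ = 1); first by rewrite sqrt_1.
exact: sin2_cos2.
Qed.

Lemma poly_phase_real (a : nat -> R) d (M : Z) :
  exists u : nat -> Cx, (forall j, `|u j| = 1) /\
   forall k : nat, toC (Defs.e (poly_eval a d (IZR (Z.add M (Z.of_nat k))))) = poly_phase d u k.
Proof.
exists (fun i => toC (Defs.e (\sum_(j < d.+1) a j * (IZR M ^+ (j - i) *+ 'C(j, i)))%R)); split.
  by move=> j; apply: e_norm.
move=> k; rewrite /poly_phase.
under [RHS]eq_bigr do rewrite -e_natmul mulr_suml.
rewrite -(e_sum _ (fun i : nat => \sum_(j < d.+1) a j * (IZR M ^+ (j - i) *+ 'C(j, i)) * (k ^ i)%N%:R)).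
rewrite exchange_big /= /poly_eval sum_f_R0E big_mkord; congr (toC (Defs.e _)).
apply: eq_bigr => j _.
rewrite RmultE RpowE plus_IZR RplusE -INR_IZR_INZ INRE exprDn mulr_sumr.
rewrite (big_ord_widen d.+1 (fun i => a j * (IZR M ^+ (j - i) * k%:R ^+ i *+ 'C(j, i)))) //.
rewrite big_mkcond; apply: eq_bigr => i _.
case: ltnP => [_ | lt]; last by rewrite bin_small // mulr0n mulr0 mul0r.
by rewrite natrX -mulrA mulrnAl.
Qed.

(** * Squarefree moduli and their primes, from Z to the naturals *)

Lemma Zdivide_dvdn a b : Z.divide (Z.of_nat a) (Z.of_nat b) <-> (a %| b)%N.
Proof.
split=> [[k E] | /dvdnP[k ->]]; last by exists (Z.of_nat k); rewrite Nat2Z.inj_mul.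
have [a0 | a0] := posnP a.
  by move: E; rewrite a0 Z.mul_0_r => /(Nat2Z.inj _ 0) ->.
apply/dvdnP; exists (Z.to_nat k); apply: Nat2Z.inj; rewrite Nat2Z.inj_mul Z2Nat.id //.
by nia.
Qed.

Lemma Zof_nat_modn x m : (0 < m)%N -> Z.of_nat (x %% m) = Z.modulo (Z.of_nat x) (Z.of_nat m).
Proof.
move=> m0; apply: (Z.mod_unique_pos _ _ (Z.of_nat (x %/ m))).
  by have := ltn_pmod x m0; move: (x %% m)%N => y; lia.
by rewrite {1}(divn_eq x m); move: (x %/ m)%N (x %% m)%N => a b; lia.
Qed.

Lemma Zgcd_gcdn a b : Z.gcd (Z.of_nat a) (Z.of_nat b) = Z.of_nat (gcdn a b).
Proof. by lia. Qed.

Lemma prime_Zprime p : prime p -> Znumtheory.prime (Z.of_nat p).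
Proof.
move=> p_pr; apply/prime_alt; split; first by have := prime_gt1 p_pr; lia.
move=> n [n1 np] nd.
have nE : Z.of_nat (Z.to_nat n) = n by apply: Z2Nat.id; lia.
move: nd; rewrite -nE => /Zdivide_dvdn /(primeP p_pr).2.
by move=> /orP[] /eqP; lia.
Qed.

Lemma In_mem (T : eqType) (x : T) l : List.In x l <-> x \in l.
Proof.
elim: l => [|y l IH] //=; rewrite inE; split.
  by move=> [->|/IH ->]; rewrite ?eqxx ?orbT.
by move=> /predU1P[->|/IH]; [left | right].
Qed.

Lemma NoDup_map_uniq (T : eqType) (U : Type) (f : T -> U) (l : seq T) :
  injective f -> uniq l -> List.NoDup (map f l).
Proof.
move=> inj_f; elim: l => [|x l IH] /=; first by constructor.
move=> /andP[xl ul]; constructor; last exact: IH.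
by move=> /List.in_map_iff[y [/inj_f -> /In_mem]]; apply/negP.
Qed.

Lemma size_primes_omega n : (size (primes n) <= Defs.omega (Z.of_nat n))%N.
Proof.
have [n0|n0] := posnP n; first by rewrite n0.
rewrite /Defs.omega -(size_map Z.of_nat); apply/ssrnat.leP.
apply: List.NoDup_incl_length.
  by apply: NoDup_map_uniq (primes_uniq n); apply: Nat2Z.inj.
move=> z /List.in_map_iff[p [<- /In_mem]]; rewrite mem_primes => /and3P[p_pr _ pn].
apply/List.filter_In; split.
  apply: List.in_map; apply/List.in_seq; split; first exact/ssrnat.leP.
  by apply/ssrnat.ltP; rewrite Nat2Z.id /= ltnS dvdn_leq.
case: prime_dec => [_|np]; last by case: np; apply: prime_Zprime.
apply/Z.eqb_eq; apply: Znumtheory.Zdivide_mod; exact/Zdivide_dvdn.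
Qed.

Lemma squarefree_prod_primes n : (0 < n)%N -> Defs.squarefree (Z.of_nat n) ->
  (\prod_(p <- primes n) p)%N = n.
Proof.
move=> n0 sqf; rewrite [RHS](prod_prime_decomp n0) prime_decompE big_map /=.
rewrite big_seq [RHS]big_seq; apply: eq_bigr => p; rewrite mem_primes => /and3P[p_pr _ pn].
have l1 : (0 < logn p n)%N by rewrite logn_gt0 mem_primes p_pr n0.
suff : (logn p n < 2)%N by case: (logn p n) l1 => [|[|]] //; rewrite expn1.
rewrite ltnNge -pfactor_dvdn //; apply/negP => p2n.
case: (sqf (Z.of_nat p) (prime_Zprime p_pr)).
by rewrite -Nat2Z.inj_mul multE mulnn; apply/Zdivide_dvdn.
Qed.

Section CharacterFactors.
Variables (n : nat) (chi : Z -> Coquelicot.Complex.C).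
Hypotheses (n0 : (0 < n)%N) (sqf : Defs.squarefree (Z.of_nat n))
  (prim : primitive_character (Z.of_nat n) chi).

Let c (k : nat) : Cx := toC (chi (Z.of_nat k)).

Let cM x y : c (x * y)%N = c x * c y.
Proof.
by case: prim => -[chiM _] _; rewrite /c -toC_mult -chiM -Nat2Z.inj_mul.
Qed.

Let c_per x : c (x + n)%N = c x.
Proof.
by case: prim => -[_ [per _]] _; rewrite /c Nat2Z.inj_add per.
Qed.

Let c_mod x y : x = y %[mod n] -> c x = c y.
Proof. by move=> xy; rewrite -(periodic_mod c_per) xy (periodic_mod c_per). Qed.

Let c_eq0 x : (c x == 0) = ~~ coprime x n.
Proof.
case: prim => -[_ [_ chi0]] _.
have E : c x = 0 <-> chi (Z.of_nat x) = RtoC 0.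
  by split => [H|H]; [apply: toC_inj; rewrite -/(c x) H | rewrite /c H].
apply/eqP/idP => [/E/chi0|nco].
  by rewrite Zgcd_gcdn => H; apply/negP => /eqP co; apply: H; rewrite co.
by apply/E/chi0; rewrite Zgcd_gcdn => /(Nat2Z.inj _ 1) co; move: nco; rewrite /coprime co.
Qed.

Let c1 : c 1 = 1.
Proof.
have : c 1 != 0 by rewrite c_eq0 negbK coprime1n.
by move=> nz; apply: (mulfI nz); rewrite -cM mulr1.
Qed.

Lemma char_mod z : chi z = chi (Z.modulo z (Z.of_nat n)).
Proof.
case: prim => -[_ [per _]] _.
have perk (k : nat) y : chi (Z.add y (Z.mul (Z.of_nat k) (Z.of_nat n))) = chi y.
  elim: k => [|k IH]; first by rewrite Z.add_0_r.
  by rewrite -[RHS]IH -[RHS]per; congr chi; lia.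
have zE := Z.div_mod z (Z.of_nat n) (ltac:(lia)).
have [k [kE|kE]] : exists k : nat, Z.div z (Z.of_nat n) = Z.of_nat k \/ Z.div z (Z.of_nat n) = Z.opp (Z.of_nat k).
- by exists (Z.to_nat (Z.abs (Z.div z (Z.of_nat n)))); lia.
- by rewrite -[RHS](perk k); congr chi; rewrite [LHS]zE kE Z.add_comm [X in Z.add _ X]Z.mul_comm.
by rewrite -[LHS](perk k); congr chi; rewrite [X in Z.add X _]zE kE; move: (Z.modulo z _) => w; lia.
Qed.

Let primitive_witness m : (m %| n)%N -> (m < n)%N ->
  exists x, [/\ coprime x n, x = 1 %[mod m] & c x != 1].
Proof.
move=> mn ltmn; case: prim => _ noind; have m0 : (0 < m)%N by apply: dvdn_gt0 mn.
apply: Classical_Prop.NNPP => H; apply: noind; exists (Z.of_nat m); split; first by lia.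
split; first by lia.
split; first exact/Zdivide_dvdn.
move=> z zco zm; apply: Classical_Prop.NNPP => z1; apply: H.
pose x := Z.to_nat (Z.modulo z (Z.of_nat n)).
have xE : Z.of_nat x = Z.modulo z (Z.of_nat n).
  by rewrite Z2Nat.id //; have := Z.mod_pos_bound z (Z.of_nat n) (ltac:(lia)); lia.
exists x; split.
- by rewrite /coprime; apply/eqP/Nat2Z.inj; rewrite -Zgcd_gcdn xE Z.gcd_mod 1?Z.gcd_comm ?zco //; lia.
- apply: Nat2Z.inj.
  rewrite !Zof_nat_modn //.
  rewrite xE -Znumtheory.Zmod_div_mod ?zm; [by [] | lia | lia | exact/Zdivide_dvdn].
by apply/negP => /eqP cx1; apply: z1; apply: toC_inj; rewrite char_mod -xE -/(c x) cx1.
Qed.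

(* The idempotents of Z/n for n = p (n/p): k prime_idem p + prime_coidem p is k mod p and
   1 mod n/p, which makes local_char the p-component of chi. *)
Definition prime_idem p := chinese p (n %/ p) 1 0.
Definition prime_coidem p := chinese p (n %/ p) 0 1.
Definition local_char p (k : nat) : Cx := c (k * prime_idem p + prime_coidem p)%N.

Section AtPrime.
Variable p : nat.
Hypothesis pn : p \in primes n.

Let p_pr : prime p. Proof. by move: pn; rewrite mem_primes => /and3P[]. Qed.
Let pdn : (p %| n)%N. Proof. by move: pn; rewrite mem_primes => /and3P[]. Qed.

Let nE : (p * (n %/ p))%N = n. Proof. by rewrite mulnC divnK. Qed.

Let co : coprime p (n %/ p).
Proof.
rewrite prime_coprime //; apply/negP => pp; case: (sqf (prime_Zprime p_pr)).
rewrite -Nat2Z.inj_mul multE; apply/Zdivide_dvdn.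
by rewrite -[X in (_ %| X)%N]nE dvdn_mul.
Qed.

Lemma local_eqmod x y : x = y %[mod p] -> x = y %[mod n %/ p] -> x = y %[mod n].
Proof. by move=> xp xn; apply/eqP; rewrite -nE chinese_remainder // xp xn !eqxx. Qed.

Lemma local_mod_p k : k * prime_idem p + prime_coidem p = k %[mod p].
Proof.
rewrite -modnDm -modnMmr /prime_idem /prime_coidem !(chinese_modl co).
by rewrite modnMmr muln1 mod0n addn0 modn_mod.
Qed.

Lemma local_mod_co k : k * prime_idem p + prime_coidem p = 1 %[mod n %/ p].
Proof.
rewrite -modnDm -modnMmr /prime_idem /prime_coidem !(chinese_modr co).
by rewrite mod0n muln0 mod0n add0n modn_mod.
Qed.

(** Nontriviality comes from primitivity at the proper divisor n/p: some x coprime to n with x = 1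
    mod n/p has chi x <> 1, and chi at such an x is already its p-component. *)
Lemma local_char_nontrivial : nontrivial_char p (local_char p).
Proof.
have np0 : (0 < n %/ p)%N by rewrite divn_gt0 ?prime_gt0 // dvdn_leq.
split.
- move=> x y; rewrite /local_char -cM; apply: c_mod; apply: local_eqmod.
    by rewrite -[RHS]modnMm !local_mod_p modnMm.
  by rewrite -[RHS]modnMm !local_mod_co modnMm.
- move=> x; rewrite /local_char; apply: c_mod; apply: local_eqmod.
    by rewrite !local_mod_p modnDr.
  by rewrite !local_mod_co.
- apply/eqP; rewrite /local_char c_eq0; apply/negP => /(coprime_dvdr pdn).
  rewrite coprime_sym prime_coprime // => /negP; apply.
  by rewrite /dvdn local_mod_p mod0n.
- rewrite -[RHS]c1; apply: c_mod; apply: local_eqmod; first exact: local_mod_p.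
  exact: local_mod_co.
have ltn : (n %/ p < n)%N by rewrite ltn_Pdiv // prime_gt1.
have dvd : (n %/ p %| n)%N by rewrite -[X in (_ %| X)%N]nE dvdn_mull.
have [x [xn x1 cx]] := primitive_witness dvd ltn.
exists x; last first.
  rewrite /local_char (_ : c _ = c x) //; apply: c_mod; apply: local_eqmod; first exact: local_mod_p.
  by rewrite local_mod_co x1.
by rewrite -prime_coprime // coprime_sym (coprime_dvdr pdn).
Qed.

End AtPrime.

Lemma eqmod_primes x y : (forall p, p \in primes n -> x = y %[mod p]) -> x = y %[mod n].
Proof.
move=> H; apply/eqP; rewrite dist_eqmod -(squarefree_prod_primes n0 sqf).
have : forall p, p \in primes n -> (p %| dist x y)%N by move=> p /H/eqP; rewrite dist_eqmod.
have : all prime (primes n) by apply/allP => p; rewrite mem_primes => /and3P[].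
elim: (primes n) (primes_uniq n) => [|p l IH] /=; first by rewrite big_nil.
move=> /andP[pl ul] /andP[p_pr prl] D; rewrite big_cons Gauss_dvd.
  by rewrite D ?mem_head //= IH // => p' p'l; apply: D; rewrite inE p'l orbT.
rewrite big_seq; elim/big_ind: _ => [|u v|p' p'l]; first exact: coprimen1.
  by rewrite coprimeMr => -> ->.
rewrite prime_coprime // dvdn_prime2 //; first by apply: contraNneq pl => ->.
exact: (allP prl).
Qed.

(** Modulo p the argument belonging to p is k and those of the other primes are 1, so the product of
    the arguments is k modulo n. *)
Lemma prod_local_char k : prod_char (primes n) local_char k = c k.
Proof.
have -> : prod_char (primes n) local_char k =
    c (\prod_(p <- primes n) (k * prime_idem p + prime_coidem p))%N.
  by rewrite /prod_char (big_morph c cM c1).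
apply: c_mod; apply: eqmod_primes => p pn.
rewrite (bigD1_seq p) ?primes_uniq //= -modnMm local_mod_p //.
suff -> : ((\prod_(i <- primes n | i != p) (k * prime_idem i + prime_coidem i)) %% p = 1 %% p)%N.
  by rewrite modnMm muln1.
rewrite big_seq_cond; elim/big_ind: _ => [//|x y xE yE|i /andP[iin ip]].
  by rewrite -modnMm xE yE modnMm muln1.
have pd : (p %| n %/ i)%N.
  move: pn iin; rewrite !mem_primes => /and3P[p_pr _ pn] /and3P[i_pr _ idn].
  have := pn; rewrite -{1}(divnK idn) Gauss_dvdl //.
  by rewrite prime_coprime // dvdn_prime2 // eq_sym.
by rewrite -(modn_dvdm _ pd) local_mod_co // modn_dvdm.
Qed.

End CharacterFactors.

Lemma Zof_nat_expn x i : Z.of_nat (x ^ i)%N = Z.pow (Z.of_nat x) (Z.of_nat i).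
Proof.
elim: i => [|i IH] //.
by rewrite expnS Nat2Z.inj_mul IH Nat2Z.inj_succ Z.pow_succ_r //; lia.
Qed.

(** * Comparison of the solution counts with [J] *)

Section SolutionCount.
Variables d B r : nat.

Let half (b : bool) (V : {ffun bool * 'I_r -> 'I_B}) : seq Z :=
  [seq Z.of_nat (V (b, i)).+1 | i <- enum 'I_r].

Let sz b V : size (half b V) = r. Proof. by rewrite size_map size_enum_ord. Qed.

Let power_sum_half b V i :
  power_sum (half b V) i = Z.of_nat (\sum_(j < r) (V (b, j)).+1 ^ i)%N.
Proof.
rewrite /half /power_sum -big_enum /=; elim: (enum 'I_r) => [|j l IH]; first by rewrite big_nil.
rewrite big_cons Nat2Z.inj_add -IH; rewrite /=.
by rewrite Zof_nat_expn.
Qed.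

Let mem_tuples (l : seq Z) :
  (forall z, List.In z l -> exists2 k : nat, (k < B)%N & z = Z.of_nat k.+1) ->
  List.In l (tuples B (size l)).
Proof.
elim: l => [|z l IH] H /=; first by left.
apply/List.in_flat_map; exists z; split; last first.
  by apply: List.in_map; apply: IH => z' z'l; apply: H; right.
have [k kB ->] := H z (or_introl erefl).
apply: List.in_map; apply/List.in_seq; split; first by apply/ssrnat.leP.
exact/ssrnat.ltP.
Qed.

Lemma vcount_le_J : (vcount d B r <= Defs.J r d B)%N.
Proof.
pose f V := half false V ++ half true V.
have inj_f : injective f.
  move=> V V' fE.
  have E0 : half false V = half false V'.
    by have := congr1 (take r) fE; rewrite !take_size_cat ?sz.
  have E1 : half true V = half true V'.
    by have := congr1 (drop r) fE; rewrite !drop_size_cat ?sz.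
  apply/ffunP => -[b i].
  have E : half b V = half b V' by case: b.
  have : nth Z0 (half b V) i = nth Z0 (half b V') i by rewrite E.
  rewrite /half !(nth_map i) -?enumT ?size_enum_ord // !nth_ord_enum.
  by move=> /Nat2Z.inj [] /val_inj.
rewrite /vcount cardE /Defs.J -(size_map f); apply/ssrnat.leP.
apply: List.NoDup_incl_length; first by apply: NoDup_map_uniq => //; apply: enum_uniq.
move=> l /List.in_map_iff[V [<- /In_mem]]; rewrite mem_enum inE => /forallP solV.
apply/List.filter_In; split.
  have -> : Nat.mul 2 r = size (f V) by rewrite size_cat !sz addnn -mul2n multE.
  apply: mem_tuples => z; rewrite /f => /List.in_app_iff[] /List.in_map_iff[i [<- _]].
    by exists (V (false, i)) => //; apply: ltn_ord.
  by exists (V (true, i)) => //; apply: ltn_ord.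
rewrite /vmvt_solution; apply/List.forallb_forall => i /List.in_seq[i1 id].
have len b : Datatypes.length (half b V) = r := sz b V.
have -> : List.firstn r (f V) = half false V.
  by rewrite List.firstn_app len Nat.sub_diag List.firstn_O List.app_nil_r List.firstn_all2 ?len.
have -> : List.skipn r (f V) = half true V.
  by rewrite List.skipn_app len Nat.sub_diag List.skipn_O List.skipn_all2 ?len.
have lt : (i.-1 < d)%N by lia.
have := solV (Ordinal lt); rewrite /= prednK; last by apply/ssrnat.ltP.
by move=> /eqP E; apply/Z.eqb_eq; rewrite !power_sum_half E.
Qed.

Lemma vcount_diagonal : (B ^ r <= vcount d B r)%N.
Proof.
rewrite -[X in (X ^ _)%N](card_ord B) -[X in (_ ^ X)%N](card_ord r) -card_ffun.
pose g (v : {ffun 'I_r -> 'I_B}) : {ffun bool * 'I_r -> 'I_B} := [ffun x => v x.2].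
have inj_g : injective g.
  move=> v v' /ffunP E; apply/ffunP => i; have := E (true, i).
  by rewrite !ffunE.
rewrite -cardsT -(card_imset _ inj_g) subset_leq_card //.
apply/subsetP => _ /imsetP[v _ ->]; rewrite inE; apply/forallP => j.
by apply/eqP; apply: eq_bigr => i _; rewrite !ffunE.
Qed.

End SolutionCount.

Lemma char_exp_sum_mixed n chi a d M N :
  (0 < n)%N -> Defs.squarefree (Z.of_nat n) -> primitive_character (Z.of_nat n) chi ->
  exists M' u, (forall j, `|u j| = 1) /\
    (Cmod (char_exp_sum chi a d M N))%:C%C = `|mixed_sum (primes n) (local_char n chi) d M' N u|.
Proof.
(* [csum] starts at k = 1 and [mixed_sum] at k = 0, whence M + 1. The character needs it only modulo
   n, the phases need it exactly. *)
move=> n0 sqf prim; pose M1 := Z.succ M; pose M' := Z.to_nat (Z.modulo M1 (Z.of_nat n)).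
have [u [u1 uE]] := poly_phase_real a d M1.
exists M', u; split=> //; rewrite -toC_norm; congr `|_|.
have -> : char_exp_sum chi a d M N =
    csum (fun k => Cmult (chi (Z.add M (Z.of_nat k))) (Defs.e (poly_eval a d (IZR (Z.add M (Z.of_nat k)))))) N.
  by [].
elim: N => [|N IH]; first by rewrite /mixed_sum big_ord0.
rewrite /mixed_sum big_ord_recr /= -/(mixed_sum _ _ _ _ _ _) -IH toC_plus toC_mult; congr (_ + _).
have E : Z.add M (Z.pos (Pos.of_succ_nat N)) = Z.add M1 (Z.of_nat N) by rewrite /M1; lia.
rewrite E uE prod_local_char //; congr (toC _ * _).
rewrite (char_mod n0 prim) [RHS](char_mod n0 prim) Nat2Z.inj_add Z2Nat.id; last first.
  by have := Z.mod_pos_bound M1 (Z.of_nat n) (ltac:(lia)); lia.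
by rewrite Zplus_mod_idemp_l.
Qed.

Lemma sqrtC_nat_real (q : nat) : sqrtC (q%:R : Cx) = (Num.sqrt (q%:R : R))%:C%C.
Proof.
have E : ((Num.sqrt (q%:R : R))%:C%C : Cx) ^+ 2 = q%:R.
  by rewrite -(rmorphXn (real_complex R)) sqr_sqrtr ?ler0n //= (rmorph_nat (real_complex R)).
by rewrite -E sqrCK // lecR sqrtr_ge0.
Qed.

Lemma harmonic_real A : harmonic Cx A = (harmonic R A)%:C%C.
Proof.
rewrite /harmonic (rmorph_sum (real_complex R)); apply: eq_bigr => h _.
by rewrite -(rmorph_nat (real_complex R)) (fmorphV (real_complex R)).
Qed.

(** * The amplification step over the reals *)

Local Open Scope R_scope.

Lemma harmonic_le_ln A : (0 < A)%N -> harmonic R A <= 1 + ln (INR A).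
Proof.
case: A => // A _; elim: A => [|A IH].
  by rewrite /harmonic big_nat1 INR_1 ln_1 invr1; apply: Req_le; rewrite Rplus_0_r.
have -> : harmonic R A.+2 = harmonic R A.+1 + / INR A.+2.
  by rewrite /harmonic big_nat_recr // INRE RinvE.
suff : / INR A.+2 <= ln (INR A.+2) - ln (INR A.+1) by move: IH; move: (harmonic R A.+1) => x; lra.
have p1 : 0 < INR A.+1 by apply: lt_0_INR; lia.
have p2 : 0 < INR A.+2 by apply: lt_0_INR; lia.
have E : INR A.+1 = INR A.+2 * (1 - / INR A.+2).
  rewrite Rmult_minus_distr_l Rinv_r; last lra.
  by have := S_INR A.+1; lra.
have p3 : 0 < 1 - / INR A.+2 by nra.
rewrite E ln_mult //.
have := exp_ineq1_le (ln (1 - / INR A.+2)); rewrite exp_ln //; lra.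
Qed.

Section RealStep.
Variables (n : nat) (chi : Z -> Coquelicot.Complex.C) (d : nat).
Hypotheses (n0 : (0 < n)%N) (sqf : Defs.squarefree (Z.of_nat n))
  (prim : primitive_character (Z.of_nat n) chi).

(** Uniform in M and in the phases, the form in which the induction on N treats the end segments. *)
Definition mixed_bound (N : nat) (x : R) := forall M (u : nat -> Cx), (forall j, `|u j| = 1%R) ->
  (`|mixed_sum (primes n) (local_char n chi) d M N u| <= x%:C%C)%R.

Let prs : all prime (primes n).
Proof. by apply/allP => p; rewrite mem_primes => /and3P[]. Qed.

Let chipP p : p \in primes n -> nontrivial_char p (local_char n chi p).
Proof. exact: local_char_nontrivial. Qed.

Lemma mixed_bound_trivial N : mixed_bound N (INR N).
Proof.
move=> M u u1; rewrite INRE (rmorph_nat (real_complex R)).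
have -> : (N%:R = \sum_(k < N) 1 :> Cx)%R by rewrite sumr_const card_ord.
rewrite (le_trans (ler_norm_sum _ _ _)) // ler_sum // => k _.
rewrite normrM mulr_ile1 ?normr_ge0 ?prod_char_norm_le1 //.
rewrite /poly_phase normr_prod big1 // => j _; by rewrite normrX u1 expr1n.
Qed.

Lemma mixed_bound_le N x y : x <= y -> mixed_bound N x -> mixed_bound N y.
Proof. by move=> /RleP xy H M u u1; apply: le_trans (H M u u1) _; rewrite lecR. Qed.

(** Trades arithmetic quantities for explicit ones: the coprime count for A / 2^(s+1), the harmonic
    sum for 1 + ln A, the product of ranges for (r+1)^d B^D, and the solution count for [J]. *)
Lemma mixed_step s r r' A B N (Y E : R) :
  (size (primes n) <= s)%N -> r = (s.+1 + r')%N -> (0 < B)%N -> (A * N <= n)%N ->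
  (2 * 4 ^ s <= A)%N -> 0 <= Y ->
  (forall h, (h <= A * B)%N -> mixed_bound h E) ->
  (INR A * INR N) ^ ((2 * r.-1)) *
     ((2 * INR A ^ 2 + 2 * (INR N * INR A) * (1 + ln (INR A)) ^ 2) *
      (INR (r.+1 ^ d * B ^ 'C(d.+1, 2))%N *
       (INR (n * (r ^ (2 * r) * B ^ r))%N +
        sqrt (INR n) * INR (mean_const r s * (B ^ (2 * s.+1) * Defs.J r' d B))%N)))
   <= (Y * (INR A * INR B / 2 ^ s.+1)) ^ (2 * r) ->
  mixed_bound N (Y + 2 * E).
Proof.
move=> sz rE B0 AN Abig /RleP Y0 HE hyp M u u1.
have nE := squarefree_prod_primes n0 sqf.
set cc := coprime_count (primes n) A.
have ccA : (A <= 2 ^ s.+1 * cc)%N.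
  have := coprime_count_lb A (primes_uniq n) prs; rewrite -/cc.
  have p2 : (2 ^ size (primes n) <= 2 ^ s)%N by rewrite leq_exp2l.
  move=> H; have {H} : (A <= 2 ^ s * (cc + 2 ^ s))%N.
    by apply: leq_trans H _; rewrite leq_mul // leq_add2l.
  have E4 : (2 ^ s * 2 ^ s = 4 ^ s)%N by rewrite -expnMn.
  rewrite mulnDr E4 expnS; move: Abig; move: (2 ^ s)%N (4 ^ s)%N => a b; lia.
have A0 : (0 < A)%N by apply: leq_trans Abig; rewrite muln_gt0 expn_gt0.
have cc0 : (0 < cc)%N by move: ccA; case: cc => //; rewrite muln0; lia.
rewrite (_ : Y + 2 * E = (Y + (E + E))%R); last by rewrite /GRing.add /=; lra.
rewrite !rmorphD -mulr2n /=.
apply: (burgess_step complex_arch (primes_uniq n) prs chipP sz rE (A := A) (B := B)) => //.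
- by rewrite nE.
- by rewrite lecR.
- by move=> h M' u' hAB u1'; apply: HE.
rewrite nE sqrtC_nat_real harmonic_real -/cc.
have key : ((A * N)%:R ^+ (2 * r.-1) *
  (((2 * A ^ 2)%:R + (2 * (N * A))%:R * harmonic R A ^+ 2) *
   ((\prod_(j < d) (r * B ^ j.+1).+1)%:R *
    ((n * (r ^ (2 * r) * B ^ r))%:R +
     Num.sqrt n%:R * (mean_const r s * (B ^ (2 * s.+1) * vcount d B r'))%:R))) <=
  (Y * (cc * B)%:R) ^+ (2 * r) :> R)%R.
  move/RleP: hyp => hyp; apply: le_trans (le_trans hyp _).
  - have Hle := harmonic_le_ln A0; move/RleP: Hle; rewrite !RealsE => Hle.
    have H0 : (0 <= harmonic R A)%R by apply: sumr_ge0 => h _; rewrite invr_ge0 ler0n.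
    have prod_le : (\prod_(j < d) (r * B ^ j.+1).+1 <= r.+1 ^ d * B ^ 'C(d.+1, 2))%N.
      rewrite -(bin2_sum d.+1) big_mkord big_ord_recl add0n expn_sum.
      rewrite -[X in (_ ^ X * _)%N](card_ord d) -prod_nat_const -big_split /=.
      apply: leq_prod => j _; rewrite mulSn addnC -addn1 leq_add2l ?expn_gt0 ?B0 //.
    have S0 := sqrtr_ge0 (n%:R : R).
    rewrite natrM; apply: ler_wpM2l; first by rewrite exprn_ge0 // mulr_ge0 ?ler0n.
    apply: ler_pM; rewrite ?mulr_ge0 ?addr_ge0 ?mulr_ge0 ?exprn_ge0 ?ler0n //.
      rewrite natrM natrX !natrM lerD2l ler_wpM2l ?mulr_ge0 ?ler0n //.
      by rewrite lerXn2r ?nnegrE // (le_trans H0 Hle).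
    apply: ler_pM; rewrite ?addr_ge0 ?mulr_ge0 ?ler0n ?ler_nat ?lerD2l ?ler_wpM2l ?ler_nat //.
    by rewrite !leq_mul2l vcount_le_J !orbT.
  rewrite !RealsE lerXn2r ?nnegrE ?mulr_ge0 ?ler0n ?invr_ge0 ?exprn_ge0 ?ler0n // ler_wpM2l //.
  rewrite natrM mulrAC ler_wpM2r ?ler0n // ler_pdivrMr ?exprn_gt0 ?ltr0n //.
  by rewrite -natrX -natrM ler_nat mulnC.
move: key; rewrite -lecR /=.
by rewrite !(rmorphM (real_complex R), rmorphD (real_complex R), rmorphXn (real_complex R), rmorph_nat (real_complex R)).
Qed.
End RealStep.

Lemma INR_bin2 d : INR 'C(d.+1, 2) = Dd d.
Proof.
have E : ('C(d.+1, 2) * 2 = d.+1 * d)%N.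
  by elim: d => [|d IH] //; rewrite binS bin1 mulnDl IH; lia.
have := congr1 INR E; rewrite !mult_INR (S_INR d) /Dd [INR 2]/=; lra.
Qed.

Lemma INR_expn m k : INR (m ^ k)%N = INR m ^ k.
Proof. by rewrite !RealsE natrX. Qed.

(** The V^rd diagonal solutions must fit below V^(2 rd - D + eps); eps = 1/2 decides, rd and D being
    integers. For r > rd this makes r - D positive. *)
Lemma vmvt_diagonal d rd : is_r_d d rd -> ('C(d.+1, 2) <= rd)%coq_nat.
Proof.
case=> rd1 [H _]; apply/Nat.nlt_ge => lt.
have [c cP] := H rd rd1 (Nat.le_refl rd) (/ 2) ltac:(lra).
have [V0 V0P] := INR_unbounded (c * c + 1).
have V1 : (1 <= V0)%coq_nat.
  by case: V0 V0P => [|V0] //= H0; [nra | lia].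
have p : 0 < INR V0 by apply: lt_0_INR; lia.
have := cP V0 V1; apply: Rlt_not_le.
have low : INR V0 ^ rd <= INR (Defs.J rd d V0).
  rewrite -INR_expn; apply/le_INR/ssrnat.leP; apply: leq_trans (vcount_le_J d V0 rd).
  exact: vcount_diagonal.
apply: Rlt_le_trans low; rewrite -Rpower_pow //.
have V1' : 1 <= INR V0 by apply: (le_INR 1).
apply: (Rle_lt_trans _ (c * Rpower (INR V0) (INR rd - / 2))).
  have c0 : 0 <= c.
    have := cP 1%N (Nat.le_refl 1); rewrite [INR 1]/= /Rpower ln_1 Rmult_0_r exp_0 Rmult_1_r.
    by apply: Rle_trans; apply: pos_INR.
  apply: Rmult_le_compat_l => //; apply: Rle_Rpower => //.
  have : INR rd + 1 <= INR 'C(d.+1, 2) by rewrite -S_INR; apply: le_INR; lia.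
  by rewrite INR_bin2; lra.
rewrite (_ : INR rd = (INR rd - / 2) + / 2); last lra.
rewrite Rpower_plus (_ : INR rd - / 2 + / 2 - / 2 = INR rd - / 2); last lra.
rewrite Rpower_sqrt // Rmult_comm; apply: Rmult_lt_compat_l; first exact: exp_pos.
have sq := sqrt_sqrt _ (Rlt_le _ _ p); have s0 := sqrt_pos (INR V0).
by apply: Rnot_le_lt => H1; nra.
Qed.

Lemma omega_prime_count n s : (Defs.omega (Z.of_nat n) <= s)%coq_nat -> (size (primes n) <= s)%N.
Proof. by move=> /ssrnat.leP; apply: leq_trans; apply: size_primes_omega. Qed.

Lemma mixed_bound_length n chi d N x :
  (1 <= n)%coq_nat -> Defs.squarefree (Z.of_nat n) -> primitive_character (Z.of_nat n) chi ->
  INR N <= x -> mixed_bound n chi d N x.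
Proof.
move=> /ssrnat.leP n0 sqf prim le; apply: mixed_bound_le le _.
exact: mixed_bound_trivial.
Qed.

Lemma omega_gt0 n : (2 <= n)%coq_nat -> (1 <= Defs.omega (Z.of_nat n))%coq_nat.
Proof.
move=> n2; apply/ssrnat.leP; apply: leq_trans (size_primes_omega n).
have : pdiv n \in primes n by rewrite mem_primes pdiv_prime ?pdiv_dvd ?andbT /=; lia.
by case: (primes n).
Qed.

Lemma mixed_bound_step n chi d s r r' A B N Y E :
  (1 <= n)%coq_nat -> Defs.squarefree (Z.of_nat n) -> primitive_character (Z.of_nat n) chi ->
  (Defs.omega (Z.of_nat n) <= s)%coq_nat -> r = (S s + r')%coq_nat -> (1 <= B)%coq_nat ->
  INR A * INR N <= INR n -> 2 * 4 ^ s <= INR A -> 0 <= Y ->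
  (forall h, INR h <= INR A * INR B -> mixed_bound n chi d h E) ->
  (INR A * INR N) ^ (2 * (r - 1)) *
     ((2 * INR A ^ 2 + 2 * (INR N * INR A) * (1 + ln (INR A)) ^ 2) *
      ((INR r + 1) ^ d * INR B ^ 'C(d.+1, 2) *
       (INR n * (INR r ^ (2 * r) * INR B ^ r) +
        sqrt (INR n) * (INR (mean_const r s) * (INR B ^ (2 * S s) * INR (Defs.J r' d B))))))
   <= (Y * (INR A * INR B / 2 ^ S s)) ^ (2 * r) ->
  mixed_bound n chi d N (Y + 2 * E).
Proof.
move=> n1 sqf prim /omega_prime_count sz rE B1 AN Abig Y0 HE hyp.
apply: (@mixed_step n chi d _ sqf prim s r r' A B N) => //.
- exact/ssrnat.ltP.
- exact/ssrnat.ltP.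
- by apply/ssrnat.leP/INR_le; rewrite mult_INR.
- by apply/ssrnat.leP/INR_le; rewrite mult_INR INR_expn; move: Abig; rewrite !INR_IZR_INZ.
- by move=> h hAB; apply: HE; rewrite -mult_INR; apply/le_INR/ssrnat.leP.
apply: Rle_trans hyp; apply: Req_le.
by rewrite !mult_INR !INR_expn S_INR subn1.
Qed.

Lemma char_exp_sum_bound n chi d N x a M :
  (1 <= n)%coq_nat -> Defs.squarefree (Z.of_nat n) -> primitive_character (Z.of_nat n) chi ->
  mixed_bound n chi d N x -> Cmod (char_exp_sum chi a d M N) <= x.
Proof.
move=> /ssrnat.leP n0 sqf prim H; have [M' [u [u1 E]]] := char_exp_sum_mixed a d M N n0 sqf prim.
by apply/RleP; rewrite -lecR E; apply: H.
Qed.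

End Burgess.

(** * Choice of the parameters *)

Lemma one_plus_ln_le q eps : 1 <= q -> 0 < eps -> 1 + ln q <= (1 + / eps) * Rpower q eps.
Proof.
intros q1 e0.
assert (l0 : 0 <= ln q) by (rewrite <- ln_1; apply ln_le; lra).
assert (E := exp_ineq1_le (eps * ln q)); fold (Rpower q eps) in E.
assert (i0 : 0 < / eps) by now apply Rinv_0_lt_compat.
apply Rle_trans with ((1 + / eps) * (1 + eps * ln q)).
- replace ((1 + / eps) * (1 + eps * ln q)) with (1 + ln q + / eps + eps * ln q) by (field; lra).
  nra.
- apply Rmult_le_compat_l; lra.
Qed.

(** The numerical condition of the step with a = A, x = N, b = B, Q = sqrt q, G = q^eps, w = 1 + ln
    A, u = N^(1-1/r) and v^(2r) = Q L. By H1 and H2 both parts of the moment are O(Q b^(2r-D) G).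
    Once common powers are cancelled, what remains is 4 k^2 P (c1 + c2) x <= (c0 / 2^(s+1))^(2r) L
    a, a consequence of x <= 32 a b. *)
Lemma step_inequality (r s D : nat) (a x b q L Q G k P c1 c2 w rr M J c0 u v : R) :
  (D <= r)%nat -> (1 <= r)%nat -> 0 < a -> a <= x -> 1 <= b -> b <= L -> x <= 32 * a * b ->
  0 < Q -> 1 <= G -> 1 <= k -> 0 <= P -> 0 <= c1 -> 0 <= c2 -> w ^ 2 <= k ^ 2 * G ->
  q * (rr * b ^ r) <= c1 * (Q * b ^ (2 * r - D)) ->
  M * (b ^ (2 * S s) * J) <= c2 * (b ^ (2 * r - D) * G) ->
  u ^ (2 * r) = x ^ (2 * (r - 1)) -> v ^ (2 * r) = Q * L ->
  0 <= c0 -> 32 * (4 * k ^ 2 * P * (c1 + c2)) <= (c0 / 2 ^ S s) ^ (2 * r) ->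
  (a * x) ^ (2 * (r - 1)) *
     ((2 * a ^ 2 + 2 * (x * a) * w ^ 2) * (P * b ^ D * (q * (rr * b ^ r) + Q * (M * (b ^ (2 * S s) * J)))))
   <= (c0 * G * u * v * (a * b / 2 ^ S s)) ^ (2 * r).
Proof.
intros Dr r1 a0 ax b1 bL xab Q0 G1 k1 P0 c10 c20 wG H1 H2 uE vE c00 Hc.
set (c4 := 4 * k ^ 2 * P * (c1 + c2)) in *.
assert (k2 : 1 <= k ^ 2) by (apply pow_R1_Rle; lra).
assert (kG : 1 <= k ^ 2 * G) by nra.
assert (bp : forall m, 0 < b ^ m) by (intro; apply pow_lt; lra).
assert (c40 : 0 <= c4).
{ unfold c4; repeat apply Rmult_le_pos; lra. }
apply Rle_trans with ((a * x) ^ (2 * (r - 1)) *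
  (4 * (k ^ 2 * G) * (x * a) * (P * b ^ D * (Q * (b ^ (2 * r - D) * G) * (c1 + c2))))).
{ apply Rmult_le_compat_l; [apply pow_le; nra |].
  assert (w2 : 0 <= w ^ 2) by apply pow2_ge_0.
  assert (T1 : 2 * a ^ 2 + 2 * (x * a) * w ^ 2 <= 4 * (k ^ 2 * G) * (x * a)).
  { assert (0 < x * a) by nra.
    assert (x * a * w ^ 2 <= x * a * (k ^ 2 * G)) by (apply Rmult_le_compat_l; lra).
    assert (a ^ 2 <= x * a * (k ^ 2 * G)) by nra.
    lra. }
  assert (T2 : q * (rr * b ^ r) + Q * (M * (b ^ (2 * S s) * J)) <= Q * (b ^ (2 * r - D) * G) * (c1 + c2)).
  { assert (Q * (M * (b ^ (2 * S s) * J)) <= Q * (c2 * (b ^ (2 * r - D) * G)))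
      by (apply Rmult_le_compat_l; lra).
    assert (0 <= c1 * (Q * b ^ (2 * r - D))).
    { apply Rmult_le_pos; [lra |]; apply Rmult_le_pos; [lra | apply Rlt_le, bp]. }
    nra. }
  assert (0 <= P * b ^ D) by (apply Rmult_le_pos; [lra | apply Rlt_le, bp]).
  assert (T3 : 0 <= P * b ^ D * (Q * (b ^ (2 * r - D) * G) * (c1 + c2))).
  { specialize (bp (2 * r - D)%nat); apply Rmult_le_pos; [lra |]; repeat apply Rmult_le_pos; lra. }
  apply Rle_trans with ((2 * a ^ 2 + 2 * (x * a) * w ^ 2) * (P * b ^ D * (Q * (b ^ (2 * r - D) * G) * (c1 + c2)))).
  - apply Rmult_le_compat_l; [nra | apply Rmult_le_compat_l; lra].
  - apply Rmult_le_compat_r; lra. }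
assert (bE : b ^ (2 * r) = b ^ D * b ^ (2 * r - D)) by (rewrite <- pow_add; f_equal; lia).
assert (ab : forall y, y ^ (2 * r) = y ^ (2 * (r - 1)) * y ^ 2) by (intro; rewrite <- pow_add; f_equal; lia).
replace (c0 * G * u * v * (a * b / 2 ^ S s)) with ((c0 / 2 ^ S s) * G * u * v * a * b)
  by (field; apply pow_nonzero; lra).
rewrite !Rpow_mult_distr, uE, vE, (ab a), (ab G), bE.
set (W := (c0 / 2 ^ S s) ^ (2 * r)) in *.
set (A := a ^ (2 * (r - 1))); set (X := x ^ (2 * (r - 1))); set (G' := G ^ (2 * (r - 1))).
assert (G1' : 1 <= G') by (apply pow_R1_Rle; lra).
assert (A0 : 0 <= A) by (apply pow_le; lra).
assert (X0 : 0 <= X) by (apply pow_le; lra).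
assert (B0 := bp D); assert (B1 := bp (2 * r - D)%nat).
assert (W0 : 0 <= W) by lra.
assert (key : c4 * x <= W * (L * a)).
{ apply Rle_trans with (c4 * (32 * (a * L))).
  - apply Rmult_le_compat_l; [lra |].
    assert (a * b <= a * L) by (apply Rmult_le_compat_l; lra). lra.
  - assert (0 <= a * L) by nra. nra. }
assert (Z0 : 0 <= A * X * (b ^ D * b ^ (2 * r - D)) * Q * a * G ^ 2).
{ assert (0 <= G ^ 2) by apply pow2_ge_0. repeat apply Rmult_le_pos; lra. }
replace (A * X * (4 * (k ^ 2 * G) * (x * a) * (P * b ^ D * (Q * (b ^ (2 * r - D) * G) * (c1 + c2)))))
  with (A * X * (b ^ D * b ^ (2 * r - D)) * Q * a * G ^ 2 * (c4 * x)) by (unfold c4; ring).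
apply Rle_trans with (A * X * (b ^ D * b ^ (2 * r - D)) * Q * a * G ^ 2 * (W * (L * a))).
- apply Rmult_le_compat_l; lra.
- assert (0 <= W * (L * a)) by nra.
  replace (W * (G' * G ^ 2) * X * (Q * L) * (A * a ^ 2) * (b ^ D * b ^ (2 * r - D)))
    with (A * X * (b ^ D * b ^ (2 * r - D)) * Q * a * G ^ 2 * (W * (L * a)) * G') by ring.
  assert (0 <= A * X * (b ^ D * b ^ (2 * r - D)) * Q * a * G ^ 2 * (W * (L * a))) by (apply Rmult_le_pos; lra).
  nra.
Qed.

Lemma Rpower_pow_mult x t m : Rpower x t ^ m = Rpower x (t * INR m).
Proof. rewrite <- Rpower_pow by apply exp_pos. apply Rpower_mult. Qed.

Lemma Rpower_ge_1 x t : 1 <= x -> 0 <= t -> 1 <= Rpower x t.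
Proof.
intros x1 t0. rewrite <- (Rpower_O x) by lra. now apply Rle_Rpower.
Qed.

(** B is the floor of L and A that of N/16B. The lower bound on N gives N/L >= q^(1/4 - 1/4K) >=
    q^(1/8) because K >= 2, hence the eighth power and the size of A. The upper bound gives N^2 <= q
    L, hence A N <= q. *)
Lemma choose_lengths (q K t L : R) (N : nat) :
  2 <= K -> 1 <= t -> (32 * t) ^ 8 <= q -> L = Rpower q (1 / (2 * K)) ->
  Rpower q (1 / 4 + 1 / (4 * K)) < INR N -> INR N <= Rpower q (1 / 2 + 1 / (4 * K)) ->
  exists A B : nat, (1 <= B)%nat /\ INR B <= L /\ L <= 2 * INR B /\ t <= INR A /\
    INR N <= 32 * INR A * INR B /\ 16 * (INR A * INR B) <= INR N /\ INR A * INR N <= q.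
Proof.
intros K2 t1 qt LE lo hi.
assert (p8 : 1 <= (32 * t) ^ 8) by (apply pow_R1_Rle; lra).
assert (q1 : 1 <= q) by lra.
assert (Kinv : 0 < 1 / (4 * K) <= 1 / 8).
{ split; [apply Rdiv_lt_0_compat; lra | apply Rmult_le_compat_l; [lra | apply Rinv_le_contravar; lra]]. }
assert (Khalf : 1 / (2 * K) = 2 * (1 / (4 * K))) by (field; lra).
rewrite Khalf in LE; set (e := 1 / (4 * K)) in *.
assert (L1 : 1 <= L) by (rewrite LE; apply Rpower_ge_1; lra).
destruct (nfloor_ex L) as [B [BL LB]]; [lra |].
assert (B1 : (1 <= B)%nat) by (destruct B; [simpl in LB; lra | lia]).
assert (B1' : 1 <= INR B) by (apply (le_INR 1); lia).
set (A := Nat.div N (16 * B)).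
assert (D1 : (16 * B * A <= N)%nat) by (apply Nat.Div0.mul_div_le).
assert (D2 : (N < 16 * B * S A)%nat) by (apply Nat.mul_succ_div_gt; lia).
apply le_INR in D1; apply lt_INR in D2.
rewrite !mult_INR in D1, D2; rewrite (S_INR A) in D2.
replace (INR 16) with 16 in D1, D2 by (simpl; ring).
assert (q8 : 32 * t <= Rpower q (1 / 8)).
{ apply Rle_trans with (Rpower ((32 * t) ^ 8) (1 / 8)).
  - rewrite <- Rpower_pow by lra. rewrite Rpower_mult.
    replace (INR 8 * (1 / 8)) with 1 by (simpl; field). rewrite Rpower_1 by lra. lra.
  - apply Rle_Rpower_l; lra. }
assert (A2 : 2 * t < INR A + 1).
{ apply Rmult_lt_reg_l with (16 * L); [lra |].
  apply Rle_lt_trans with (INR N).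
  - apply Rle_trans with (L * Rpower q (1 / 8)); [nra |].
    apply Rle_trans with (Rpower q (1 / 4 + e)); [| lra].
    rewrite LE, <- Rpower_plus. apply Rle_Rpower; lra.
  - apply Rlt_le_trans with (1 := D2). assert (0 <= INR A) by apply pos_INR. nra. }
exists A, B. repeat split; try lra; try exact B1; try nra.
assert (sq : INR N * INR N <= q * L).
{ apply Rle_trans with (Rpower q (1 / 2 + e) * Rpower q (1 / 2 + e)).
  - assert (0 <= INR N) by apply pos_INR. nra.
  - rewrite <- Rpower_plus, LE. rewrite <- (Rpower_1 q) at 2 by lra.
    rewrite <- Rpower_plus. right; f_equal; lra. }
assert (0 <= INR N) by apply pos_INR.
apply Rmult_le_reg_l with (16 * INR B); [lra |].
apply Rle_trans with (INR N * INR N); [nra |].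
apply Rle_trans with (1 := sq). nra.
Qed.

Lemma J_bound_scaled d r' D b q C2 eps :
  INR D = Dd d -> (1 <= b)%nat -> INR b <= q -> (D <= 2 * r')%nat -> 0 < eps -> 0 <= C2 ->
  INR (J r' d b) <= C2 * Rpower (INR b) (2 * INR r' - Dd d + eps) ->
  INR (J r' d b) <= C2 * (INR b ^ (2 * r' - D) * Rpower q eps).
Proof.
intros HD b1 bq Dr' e0 C20 H. apply Rle_trans with (1 := H).
assert (b1' : 1 <= INR b) by (apply (le_INR 1); lia).
apply Rmult_le_compat_l; [exact C20 |].
rewrite Rpower_plus, <- HD.
replace (2 * INR r' - INR D) with (INR (2 * r' - D)) by (rewrite minus_INR, mult_INR by lia; simpl; ring).
rewrite Rpower_pow by lra.
apply Rmult_le_compat_l; [apply pow_le; lra |]. apply Rle_Rpower_l; lra.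
Qed.

Lemma mixed_bound_burgess (d s r rd : nat) eps :
  is_r_d d rd -> (rd + s + 1 <= r)%nat -> 0 < eps ->
  exists C, 0 < C /\ forall n chi N,
    (1 <= n)%nat -> squarefree (Z.of_nat n) -> primitive_character (Z.of_nat n) chi ->
    (omega (Z.of_nat n) <= s)%nat -> (1 <= N)%nat ->
    INR N <= Rpower (INR n) (1 / 2 + 1 / (4 * (INR r - Dd d))) ->
    Burgess.mixed_bound n chi d N (C * Rpower (INR n) eps * Rpower (INR N) (1 - 1 / INR r)
      * Rpower (INR n) ((INR r + 1 - Dd d) / (4 * INR r * (INR r - Dd d)))).
Proof.
intros Hrd hr e0.
assert (Drd := Burgess.vmvt_diagonal Hrd).
assert (HD := Burgess.INR_bin2 d).
set (D := binomial.binomial (S d) 2) in *.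
destruct Hrd as [rd1 [vm _]].
set (r' := (r - S s)%nat).
destruct (vm r' ltac:(lia) ltac:(lia) eps e0) as [CJ HJ].
assert (CJ0 : 0 <= CJ).
{ specialize (HJ 1%nat (le_n 1)).
  replace (Rpower (INR 1) (2 * INR r' - Dd d + eps)) with 1 in HJ
    by (simpl; unfold Rpower; now rewrite ln_1, Rmult_0_r, exp_0).
  assert (0 <= INR (J r' d 1)) by apply pos_INR. lra. }
set (c1 := 2 ^ (r - D) * INR r ^ (2 * r)).
set (c2 := INR (Burgess.mean_const r s) * CJ).
set (k := 1 + / (eps / 2)).
set (P := (INR r + 1) ^ d).
set (c4 := 4 * k ^ 2 * P * (c1 + c2)).
set (t := 2 * 4 ^ s).
set (q0 := (32 * t) ^ 8).
(* Half of C = q0 + 2 c0 serves the main term: C/2 divided by 2^(s+1) is at least 1 + 32 c4, whose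
   2r-th power exceeds 32 c4. The summand q0 covers q < q0 trivially. *)
set (c0 := 2 ^ S s * (1 + 32 * c4)).
assert (r0 : 0 <= INR r) by apply pos_INR.
assert (c10 : 0 <= c1) by (apply Rmult_le_pos; apply pow_le; lra).
assert (c20 : 0 <= c2) by (apply Rmult_le_pos; [apply pos_INR | lra]).
assert (k1 : 1 <= k).
{ assert (0 < / (eps / 2)) by (apply Rinv_0_lt_compat; lra). unfold k; lra. }
assert (P0 : 0 <= P) by (apply pow_le; lra).
assert (c40 : 0 <= c4).
{ assert (0 <= k ^ 2) by apply pow2_ge_0. repeat apply Rmult_le_pos; lra. }
assert (s4 : 1 <= 4 ^ s) by (apply pow_R1_Rle; lra).
assert (s2 : 1 <= 2 ^ S s) by (apply pow_R1_Rle; lra).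
assert (t1 : 1 <= t) by (unfold t; lra).
assert (q01 : 1 <= q0) by (apply pow_R1_Rle; lra).
assert (c0ge : 1 <= c0) by (unfold c0; nra).
exists (q0 + 2 * c0). split; [lra |].
intros n chi N n1 sqf prim om N1 hN.
set (C := q0 + 2 * c0).
set (K := INR r - Dd d) in *.
assert (rK : INR (r - D) = K) by (unfold K; rewrite minus_INR, HD by lia; reflexivity).
assert (K1 : 1 <= K) by (rewrite <- rK; apply (le_INR 1); lia).
assert (r2 : 2 <= INR r) by (apply (le_INR 2); lia).
set (q := INR n) in *.
assert (q1 : 1 <= q) by (apply (le_INR 1); lia).
replace ((INR r + 1 - Dd d) / (4 * INR r * K)) with ((1 / 4 + 1 / (4 * K)) * / INR r)
  by (unfold K; field; fold K; lra).
set (theta := (1 / 4 + 1 / (4 * K)) * / INR r).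
assert (Kinv : 0 < 1 / (4 * K) <= 1 / 4).
{ split; [apply Rdiv_lt_0_compat; lra | apply Rmult_le_compat_l; [lra | apply Rinv_le_contravar; lra]]. }
assert (rinv : 0 < / INR r <= / 2).
{ split; [apply Rinv_0_lt_compat; lra | apply Rinv_le_contravar; lra]. }
assert (th0 : 0 <= theta) by (unfold theta; apply Rmult_le_pos; lra).
set (G := Rpower q eps).
set (v := Rpower q theta).
assert (G1 : 1 <= G) by (apply Rpower_ge_1; lra).
assert (v1 : 1 <= v) by (apply Rpower_ge_1; lra).
replace (1 - 1 / INR r) with (1 - / INR r) by (unfold Rdiv; ring).
set (tau := 1 - / INR r).
assert (C1 : 1 <= C) by (unfold C; lra).
induction N as [N IH] using lt_wf_ind.
set (x := INR N) in *.
assert (x1 : 1 <= x) by (apply (le_INR 1); lia).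
set (u := Rpower x tau).
assert (u1 : 1 <= u) by (apply Rpower_ge_1; unfold tau; lra).
assert (CG : C <= C * G) by nra.
assert (CGu : C * G <= C * G * u) by nra.
assert (CGuv : C * G * u <= C * G * u * v) by nra.
destruct (Rlt_le_dec q q0) as [small | large].
{ apply Burgess.mixed_bound_length; try assumption; fold x.
  assert (x <= q).
  { apply Rle_trans with (1 := hN). rewrite <- (Rpower_1 q) at 2 by lra. apply Rle_Rpower; lra. }
  unfold C in *; lra. }
destruct (Rle_lt_dec x (Rpower q (1 / 4 + 1 / (4 * K)))) as [short | long].
{ apply Burgess.mixed_bound_length; try assumption; fold x.
  apply Rle_trans with (u * v).
  - rewrite <- (Rpower_1 x) at 1 by lra. replace 1 with (tau + / INR r) by (unfold tau; ring).
    rewrite Rpower_plus. apply Rmult_le_compat_l; [fold u; lra |].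
    unfold v, theta. rewrite <- Rpower_mult. apply Rle_Rpower_l; lra.
  - assert (0 <= u * v) by nra. replace (C * G * u * v) with (C * G * (u * v)) by ring. nra. }
(* A large q has a prime factor, so s >= 1 and r >= rd + 2 >= D + 2. *)
assert (K2 : 2 <= K).
{ assert (2 <= n)%nat.
  { destruct n as [|[|n']]; try lia. exfalso. unfold q, q0 in large.
    assert (32 * t <= (32 * t) ^ 8).
    { rewrite <- (pow_1 (32 * t)) at 1. apply Rle_pow; [lra | lia]. }
    simpl INR in large. lra. }
  assert (1 <= omega (Z.of_nat n))%nat by now apply Burgess.omega_gt0.
  rewrite <- rK. apply (le_INR 2). lia. }
destruct (choose_lengths q K t (Rpower q (1 / (2 * K))) N K2 t1 large eq_refl long hN)
  as [A [B [B1 [BL [LB [tA [NAB [ABN AN]]]]]]]].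
fold x in NAB, ABN, AN.
set (a := INR A) in *; set (b := INR B) in *; set (L := Rpower q (1 / (2 * K))) in *.
assert (b1 : 1 <= b) by (apply (le_INR 1); lia).
assert (Kinv2 : 1 / (2 * K) = 2 * (1 / (4 * K))) by (field; lra).
assert (Lq : L <= q).
{ rewrite <- (Rpower_1 q) by lra. apply Rle_Rpower; lra. }
assert (ax : a <= x) by nra.
assert (aq : a <= q) by nra.
assert (l0 : 0 <= ln a) by (rewrite <- ln_1; apply ln_le; lra).
assert (lq : ln a <= ln q) by (apply ln_le; lra).
assert (w2 : (1 + ln a) ^ 2 <= k ^ 2 * G).
{ replace G with (Rpower q (eps / 2) ^ 2)
    by (rewrite Rpower_pow_mult; unfold G; f_equal; simpl; field).
  rewrite <- Rpow_mult_distr. apply pow_incr. split; [lra |].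
  apply Rle_trans with (1 + ln q); [lra |]. apply one_plus_ln_le; lra. }
assert (sq : sqrt q = L ^ (r - D)).
{ unfold L. rewrite Rpower_pow_mult, rK, <- Rpower_sqrt by lra. f_equal. field. lra. }
set (Q := sqrt q) in *.
assert (Q0 : 0 < Q) by (apply sqrt_lt_R0; lra).
assert (QQ : q = Q * Q) by (symmetry; apply sqrt_sqrt; lra).
set (E := C * G * Rpower (x / 16) tau * v).
apply Burgess.mixed_bound_le with (C / 2 * G * u * v + 2 * E).
(* As r >= 2, tau >= 1/2 and 16^tau >= 4: the end segments, of length at most N/16, use up only half
   of the constant. *)
{ assert (E4 : 4 * Rpower (x / 16) tau <= u).
  { unfold u. replace x with (16 * (x / 16)) at 2 by field.
    rewrite <- Rpower_mult_distr by lra. apply Rmult_le_compat_r; [apply Rlt_le, exp_pos |].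
    apply Rle_trans with (Rpower 16 (/ 2)); [| apply Rle_Rpower; unfold tau; lra].
    rewrite Rpower_sqrt by lra. right. symmetry. apply sqrt_lem_1; lra. }
  assert (0 <= C * G * v) by nra.
  assert (C * G * v * (4 * Rpower (x / 16) tau) <= C * G * v * u) by (apply Rmult_le_compat_l; lra).
  unfold E. lra. }
apply Burgess.mixed_bound_step with (s := s) (r := r) (r' := r') (A := A) (B := B); try assumption.
- unfold r'; lia.
- assert (0 <= C / 2 * G) by nra. assert (0 <= C / 2 * G * u) by nra. nra.
- intros h hAB. fold a b in hAB.
  assert (E0 : 0 <= E).
  { unfold E. assert (0 <= Rpower (x / 16) tau) by (apply Rlt_le, exp_pos).
    assert (0 <= C * G) by lra. assert (0 <= C * G * Rpower (x / 16) tau) by nra. nra. }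
  (* The empty segment lies outside the induction hypothesis. *)
  destruct h as [| h']; [apply Burgess.mixed_bound_length; try assumption; exact E0 |].
  set (h := S h') in *.
  assert (h1 : 1 <= INR h) by (apply (le_INR 1); unfold h; lia).
  assert (hx : INR h <= x / 16) by lra.
  apply Burgess.mixed_bound_le with (C * G * Rpower (INR h) tau * v).
  + unfold E. apply Rmult_le_compat_r; [lra |]. apply Rmult_le_compat_l; [lra |].
    apply Rle_Rpower_l; unfold tau; lra.
  + apply IH; [apply INR_lt; fold x; lra | unfold h; lia |].
    apply Rle_trans with (2 := hN). lra.
- fold D a b q x Q.
  apply step_inequality with (L := L) (k := k) (c1 := c1) (c2 := c2); try lra; try lia; try assumption.
  + replace (b ^ (2 * r - D)) with (b ^ (r - D) * b ^ r) by (rewrite <- pow_add; f_equal; lia).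
    assert (Q <= 2 ^ (r - D) * b ^ (r - D)).
    { rewrite sq, <- Rpow_mult_distr. apply pow_incr; lra. }
    assert (0 <= INR r ^ (2 * r) * b ^ r) by (apply Rmult_le_pos; apply pow_le; lra).
    apply Rle_trans with (Q * (2 ^ (r - D) * b ^ (r - D)) * (INR r ^ (2 * r) * b ^ r)).
    * rewrite QQ at 1. apply Rmult_le_compat_r; [lra |]. apply Rmult_le_compat_l; lra.
    * unfold c1; right; ring.
  + unfold c2.
    replace (b ^ (2 * r - D)) with (b ^ (2 * S s) * b ^ (2 * r' - D))
      by (rewrite <- pow_add; f_equal; unfold r'; lia).
    replace (INR (Burgess.mean_const r s) * CJ * (b ^ (2 * S s) * b ^ (2 * r' - D) * G))
      with (INR (Burgess.mean_const r s) * (b ^ (2 * S s) * (CJ * (b ^ (2 * r' - D) * G)))) by ring.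
    apply Rmult_le_compat_l; [apply pos_INR |]. apply Rmult_le_compat_l; [apply pow_le; lra |].
    apply J_bound_scaled; try assumption; [fold b; lra | unfold r'; lia | now apply HJ].
  + unfold u. rewrite Rpower_pow_mult, <- Rpower_pow by lra. f_equal.
    rewrite !mult_INR, minus_INR by lia. unfold tau. simpl; field; lra.
  + unfold v, L, Q. rewrite Rpower_pow_mult, <- Rpower_sqrt, <- Rpower_plus by lra. f_equal.
    rewrite mult_INR. unfold theta. simpl; field; lra.
  + fold P; fold c4. set (z := 1 + 32 * c4) in *.
    assert (zle : z <= C / 2 / 2 ^ S s).
    { apply Rmult_le_reg_r with (2 ^ S s); [lra |].
      replace (C / 2 / 2 ^ S s * 2 ^ S s) with (C / 2) by (field; lra).
      unfold C, c0; lra. }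
    apply Rle_trans with (z ^ (2 * r)).
    * apply Rle_trans with (z ^ 1); [rewrite pow_1; unfold z; lra |].
      apply Rle_pow; [unfold z; lra | lia].
    * apply pow_incr; unfold z in *; lra.
Qed.

Theorem theorem2 :
  forall (d s r rd : nat),
    (1 <= d)%nat -> is_r_d d rd -> (rd + s + 1 <= r)%nat ->
  forall eps : R, 0 < eps ->
  exists Ceps : R,
  forall (q : Z) (chi : Z -> C) (M : Z) (N : nat) (a : nat -> R),
    (1 <= q)%Z -> squarefree q -> (omega q <= s)%nat ->
    primitive_character q chi ->
    (1 <= N)%nat ->
    INR N <= Rpower (IZR q) (1 / 2 + 1 / (4 * (INR r - Dd d))) ->
    a d <> 0 ->
    Cmod (char_exp_sum chi a d M N)
      <= Ceps * Rpower (IZR q) eps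
         * Rpower (INR N) (1 - 1 / INR r)
         * Rpower (IZR q) ((INR r + 1 - Dd d) / (4 * INR r * (INR r - Dd d))).
Proof.
intros d s r rd hd Hrd hr eps e0.
destruct (mixed_bound_burgess d s r rd eps Hrd hr e0) as [C0 [_ H]].
exists C0.
intros q chi M N a q1 sqf om prim N1 hN _.
rewrite <- (Z2Nat.id q) in * by lia.
set (n := Z.to_nat q) in *.
rewrite <- INR_IZR_INZ in *.
assert (n1 : (1 <= n)%nat) by lia.
now apply Burgess.char_exp_sum_bound with (n := n); [| | | apply H].
Qed.
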